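(* Let $G$ be a non-elementary GBS group with non-trivial center $Z$, and let $\kappa,\varepsilon$ be the associated integers. Given positive integers $k$ and $n$, the following are equivalent: (1) $(k,n-1)$ is an integral multiple of $(\kappa,\varepsilon)$; (2) $G/Z$ has a subgroup of index $k$ isomorphic to $\mathbb{F}_n$; (3) $G$ has a subgroup $G_0$ of index $k$ isomorphic to $\mathbb{F}_n\times\mathbb{Z}$, with $Z\subset G_0$; (4) $G$ has a subgroup $G_0$ isomorphic to $\mathbb{F}_n\times\mathbb{Z}$ whose index is finite and equal to $k\,[Z:G_0\cap Z]$.
   Context: A GBS group (generalized Baumslag-Solitar group) is the fundamental group of a finite graph of groups all of whose vertex and edge groups are infinite cyclic. It is non-elementary if it is not isomorphic to $\mathbb{Z}$, $\mathbb{Z}^2$, or the Klein bottle group. For a non-elementary GBS group $G$ with non-trivial center $Z$, $Z$ is infinite cyclic and $G/Z$ is virtually free; one defines: $\kappa$ is the least common multiple of the orders of the torsion elements of $G/Z$; $\varepsilon+1$ is the smallest rank of a free subgroup of finite index of $G/Z$. $\mathbb{F}_n$ is the free group of rank $n$. *)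

(* Defs.v *)
From HB Require Import structures.
From mathcomp Require Import all_boot all_order all_algebra.
From mathcomp Require Import boolp classical_sets functions cardinality.

Set Implicit Arguments.
Unset Strict Implicit.
Unset Printing Implicit Defensive.

Import Order.TTheory GRing.Theory Num.Theory.

Local Open Scope quotient_scope.
Local Open Scope classical_set_scope.
Local Open Scope card_scope.
Local Open Scope group_scope.

Definition isog (G H : groupType) : Prop :=
  exists f : {multiplicative G -> H}, bijective f.

(* ℤ written multiplicatively: `x * y` is the sum of the integers x and y. *)
Definition Zgroup : Type := int.
HB.instance Definition _ := Choice.copy Zgroup int.
HB.instance Definition _ := isGroup.Build Zgroup
  (@addrA int) (@add0r int) (@addr0 int) (@addNr int) (@addrN int).

(* The group presented by the generators X and the relations "u = v" for
   R u v. In a word, the letter (x, false) stands for x and (x, true) for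
   x^-1. *)
Section Presentation.
Variables (X : choiceType) (R : seq (X * bool) -> seq (X * bool) -> Prop).

Inductive word_eq : seq (X * bool) -> seq (X * bool) -> Prop :=
| word_eq_refl u : word_eq u u
| word_eq_sym u v : word_eq u v -> word_eq v u
| word_eq_trans v u w : word_eq u v -> word_eq v w -> word_eq u w
| word_eq_cat u u' v v' :
    word_eq u u' -> word_eq v v' -> word_eq (u ++ v) (u' ++ v')
| word_eq_cancel x b : word_eq [:: (x, b); (x, ~~ b)] [::]
| word_eq_rel u v : R u v -> word_eq u v.

Definition word_eqb u v := `[< word_eq u v >].

Lemma word_eqb_refl : reflexive word_eqb.
Proof. by move=> u; apply/asboolP; exact: word_eq_refl. Qed.

Lemma word_eqb_sym : symmetric word_eqb.
Proof. by move=> u v; apply: asbool_equiv_eq; split; apply: word_eq_sym. Qed.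

Lemma word_eqb_trans : transitive word_eqb.
Proof.
move=> v u w /asboolP uv /asboolP vw; apply/asboolP; exact: word_eq_trans vw.
Qed.

Canonical word_equiv :=
  EquivRel word_eqb word_eqb_refl word_eqb_sym word_eqb_trans.

Definition presented := {eq_quot word_equiv}.
HB.instance Definition _ := Choice.on presented.
HB.instance Definition _ := EqQuotient.on presented.

Definition word_inv (u : seq (X * bool)) := rev [seq (a.1, ~~ a.2) | a <- u].

Lemma word_eqP u v : reflect (word_eq u v) (\pi_presented u == \pi_presented v).
Proof. by rewrite piE; exact: asboolP. Qed.

Lemma word_eq_repr u : word_eq (repr (\pi_presented u)) u.
Proof. by apply/word_eqP; rewrite reprK. Qed.

Lemma word_invK : involutive word_inv.
Proof.
move=> u; rewrite /word_inv map_rev revK -map_comp -[RHS]map_id.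
by apply: eq_map => -[x b] /=; rewrite negbK.
Qed.

Lemma word_inv_cat u v : word_inv (u ++ v) = word_inv v ++ word_inv u.
Proof. by rewrite /word_inv map_cat rev_cat. Qed.

Lemma word_mulVg u : word_eq (word_inv u ++ u) [::].
Proof.
elim: u => [|[x b] u IHu]; first exact: word_eq_refl.
rewrite -cat1s word_inv_cat -catA (catA _ _ u).
apply: word_eq_trans IHu; apply: word_eq_cat; first exact: word_eq_refl.
rewrite -[X in word_eq _ X]cat0s; apply: word_eq_cat (word_eq_refl _).
by have := word_eq_cancel x (~~ b); rewrite negbK.
Qed.

Lemma word_mulgV u : word_eq (u ++ word_inv u) [::].
Proof. by have := word_mulVg (word_inv u); rewrite word_invK. Qed.

Lemma word_eq_inv u v : word_eq u v -> word_eq (word_inv u) (word_inv v).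
Proof.
move=> uv.
apply: (@word_eq_trans (word_inv u ++ (v ++ word_inv v))).
  rewrite -[X in word_eq X]cats0; apply: word_eq_cat (word_eq_refl _) _.
  by apply: word_eq_sym; exact: word_mulgV.
rewrite catA -[X in word_eq _ X]cat0s; apply: word_eq_cat (word_eq_refl _).
apply: word_eq_trans (word_mulVg u).
by apply: word_eq_cat (word_eq_refl _) _; exact: word_eq_sym.
Qed.

Definition pmul (a b : presented) := \pi_presented (repr a ++ repr b).
Definition pone := \pi_presented [::].
Definition pinv (a : presented) := \pi_presented (word_inv (repr a)).

Lemma pmulE u v :
  pmul (\pi_presented u) (\pi_presented v) = \pi_presented (u ++ v).
Proof. by apply/eqP/word_eqP; apply: word_eq_cat; exact: word_eq_repr. Qed.

Lemma pinvE u : pinv (\pi_presented u) = \pi_presented (word_inv u).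
Proof. by apply/eqP/word_eqP; apply: word_eq_inv; exact: word_eq_repr. Qed.

Lemma pmulA : associative pmul.
Proof.
move=> a b c; elim/quotW: a => u; elim/quotW: b => v; elim/quotW: c => w.
by rewrite (pmulE v w) (pmulE u v) (pmulE u) (pmulE (u ++ v)) catA.
Qed.

Lemma pmul1 : left_id pone pmul.
Proof. by elim/quotW=> u; rewrite pmulE. Qed.

Lemma pmulr1 : right_id pone pmul.
Proof. by elim/quotW=> u; rewrite pmulE cats0. Qed.

Lemma pmulV : left_inverse pone pinv pmul.
Proof.
by elim/quotW=> u; rewrite pinvE pmulE; apply/eqP/word_eqP; exact: word_mulVg.
Qed.

Lemma pmulrV : right_inverse pone pinv pmul.
Proof.
by elim/quotW=> u; rewrite pinvE pmulE; apply/eqP/word_eqP; exact: word_mulgV.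
Qed.

HB.instance Definition _ := isGroup.Build presented
  pmulA pmul1 pmulr1 pmulV pmulrV.

End Presentation.

Definition free_group (n : nat) : groupType :=
  presented (fun _ _ : seq ('I_n * bool) => False).

(* ⟨ a, b | a b a^-1 = b^-1 ⟩ with a, b encoded as false, true. *)
Definition klein_bottle_group : groupType :=
  presented (fun u v : seq (bool * bool) =>
    u = [:: (false, false); (true, false); (false, true)] /\
    v = [:: (true, true)]).

(* A finite graph with geometric edges E, each with a chosen orientation;
   loops and multiple edges are allowed. *)
Record graph_of_groups := GraphOfGroups {
  vertex : finType;
  edge : finType;
  src : edge -> vertex;
  tgt : edge -> vertex;
  vgrp : vertex -> groupType;
  egrp : edge -> groupType;
  src_mor : forall e, {multiplicative egrp e -> vgrp (src e)};
  tgt_mor : forall e, {multiplicative egrp e -> vgrp (tgt e)};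
  src_mor_inj : forall e, injective (src_mor e);
  tgt_mor_inj : forall e, injective (tgt_mor e) }.

Section FundamentalGroup.
Variable A : graph_of_groups.

Definition adjacent (T : {set edge A}) : rel (vertex A) :=
  [rel u v | [exists e in T, ((src e == u) && (tgt e == v))
                          || ((src e == v) && (tgt e == u))]].

(* Acyclicity: an edge of T lies on a circuit of T iff its endpoints can be
   joined by a path of T avoiding it. *)
Definition spanning_tree (T : {set edge A}) : Prop :=
  [/\ (0 < #|vertex A|)%N,
      forall u v, connect (adjacent T) u v
    & forall e, e \in T -> ~~ connect (adjacent (T :\ e)) (src e) (tgt e)].

Definition pi1_gen : choiceType := ({v : vertex A & vgrp v} + edge A)%type.

Definition vgen (v : vertex A) (x : vgrp v) : pi1_gen :=
  inl (Tagged (fun v => vgrp v) x).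
Definition egen (e : edge A) : pi1_gen := inr e.

(* Serre's π₁(A, T): the vertex groups and one stable letter per edge, the
   letters of T being trivial. *)
Inductive pi1_rel (T : {set edge A}) :
    seq (pi1_gen * bool) -> seq (pi1_gen * bool) -> Prop :=
| Pi1Vertex v (x y : vgrp v) :
    pi1_rel T [:: (vgen x, false); (vgen y, false)] [:: (vgen (x * y), false)]
| Pi1Edge e (c : egrp e) :
    pi1_rel T
      [:: (egen e, false); (vgen (tgt_mor e c), false); (egen e, true)]
      [:: (vgen (src_mor e c), false)]
| Pi1Tree e : e \in T -> pi1_rel T [:: (egen e, false)] [::].

Definition pi1 (T : {set edge A}) : groupType := presented (pi1_rel T).

End FundamentalGroup.

Definition infinite_cyclic (G : groupType) : Prop := isog Zgroup G.

(* Up to isomorphism, pi1 A T does not depend on T. *)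
Definition is_GBS (G : groupType) : Prop :=
  exists (A : graph_of_groups) (T : {set edge A}),
    [/\ spanning_tree T,
        forall v : vertex A, infinite_cyclic (vgrp v),
        forall e : edge A, infinite_cyclic (egrp e)
      & isog G (pi1 T)].

Definition non_elementary (G : groupType) : Prop :=
  [/\ ~ isog G Zgroup, ~ isog G (Zgroup * Zgroup)%type
    & ~ isog G klein_bottle_group].

Definition is_subgroup (G : groupType) (H : set G) : Prop :=
  [/\ H 1, forall x y, H x -> H y -> H (x * y) & forall x, H x -> H x^-1].

(* [K : H] is finite and equal to n, counted with left cosets. *)
Definition has_index (G : groupType) (K H : set G) (n : nat) : Prop :=
  [set [set x * h | h in H] | x in K] #= `I_n.

Definition subgroup_isog (K G : groupType) (H : set G) : Prop :=
  exists f : {multiplicative K -> G}, injective f /\ range f = H.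

Section CenterQuotient.
Variable G : groupType.

Definition center : set G := [set z | forall x, z * x = x * z].

Lemma center1 : center 1.
Proof. by move=> x; rewrite mul1g mulg1. Qed.

Lemma centerM x y : center x -> center y -> center (x * y).
Proof. by move=> zx zy z; rewrite -mulgA zy !mulgA zx. Qed.

Lemma centerV x : center x -> center x^-1.
Proof.
by move=> zx z; apply: (mulgI x); rewrite mulgA mulgV mul1g mulgA zx mulgK.
Qed.

Definition eq_mod_center (x y : G) := `[< center (x^-1 * y) >].

Lemma eq_mod_center_refl : reflexive eq_mod_center.
Proof. by move=> x; apply/asboolP; rewrite mulVg; exact: center1. Qed.

Lemma eq_mod_center_sym : symmetric eq_mod_center.
Proof.
move=> x y; apply: asbool_equiv_eq.
by split=> /centerV; rewrite invgM invgK.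
Qed.

Lemma eq_mod_center_trans : transitive eq_mod_center.
Proof.
move=> y x z /asboolP xy /asboolP yz; apply/asboolP.
by have := centerM xy yz; rewrite mulgA mulgK.
Qed.

Canonical eq_mod_center_equiv := EquivRel eq_mod_center
  eq_mod_center_refl eq_mod_center_sym eq_mod_center_trans.

Definition center_quot := {eq_quot eq_mod_center_equiv}.
HB.instance Definition _ := Choice.on center_quot.
HB.instance Definition _ := EqQuotient.on center_quot.

Lemma center_quotP x y :
  reflect (center (x^-1 * y)) (\pi_center_quot x == \pi_center_quot y).
Proof. by rewrite piE; exact: asboolP. Qed.

Lemma center_repr x : center ((repr (\pi_center_quot x))^-1 * x).
Proof. by apply/center_quotP; rewrite reprK. Qed.

Definition qmul (a b : center_quot) := \pi_center_quot (repr a * repr b).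
Definition qone := \pi_center_quot 1.
Definition qinv (a : center_quot) := \pi_center_quot (repr a)^-1.

Lemma qmulE x y :
  qmul (\pi_center_quot x) (\pi_center_quot y) = \pi_center_quot (x * y).
Proof.
apply/eqP/center_quotP; rewrite invgM.
set y' := repr _; set x' := repr _.
have zx : center (x'^-1 * x) by exact: center_repr.
have zy : center (y'^-1 * y) by exact: center_repr.
have -> : y'^-1 * x'^-1 * (x * y) = (x'^-1 * x) * (y'^-1 * y).
  by rewrite [RHS]mulgA zx !mulgA.
exact: centerM.
Qed.

Lemma qinvE x : qinv (\pi_center_quot x) = \pi_center_quot x^-1.
Proof.
apply/eqP/center_quotP; rewrite invgK.
set x' := repr _.
have zx : center (x'^-1 * x) by exact: center_repr.
have -> : x' * x^-1 = (x'^-1 * x)^-1.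
  apply: (mulIg (x'^-1 * x)); rewrite mulVg -mulgA -zx mulgA.
  by rewrite mulgA mulgV mul1g mulgV.
exact: centerV.
Qed.

Lemma qmulA : associative qmul.
Proof.
move=> a b c; elim/quotW: a => x; elim/quotW: b => y; elim/quotW: c => z.
by rewrite (qmulE y z) (qmulE x y) (qmulE x) (qmulE (x * y)) mulgA.
Qed.

Lemma qmul1 : left_id qone qmul.
Proof. by elim/quotW=> x; rewrite qmulE mul1g. Qed.

Lemma qmulr1 : right_id qone qmul.
Proof. by elim/quotW=> x; rewrite qmulE mulg1. Qed.

Lemma qmulV : left_inverse qone qinv qmul.
Proof. by elim/quotW=> x; rewrite qinvE qmulE mulVg. Qed.

Lemma qmulrV : right_inverse qone qinv qmul.
Proof. by elim/quotW=> x; rewrite qinvE qmulE mulgV. Qed.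

HB.instance Definition _ := isGroup.Build center_quot
  qmulA qmul1 qmulr1 qmulV qmulrV.

End CenterQuotient.

Arguments center : clear implicits.

(* x is a torsion element, of order d. *)
Definition has_order (G : groupType) (x : G) (d : nat) : Prop :=
  [/\ (0 < d)%N, x ^+ d = 1
    & forall m, (0 < m)%N -> x ^+ m = 1 -> (d <= m)%N].

Definition is_lcm (D : set nat) (l : nat) : Prop :=
  (forall d, D d -> (d %| l)%N) /\
  (forall m, (forall d, D d -> (d %| m)%N) -> (l %| m)%N).

(* `xget 0 P` is the element of P (unique in both uses below), and 0 if P is
   empty. The set in `kappa` is never empty: 0 is the lcm of an unbounded set.
   The one in `epsilon` is non-empty exactly when G/Z is virtually free of
   finite rank, as for a non-elementary GBS group with non-trivial center. *)
Definition kappa (G : groupType) : nat :=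
  xget 0%N
    (is_lcm [set d | exists x : center_quot G, has_order x d]).

Definition finite_index_free_rank (Q : groupType) : set nat :=
  [set r | exists H : set Q, [/\ is_subgroup H,
     exists m, has_index setT H m & subgroup_isog (free_group r) H]].

Definition epsilon (G : groupType) : int :=
  (Posz (xget 0%N
     [set r | finite_index_free_rank (center_quot G) r /\
        forall s, finite_index_free_rank (center_quot G) s -> (r <= s)%N])
   - 1)%R.

(* Main.v *)
(** A GBS group G acts on the rational line by affine maps in which the
    generators of the vertex groups are non-trivial translations. A subgroup
    whose image contains no non-trivial translation meets no conjugate of a
    vertex group, so it acts freely on the Bass-Serre tree and is free. Now let
    z <> 1 be central. If the linear part of some g is not 1, then z acts
    trivially; if moreover it is not -1, then <g, z> is free and abelian, hence
    cyclic, which is absurd; and if it is -1, then G is the Klein bottle group.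
    Otherwise G acts by translations, and rescaling gives a surjection
    theta : G -> Z whose kernel N is free of finite rank r > 1, as G is not
    elementary.

    Some power of every vertex generator is central,
      N meets the center trivially
    and the center is <c> with theta c = L > 0. The image of N in the quotient
      by
    the center is free of rank r and of index L = kappa. Comparing ranks of
    finite index subgroups by Schreier's formula yields r - 1 = epsilon and
    (n - 1) kappa = k epsilon for every subgroup of index k isomorphic to F_n;
    kappa divides k since torsion elements act freely on the cosets. A subgroup
    of the quotient isomorphic to F_n lifts to F_n x Z. Conversely, an element u
    commuting with a finite index subgroup of G is central: as roots are unique
    in N, it centralizes N, and so does g u g^-1 for all g; but u^-1 g u g^-1
    lies in N, whose center is trivial. *)
From HB Require Import structures.
From mathcomp Require Import all_boot all_order all_algebra.
From mathcomp Require Import boolp classical_sets functions cardinality.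
From mathcomp Require Import ring zify.
Require Import Defs.
Set Implicit Arguments.
Unset Strict Implicit.
Unset Printing Implicit Defensive.

Import Order.TTheory GRing.Theory Num.Theory.

Local Open Scope classical_set_scope.
Local Open Scope card_scope.
Local Open Scope group_scope.

(** * Subgroups, powers and affine maps of the rational line *)

(** The action on the line is found by choosing the translation lengths of the vertex generators
    compatibly along the spanning tree: its stable letters can then act trivially, and every other
    stable letter gets the homothety that its relation dictates.

    The Bass-Serre tree enters only through its quotient by a freely acting subgroup H, encoded by
    double cosets. That H is free on the edges outside a maximal tree is proved as a universal
    property: weights on these edges define a homomorphism from G to a wreath product, hence a
    crossed homomorphism, whose restriction to H is read off at the identity. The same theorem for
    bouquets shows that subgroups of free groups are free and, by counting edges, yields Schreier's
    formula.

    Free subgroups are handled through the property that all their subgroups have bases. Torsion,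
    commuting pairs, centers and roots are then studied inside the subgroup generated by one or two
    elements, whose basis is empty or a singleton in the relevant cases. *)

Definition morph (G K : groupType) (f : G -> K) :=
  forall x y, f (x * y) = f x * f y.

Section Morph.
Variables (G K : groupType) (f : G -> K).
Hypothesis fM : morph f.

Lemma morph1 : f 1 = 1.
Proof. by apply: (mulgI (f 1)); rewrite -fM !mulg1. Qed.

Lemma morphV x : f x^-1 = (f x)^-1.
Proof. by apply: (mulgI (f x)); rewrite -fM !mulgV morph1. Qed.

Lemma morph_bundle :
  exists F : {multiplicative G -> K}, (F : G -> K) = f.
Proof.
have m1 : f 1 = 1 := morph1.
pose M := isUMagmaMorphism.Build G K f (conj m1 fM).
pose F : {multiplicative G -> K} := HB.pack f M.
by exists F.
Qed.

Lemma morph_kernel_subgroup : is_subgroup [set x | f x = 1].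
Proof.
split=> [|x y /= fx fy|x /= fx]; first exact: morph1.
  by rewrite fM fx fy mulg1.
by rewrite morphV fx invg1.
Qed.

Lemma morph_preimage_subgroup (H : set K) :
  is_subgroup H -> is_subgroup (f @^-1` H).
Proof.
move=> [H1 HM HV]; split=> [|x y /= fx fy|x /= fx].
- by rewrite /= morph1.
- by rewrite /= fM; exact: HM.
- by rewrite /= morphV; exact: HV.
Qed.

Lemma morph_image_subgroup (H : set G) :
  is_subgroup H -> is_subgroup (f @` H).
Proof.
move=> [H1 HM HV]; split.
- by exists 1 => //; exact: morph1.
- by move=> _ _ [x Hx <-] [y Hy <-]; exists (x * y); [exact: HM|exact: fM].
- by move=> _ [x Hx <-]; exists x^-1; [exact: HV|exact: morphV].
Qed.

Lemma morph_inj : (forall x, f x = 1 -> x = 1) -> injective f.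
Proof.
move=> f1 x y fxy; apply/divg1_eq/f1.
by rewrite fM morphV fxy mulgV.
Qed.

End Morph.

Lemma multiplicative_morph (G K : groupType) (f : {multiplicative G -> K}) :
  morph f.
Proof. by move=> x y; rewrite gmulfM. Qed.

Lemma morph_comp (G K L : groupType) (f : G -> K) (g : K -> L) :
  morph f -> morph g -> morph (g \o f).
Proof. by move=> fM gM x y; rewrite /= fM gM. Qed.

Section Subgroup.
Variable G : groupType.
Implicit Types (H S : set G).

Lemma subgroupI H1 H2 :
  is_subgroup H1 -> is_subgroup H2 -> is_subgroup (H1 `&` H2).
Proof.
move=> [a1 aM aV] [b1 bM bV]; split=> //.
- by move=> x y [? ?] [? ?]; split; [exact: aM|exact: bM].
- by move=> x [? ?]; split; [exact: aV|exact: bV].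
Qed.

Lemma subgroupT : is_subgroup [set: G].
Proof. by []. Qed.

Lemma subgroup_div H x y : is_subgroup H -> H x -> H y -> H (x * y^-1).
Proof. by move=> [_ HM HV] Hx Hy; apply/HM/HV. Qed.

Definition generated S : set G :=
  [set g | forall H, is_subgroup H -> S `<=` H -> H g].

Lemma generated_subgroup S : is_subgroup (generated S).
Proof.
split=> [H [] //|x y Sx Sy H HH SH|x Sx H HH SH]; have [_ HM HV] := HH.
- by apply: HM; [exact: Sx|exact: Sy].
- by apply: HV; exact: Sx.
Qed.

Lemma sub_generated S : S `<=` generated S.
Proof. by move=> x Sx H _; exact. Qed.

Lemma generated_min S H : is_subgroup H -> S `<=` H -> generated S `<=` H.
Proof. by move=> HH SH x; exact. Qed.

Definition zexp (x : G) (i : int) : G :=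
  match i with Posz n => x ^+ n | Negz n => (x ^+ n.+1)^-1 end.

Lemma zexpS x (i : int) : zexp x (i + 1)%R = zexp x i * x.
Proof.
case: i => n; first by rewrite -PoszD addn1 /= expgSr.
case: n => [|n]; first by rewrite /= mulVg.
have -> : (Negz n.+1 + 1 = Negz n)%R by lia.
by rewrite /= (expgS x n.+1) invgM mulgVK.
Qed.

Lemma zexpP x (i : int) : zexp x (i - 1)%R = zexp x i * x^-1.
Proof. by apply: (mulIg x); rewrite -zexpS subrK mulgVK. Qed.

Lemma zexpD x (i j : int) : zexp x (i + j)%R = zexp x i * zexp x j.
Proof.
elim/int_rect: j => [|n IH|n IH]; first by rewrite addr0 mulg1.
  have -> : Posz n.+1 = (Posz n + 1)%R by lia.
  by rewrite addrA !zexpS IH mulgA.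
have -> : (- Posz n.+1 = - Posz n - 1)%R by lia.
by rewrite addrA !zexpP IH mulgA.
Qed.

Lemma zexp_morph x : morph (zexp x : Zgroup -> G).
Proof. exact: zexpD. Qed.

Lemma zexp1 x : zexp x 1 = x. Proof. by []. Qed.

Lemma zexpN x (i : int) : zexp x (- i)%R = (zexp x i)^-1.
Proof. by apply: (mulgI (zexp x i)); rewrite -zexpD subrr mulgV. Qed.

Lemma zexpM x (i j : int) : zexp x (i * j)%R = zexp (zexp x i) j.
Proof.
elim/int_rect: j => [|n IH|n IH]; first by rewrite mulr0.
  have -> : Posz n.+1 = (Posz n + 1)%R by lia.
  by rewrite zexpS mulrDr mulr1 zexpD IH.
have -> : (- Posz n.+1 = - Posz n - 1)%R by lia.
by rewrite zexpP mulrBr mulr1 zexpD IH (zexpN x i).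
Qed.

Lemma zexp1g (i : int) : zexp 1 i = 1.
Proof. by case: i => n; rewrite /zexp expg1n ?invg1. Qed.

Lemma zexp_in H x (i : int) : is_subgroup H -> H x -> H (zexp x i).
Proof.
move=> [H1 HM HV] Hx.
have Hn n : H (x ^+ n) by elim: n => // n IH; rewrite expgS; exact: HM.
by case: i => n //=; exact: HV.
Qed.

Lemma commute_zexp (x y : G) i : commute x y -> commute x (zexp y i).
Proof.
move=> xy; case: i => n /=; first exact: commuteX.
by apply: commuteV; exact: commuteX.
Qed.

Lemma commute_zexp2 (x y : G) i j :
  commute x y -> commute (zexp x i) (zexp y j).
Proof.
move=> xy; apply: commute_zexp; apply: commute_sym.
by apply: commute_zexp; apply: commute_sym.
Qed.

Lemma zexpMn (x y : G) i :
  commute x y -> zexp (x * y) i = zexp x i * zexp y i.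
Proof.
move=> xy; elim/int_rect: i => [|n IH|n IH]; first by rewrite mulg1.
  have -> : Posz n.+1 = (Posz n + 1)%R by lia.
  rewrite !zexpS IH -!mulgA; congr (_ * _).
  rewrite !mulgA; congr (_ * _).
  by apply: commute_sym; apply: commute_zexp.
have -> : (- Posz n.+1 = - Posz n - 1)%R by lia.
rewrite !zexpP IH xy invgM -!mulgA; congr (_ * _).
rewrite !mulgA; congr (_ * _).
apply: commute_sym; apply: commute_zexp.
by apply: commute_sym; apply: commuteV; apply: commute_sym.
Qed.

Lemma zexp_conj (x g : G) i : zexp (g * x * g^-1) i = g * zexp x i * g^-1.
Proof.
elim/int_rect: i => [|n IH|n IH]; first by rewrite /= mulg1 mulgV.
  have -> : Posz n.+1 = (Posz n + 1)%R by lia.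
  by rewrite !zexpS IH !mulgA mulgVK.
have -> : (- Posz n.+1 = - Posz n - 1)%R by lia.
by rewrite !zexpP IH !invgM invgK !mulgA mulgVK.
Qed.

Lemma generated1_zexp (x g : G) :
  generated [set x] g -> exists i, g = zexp x i.
Proof.
move=> gx; apply: (gx [set g | exists i, g = zexp x i]).
  split; first by exists 0%R.
    by move=> _ _ [i ->] [j ->]; exists (i + j)%R; rewrite zexpD.
  by move=> _ [i ->]; exists (- i)%R; rewrite zexpN.
by move=> _ ->; exists 1%R.
Qed.

Lemma generated2_zexp (x y g : G) : commute x y ->
  generated [set x; y] g -> exists i j, g = zexp x i * zexp y j.
Proof.
move=> xy gx; apply: (gx [set g | exists i j, g = zexp x i * zexp y j]).
  split; first by exists 0%R, 0%R; rewrite mulg1.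
    move=> _ _ [i [j ->]] [i' [j' ->]]; exists (i + i')%R, (j + j')%R.
    rewrite !zexpD -!mulgA; congr (_ * _); rewrite !mulgA; congr (_ * _).
    by apply: commute_zexp2; apply: commute_sym.
  move=> _ [i [j ->]]; exists (- i)%R, (- j)%R.
  rewrite !zexpN invgM; apply: commuteV; apply: commute_sym; apply: commuteV.
  by apply: commute_zexp2.
move=> _ [->|->]; first by exists 1%R, 0%R; rewrite mulg1.
by exists 0%R, 1%R; rewrite mul1g.
Qed.

End Subgroup.

Lemma morph_zexp (G K : groupType) (f : G -> K) x i :
  morph f -> f (zexp x i) = zexp (f x) i.
Proof.
move=> fM; elim/int_rect: i => [|n IH|n IH]; first exact: (morph1 fM).
  have -> : Posz n.+1 = (Posz n + 1)%R by lia.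
  by rewrite !zexpS fM IH.
have -> : (- Posz n.+1 = - Posz n - 1)%R by lia.
by rewrite !zexpP fM IH (morphV fM).
Qed.

Lemma zexp_Zgroup (x : Zgroup) (i : int) : zexp x i = (i * x)%R.
Proof.
elim/int_rect: i => [|n IH|n IH]; first by rewrite mul0r.
  have -> : Posz n.+1 = (Posz n + 1)%R by lia.
  by rewrite zexpS IH mulrDl mul1r.
have -> : (- Posz n.+1 = - Posz n - 1)%R by lia.
by rewrite zexpP IH mulrBl mul1r.
Qed.

(** Euclidean division by the least positive element; d is 0 when there is none. *)
Lemma Zgroup_subgroup (H : set Zgroup) : is_subgroup H ->
  exists d : nat, H = [set x : int | (d %| x)%Z].
Proof.
move=> HH; have [H1 HM HV] := HH.
have Hz (x i : int) : H x -> H (i * x)%R.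
  by move=> Hx; rewrite -zexp_Zgroup; exact: zexp_in.
have [[d0 [d0_gt0 Hd0]]|H0] := pselect (exists d : nat,
  (0 < d)%N /\ H (Posz d)).
  have exd : exists d : nat, (0 < d)%N && `[< H (Posz d) >].
    by exists d0; rewrite d0_gt0; apply/asboolP.
  case: (ex_minnP exd) => d /andP[d_gt0 /asboolP Hd] dmin.
  exists d; rewrite eqEsubset; split=> x /=; last first.
    by move=> /dvdzP[q ->]; exact: Hz.
  move=> Hx; apply: contrapT => ndx.
  have Hr : H (x %% d)%Z.
    have -> : (x %% d)%Z = (x + (- (x %/ d)%Z) * d)%R.
      by rewrite {2}(divz_eq x d) mulNr addrAC subrr add0r.
    by apply: HM => //; exact: Hz.
  have r_ge0 : (0 <= (x %% d)%Z)%R by apply: modz_ge0; lia.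
  have r_lt : ((x %% d)%Z < d)%R by apply: ltz_pmod; lia.
  have r_neq0 : (x %% d)%Z <> 0 by move=> r0; apply: ndx; apply/dvdz_mod0P.
  have := dmin `|(x %% d)%Z|%N.
  have -> : Posz `|(x %% d)%Z|%N = (x %% d)%Z by lia.
  have -> : (0 < `|(x %% d)%Z|)%N by lia.
  by move/(_ (introT (asboolP _) Hr)); lia.
exists 0%N; rewrite eqEsubset; split=> x /=; last first.
  by rewrite dvd0z => /eqP ->.
move=> Hx; rewrite dvd0z; apply/negPn/negP => x0; apply: H0.
exists `|x|%N; split; first by lia.
have [x_ge0|x_lt0] := lerP 0%R x; first by have -> : Posz `|x|%N = x by lia.
have -> : Posz `|x|%N = (- x)%R by lia.
exact: HV.
Qed.

(* The affine maps b |-> l b + t of the rational line, as pairs (l, t). *)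
Definition aff : Type := ({l : rat | l != 0%R} * rat)%type.
HB.instance Definition _ := Choice.on aff.

Definition scale (a : aff) : rat := val a.1.
Definition shift (a : aff) : rat := a.2.
Definition mkaff (l : rat) (l0 : l != 0%R) (t : rat) : aff := (exist _ l l0, t).

Lemma scale_neq0 a : scale a != 0%R.
Proof. exact: (valP a.1). Qed.

Lemma aff_ext a b : scale a = scale b -> shift a = shift b -> a = b.
Proof. by case: a b => [a1 a2] [b1 b2];
  rewrite /scale /shift /= => /val_inj -> ->. Qed.

Definition aff_mul (a b : aff) : aff :=
  mkaff (mulf_neq0 (scale_neq0 a) (scale_neq0 b))
    (shift a + scale a * shift b)%R.
Definition aff_one : aff := mkaff (oner_neq0 _) 0%R.
Definition aff_inv (a : aff) : aff :=
  mkaff (invr_neq0 (scale_neq0 a)) (- (scale a)^-1 * shift a)%R.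

Section AffineLaws.
Let scaleE a b : scale (aff_mul a b) = (scale a * scale b)%R := erefl.
Let shiftE a b : shift (aff_mul a b) = (shift a + scale a * shift b)%R := erefl.
Let scale1E : scale aff_one = 1%R := erefl.
Let shift1E : shift aff_one = 0%R := erefl.
Let scaleVE a : scale (aff_inv a) = (scale a)^-1%R := erefl.
Let shiftVE a : shift (aff_inv a) = (- (scale a)^-1 * shift a)%R := erefl.
Let affE := (scaleE, shiftE, scale1E, shift1E, scaleVE, shiftVE).

Lemma aff_mulA : associative aff_mul.
Proof. by move=> a b c; apply: aff_ext; rewrite !affE; ring. Qed.
Lemma aff_mul1 : left_id aff_one aff_mul.
Proof. by move=> a; apply: aff_ext; rewrite !affE; ring. Qed.
Lemma aff_mulr1 : right_id aff_one aff_mul.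
Proof. by move=> a; apply: aff_ext; rewrite !affE; ring. Qed.
Lemma aff_mulV : left_inverse aff_one aff_inv aff_mul.
Proof.
by move=> a; have a0 := scale_neq0 a; apply: aff_ext; rewrite !affE; field.
Qed.
Lemma aff_mulrV : right_inverse aff_one aff_inv aff_mul.
Proof.
by move=> a; have a0 := scale_neq0 a; apply: aff_ext; rewrite !affE; field.
Qed.

End AffineLaws.

HB.instance Definition _ := isGroup.Build aff
  aff_mulA aff_mul1 aff_mulr1 aff_mulV aff_mulrV.

Lemma scaleM (a b : aff) : scale (a * b) = (scale a * scale b)%R.
Proof. by []. Qed.
Lemma shiftM (a b : aff) : shift (a * b) = (shift a + scale a * shift b)%R.
Proof. by []. Qed.
Lemma scale1 : scale 1 = 1%R. Proof. by []. Qed.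
Lemma shift1 : shift 1 = 0%R. Proof. by []. Qed.
Lemma scaleV (a : aff) : scale a^-1 = (scale a)^-1%R.
Proof. by []. Qed.
Lemma shiftV (a : aff) : shift a^-1 = (- (scale a)^-1 * shift a)%R.
Proof. by []. Qed.

Lemma scale_zexp (a : aff) (i : int) : scale (zexp a i) = (scale a ^ i)%R.
Proof.
have a0 : scale a \is a GRing.unit by rewrite unitfE scale_neq0.
elim/int_rect: i => [|n IH|n IH]; first by rewrite expr0z.
  have -> : Posz n.+1 = (Posz n + 1)%R by lia.
  by rewrite zexpS scaleM IH expfzDr ?scale_neq0 // expr1z.
have -> : (- Posz n.+1 = - Posz n - 1)%R by lia.
by rewrite zexpP scaleM scaleV IH expfzDr ?scale_neq0 // exprN1.
Qed.

Lemma shift_zexp (a : aff) (i : int) :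
  scale a = 1%R -> shift (zexp a i) = (i%:~R * shift a)%R.
Proof.
move=> a1; have sc j : scale (zexp a j) = 1%R by rewrite scale_zexp a1 exp1rz.
elim/int_rect: i => [|n IH|n IH]; first by rewrite mul0r.
  have -> : Posz n.+1 = (Posz n + 1)%R by lia.
  by rewrite zexpS shiftM IH sc intrD; ring.
have -> : (- Posz n.+1 = - Posz n - 1)%R by lia.
by rewrite zexpP shiftM IH sc shiftV a1 intrB invr1; ring.
Qed.

(** Conjugates of non-trivial translations are non-trivial translations: a subgroup acting without
    them therefore avoids all conjugates of vertex groups. *)
Lemma mul_shift (g a : aff) : scale a = 1%R ->
  g * a * g^-1 = mkaff (oner_neq0 _) (scale g * shift a)%R.
Proof.
move=> a1; have g0 := scale_neq0 g.
apply: aff_ext.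
  by rewrite !scaleM scaleV a1 mulr1 mulfV.
by rewrite !shiftM !scaleM shiftV a1 /=; field.
Qed.

(** * Spanning trees of possibly infinite graphs *)

Section SpanningTree.
Variables (I J : Type) (V : set J) (E : set I) (s t : I -> J) (u0 : J).
Hypotheses (sV : forall e, E e -> V (s e)) (tV : forall e, E e -> V (t e)).
(** Connectedness in the form of invariant sets of vertices, which is how the quotient graph
    provides it. *)
Hypothesis conn : forall P : set J, P u0 ->
  (forall e, E e -> (P (s e) <-> P (t e))) -> V `<=` P.

Fixpoint graph_ball n : set J :=
  if n is n'.+1 then
    graph_ball n' `|` [set u | exists e, E e /\
      ((u = s e /\ graph_ball n' (t e)) \/ (u = t e /\ graph_ball n' (s e)))]
  else [set u0].

Lemma graph_distance : exists d : J -> nat, forall u, V u ->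
  graph_ball (d u) u /\ forall m, graph_ball m u -> (d u <= m)%N.
Proof.
suff /choice[d dP] : forall u, exists n, V u ->
  graph_ball n u /\ forall m, graph_ball m u -> (n <= m)%N by exists d.
move=> u; have [Vu|nVu] := pselect (V u); last by exists 0%N.
have ex_n : exists n, `[< graph_ball n u >].
  suff : V `<=` [set u | exists n, graph_ball n u].
    by move=> /(_ _ Vu)[n un]; exists n; apply/asboolP.
  apply: conn; first by exists 0%N.
  move=> e Ee; split=> -[n en]; exists n.+1; right; exists e; split=> //.
    by right.
  by left.
case: (ex_minnP ex_n) => n /asboolP un nmin; exists n => _; split=> // m um.
by apply: nmin; apply/asboolP.
Qed.

(* [par u e]: e is the first edge of the tree path from u to the root u0. *)
Lemma spanning_tree_exists : exists par : J -> I -> Prop,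
  [/\ forall u, V u -> u <> u0 -> exists e, par u e,
      forall u e, par u e -> [/\ V u, u <> u0 & E e],
      (forall u e e', par u e -> par u e' -> e = e') /\
      (forall u u' e, par u e -> par u' e -> u = u'),
      forall (K : groupType) (k : I -> K), exists b : J -> K,
        [/\ b u0 = 1, forall u e, par u e -> k e = b (s e) * (b (t e))^-1
          & forall S, is_subgroup S -> (forall u e, par u e -> S (k e)) ->
            forall u, V u -> S (b u)]
    & forall P : set J, P u0 ->
        (forall u e, par u e -> (P (s e) <-> P (t e))) -> V `<=` P].
Proof.
have [d dP] := graph_distance.
(* The parent edge of u is any edge leading to a vertex strictly closer to the root. *)
have /choice[p pP] : forall u, exists oe : option I, V u -> u <> u0 ->
    exists e, [/\ oe = Some e, E e & (u = s e /\ (d (t e) < d u)%N) \/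
                                  (u = t e /\ (d (s e) < d u)%N)].
  move=> u; have [Vu|nVu] := pselect (V u); last by exists None.
  have [->|u_neq0] := pselect (u = u0); first by exists None.
  have [] := dP u Vu; case du: (d u) => [|n] //= [un|[e [Ee wP]]] dmin.
    by have := dmin _ un; rewrite ltnn.
  exists (Some e) => _ _; exists e; split=> //.
  have le_n w : V w -> graph_ball n w -> (d w < n.+1)%N.
    by move=> Vw wn; have [_] := dP w Vw; apply.
  case: wP => -[-> wn]; [left|right]; split=> //; apply: le_n => //.
    exact: tV.
  exact: sV.
pose par u e := [/\ V u, u <> u0 & p u = Some e].
have parP u e : par u e -> [/\ V u, u <> u0, E e &
    (u = s e /\ (d (t e) < d u)%N) \/ (u = t e /\ (d (s e) < d u)%N)].
  by move=> [Vu uu0 pu]; have [e' []] := pP u Vu uu0; rewrite pu => -[->].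
exists par; split.
- by move=> u Vu uu0; have [e [pu _ _]] := pP u Vu uu0; exists e.
- by move=> u e /parP[].
- split=> [u e e' [_ _ pu] [_ _]|u u' e /parP[_ _ _ ue] /parP[_ _ _ u'e]].
    by rewrite pu => -[].
  by case: ue u'e => -[-> du] [] [-> du'] //; have := ltn_trans du du';
    rewrite ltnn.
- move=> K k.
  (* The potential is the product of the labels along the path from u to the root. Here [n] is fuel,
     and [stab] shows that any fuel from [d u] on gives the same value. *)
  pose fix B (n : nat) (u : J) {struct n} : K :=
    if n is n'.+1 then
      if `[< u = u0 >] then 1 else
      if p u is Some e then
        if `[< u = s e >] then k e * B n' (t e) else (k e)^-1 * B n' (s e)
      else 1
    else 1.
  have B_root n : B n u0 = 1 by case: n => //= n; rewrite asboolT.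
  have stab n : forall m u, V u -> (d u <= m <= n)%N -> B m u = B (d u) u.
    elim/ltn_ind: n => n IH m u Vu /andP[dm mn].
    have [->|uu0] := pselect (u = u0); first by rewrite !B_root.
    have [e [pu Ee ue]] := pP u Vu uu0.
    case: m dm mn => [|m] dm mn; first by move: dm; rewrite leqn0 => /eqP ->.
    case du: (d u) => [|q]; first by move: ue; rewrite du; case=> -[].
    rewrite /= asboolF // pu.
    have qm : (q <= m)%N by move: dm; rewrite du ltnS.
    case: asboolP => us.
      have dte : (d (t e) <= q)%N.
        case: ue => -[eq_u]; rewrite du ltnS // => lt_s.
        by move: lt_s; rewrite -us du ltnn.
      rewrite (IH m mn m _ (tV Ee)) ?(IH m mn q _ (tV Ee)) ?leqnn ?dte //.
      by rewrite (leq_trans dte).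
    have dse : (d (s e) <= q)%N by case: ue => -[eq_u]; rewrite du ltnS.
    rewrite (IH m mn m _ (sV Ee)) ?(IH m mn q _ (sV Ee)) ?leqnn ?dse //.
    by rewrite (leq_trans dse).
  pose b u := B (d u) u.
  have step u e : par u e ->
      ((d (t e) < d u)%N /\ u = s e /\ b u = k e * b (t e)) \/
      ((d (s e) < d u)%N /\ u = t e /\ b u = (k e)^-1 * b (s e)).
    move=> /[dup] -[_ _ pu] /parP[Vu uu0 Ee ue]; rewrite /b.
    case: ue => -[eq_u lt_d]; [left|right]; do 2!split=> //; move: (lt_d);
      case: (d u) => // q lt_q; rewrite /= asboolF // pu.
      by rewrite asboolT // (stab q q _ (tV Ee)) // leqnn andbT.
    rewrite asboolF; last by move=> us; move: lt_d; rewrite -us ltnn.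
    by rewrite (stab q q _ (sV Ee)) // leqnn andbT.
  exists b; split; first exact: B_root.
    move=> u e /step[] [_ [<- ->]]; first by rewrite mulgK.
    by rewrite invgM invgK mulVKg.
  move=> S [S1 SM SV] Sk u; move: {2}(d u) (leqnn (d u)) => n.
  elim: n u => [|n IH] u du Vu; have [->|uu0] := pselect (u = u0);
    rewrite ?/b ?B_root //; have [e [pu Ee _]] := pP u Vu uu0;
    have pe : par u e by [].
    by move: du; rewrite leqn0 => /eqP du; case: (step _ _ pe); rewrite du;
      case.
  have lt_n w : (d w < d u)%N -> (d w <= n)%N.
    by move=> lt_d; rewrite -ltnS (leq_trans lt_d).
  rewrite -/(b u); case: (step _ _ pe) => -[/lt_n le_n [_ ->]]; apply: SM.
  - exact: Sk pe.
  - by apply: IH => //; exact: tV.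
  - by apply/SV/(Sk u).
  - by apply: IH => //; exact: sV.
- move=> P P0 Pe u; move: {2}(d u) (leqnn (d u)) => n.
  elim: n u => [|n IH] u du Vu; have [->|uu0] := pselect (u = u0) => //;
    have [e [pu Ee ue]] := pP u Vu uu0; have := Pe u e (And3 Vu uu0 pu).
    by move: du; rewrite leqn0 => /eqP du; move: ue; rewrite du; case=> -[].
  case: ue => -[eq_u lt_d] Pst; rewrite eq_u; apply/Pst.
    apply: IH; last exact: tV.
    exact: leq_trans lt_d du.
  apply: IH; last exact: sV.
  exact: leq_trans lt_d du.
Qed.

End SpanningTree.

(** * Fundamental groups of graphs of groups *)

(** H stays a set: the extension of f is a map on all of G, multiplicative on H and arbitrary
    elsewhere. Its uniqueness on H follows from generation. *)
Definition free_on (G : groupType) (H : set G) (I : Type) (B : set I)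
    (y : I -> G) : Prop :=
  [/\ forall b, B b -> H (y b),
      H `<=` generated (y @` B)
    & forall (K : groupType) (f : I -> K), exists phi : G -> K,
        (forall g h, H g -> H h -> phi (g * h) = phi g * phi h) /\
        (forall b, B b -> phi (y b) = f b)].

(** * Double cosets and free actions *)

Section DoubleCoset.
Variables (G : groupType) (S H : set G).
Hypotheses (HS : is_subgroup S) (HH : is_subgroup H).

Definition double_coset (x : G) : set G :=
  [set r | exists s h, [/\ S s, H h & r = s * x * h]].

Definition dcrep (x : G) : G := xget 1 (double_coset x).

Lemma double_coset_refl x : double_coset x x.
Proof.
by have [[S1 _ _] [H1 _ _]] := (HS, HH); exists 1, 1; rewrite mul1g mulg1.
Qed.

Lemma dcrep_eq s h x : S s -> H h -> dcrep (s * x * h) = dcrep x.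
Proof.
move=> Ss Hh; have [[_ SM SV] [_ HM HV]] := (HS, HH).
rewrite /dcrep; congr xget; rewrite eqEsubset; split=> r /=.
  move=> [s' [h' [Ss' Hh' ->]]]; exists (s' * s), (h * h'); split.
  - exact: SM.
  - exact: HM.
  - by rewrite !mulgA.
move=> [s' [h' [Ss' Hh' ->]]]; exists (s' * s^-1), (h^-1 * h'); split.
- exact/SM/SV.
- by apply: HM => //; exact: HV.
- by rewrite !mulgA mulgVK mulgK.
Qed.

Lemma dcrep_eql s x : S s -> dcrep (s * x) = dcrep x.
Proof. by move=> Ss; have [H1 _ _] := HH;
  rewrite -(dcrep_eq x Ss H1) mulg1. Qed.

Lemma dcrep_eqr h x : H h -> dcrep (x * h) = dcrep x.
Proof. by move=> Hh; have [S1 _ _] := HS;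
  rewrite -(dcrep_eq x S1 Hh) mul1g. Qed.

Lemma dcrepP x : exists s h, [/\ S s, H h & x = s * dcrep x * h].
Proof.
have [[_ SM SV] [_ HM HV]] := (HS, HH).
have [s [h [Ss Hh eq_r]]] : double_coset x (dcrep x).
  by rewrite /dcrep; apply: (xgetPex 1); exists x; exact: double_coset_refl.
exists s^-1, h^-1; split; [exact: SV|exact: HV|].
by rewrite eq_r !mulgA mulVg mul1g mulgK.
Qed.

Lemma dcrepK x : dcrep (dcrep x) = dcrep x.
Proof.
by have [s [h [Ss Hh {2}->]]] := dcrepP x; rewrite dcrep_eq.
Qed.

Hypothesis SH_free : forall x s, S s -> H (x^-1 * s * x) -> s = 1.

(* The unique h in H such that x = s * dcrep x * h for some s in S. *)
Definition hpart (x : G) : G :=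
  xget 1 [set h | H h /\ exists2 s, S s & x = s * dcrep x * h].

Lemma hpartP x : H (hpart x) /\ exists2 s, S s & x = s * dcrep x * hpart x.
Proof.
have [s [h [Ss Hh eq_x]]] := dcrepP x.
apply: (@xgetPex _ 1 [set h | H h /\ exists2 s, S s & x = s * dcrep x * h]).
by exists h; split=> //; exists s.
Qed.

(** Two decompositions of x differ by an element of S whose conjugate by the representative lies in
    H; freeness makes it trivial. *)
Lemma hpart_uniq x s h : S s -> H h -> x = s * dcrep x * h -> hpart x = h.
Proof.
move=> Ss Hh eq_x; have [Hh' [s' Ss' eq_x']] := hpartP x.
have [[_ SM SV] [_ HM HV]] := (HS, HH).
set r := dcrep x in eq_x eq_x'; set h' := hpart x in Hh' eq_x' *.
have E : r^-1 * (s'^-1 * s) * r = h' * h^-1.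
  apply: (mulIg h); rewrite mulgVK -!mulgA (mulgA s) -eq_x eq_x'.
  by rewrite !mulgA mulgVK mulVg mul1g.
have s1 : s'^-1 * s = 1.
  by apply: (SH_free (x := r)); [exact/SM/Ss/SV|rewrite E; exact/HM/HV].
by move: E; rewrite s1 mulg1 mulVg => /esym/divg1_eq.
Qed.

Lemma hpartl s x : S s -> hpart (s * x) = hpart x.
Proof.
move=> Ss; have [Hh [s' Ss' eq_x]] := hpartP x; have [_ SM _] := HS.
apply: (@hpart_uniq _ (s * s')) => //; first exact: SM.
by rewrite dcrep_eql // {1}eq_x !mulgA.
Qed.

Lemma hpartr h x : H h -> hpart (x * h) = hpart x * h.
Proof.
move=> Hh; have [Hh' [s' Ss' eq_x]] := hpartP x; have [_ HM _] := HH.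
apply: (@hpart_uniq _ s') => //; first exact: HM.
by rewrite dcrep_eqr // {1}eq_x !mulgA.
Qed.

End DoubleCoset.

Section WreathProduct.
Variables G K : groupType.

(* The semidirect product of the group of functions G -> K by G acting on it
   by translations. *)
Definition wreath : Type := ((G -> K) * G)%type.
HB.instance Definition _ := Choice.on wreath.

(** Twisted so that a homomorphism g |-> (phi g, g) is the same as a crossed homomorphism, phi (a *
    b) x = phi a (b * x) * phi b x. *)
Definition wr_mul (a b : wreath) : wreath :=
  (fun x => a.1 (b.2 * x) * b.1 x, a.2 * b.2).
Definition wr_one : wreath := (fun=> 1, 1).
Definition wr_inv (a : wreath) : wreath :=
  (fun x => (a.1 (a.2^-1 * x))^-1, a.2^-1).

Lemma wr_mulA : associative wr_mul.
Proof.
move=> a b c; rewrite /wr_mul /= mulgA; congr (_, _).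
by apply: funext => x; rewrite !mulgA.
Qed.
Lemma wr_mul1 : left_id wr_one wr_mul.
Proof.
move=> [a g]; rewrite /wr_mul /= mul1g; congr (_, _).
by apply: funext => x; rewrite mul1g.
Qed.
Lemma wr_mulr1 : right_id wr_one wr_mul.
Proof.
move=> [a g]; rewrite /wr_mul /= mulg1; congr (_, _).
by apply: funext => x; rewrite mul1g mulg1.
Qed.
Lemma wr_mulV : left_inverse wr_one wr_inv wr_mul.
Proof.
move=> [a g]; rewrite /wr_mul /= mulVg; congr (_, _).
by apply: funext => x; rewrite mulKg mulVg.
Qed.
Lemma wr_mulrV : right_inverse wr_one wr_inv wr_mul.
Proof.
move=> [a g]; rewrite /wr_mul /= mulgV; congr (_, _).
by apply: funext => x; rewrite mulgV.
Qed.

HB.instance Definition _ := isGroup.Build wreath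
  wr_mulA wr_mul1 wr_mulr1 wr_mulV wr_mulrV.

End WreathProduct.

(** The values on generators of a homomorphism from Serre's group to K. *)
Definition pi1_data (A : graph_of_groups) (T : {set edge A}) (K : groupType)
    (jv : forall v : vertex A, vgrp v -> K) (tau : edge A -> K) : Prop :=
  [/\ forall v, morph (jv v),
      forall e c, tau e * jv _ (tgt_mor e c) * (tau e)^-1 = jv _ (src_mor e c)
    & forall e, e \in T -> tau e = 1].

(** A universal property rather than a presentation, so that it passes through isomorphisms and also
    covers free groups, as groups of bouquets. *)
Definition is_pi1 (A : graph_of_groups) (T : {set edge A}) (G : groupType)
    (iv : forall v : vertex A, vgrp v -> G) (st : edge A -> G) : Prop :=
  [/\ pi1_data T iv st,
      forall H : set G, is_subgroup H -> (forall v x, H (iv v x)) ->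
        (forall e, H (st e)) -> forall g, H g
    & forall (K : groupType) (jv : forall v : vertex A, vgrp v -> K) tau,
        pi1_data T jv tau -> exists Phi : G -> K,
        [/\ morph Phi, forall v x, Phi (iv v x) = jv v x
          & forall e, Phi (st e) = tau e]].

Lemma connect_invariant (X : finType) (r : rel X) (P : X -> Prop) x y :
  (forall u v, r u v -> (P u <-> P v)) -> connect r x y -> (P x <-> P y).
Proof.
move=> rP /(closed_connect (a := [pred u | `[< P u >]])) xy.
have /xy : closed r [pred u | `[< P u >]].
  by move=> u v /rP uv; rewrite !inE; apply: asbool_equiv_eq.
rewrite !inE => E; split=> /asboolP; first by rewrite E => /asboolP.
by rewrite -E => /asboolP.
Qed.

Lemma adjacent_invariant (A : graph_of_groups) (T : {set edge A})
    (P : vertex A -> Prop) u v :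
  (forall e, e \in T -> (P (src e) <-> P (tgt e))) ->
  connect (adjacent T) u v -> (P u <-> P v).
Proof.
move=> TP; apply: connect_invariant => {}u {}v /existsP[e /andP[/TP eT]].
by case/orP => /andP[/eqP <- /eqP <-] //; split=> /eT.
Qed.

(** The rooted tree extracted from T uses every edge of T: it would otherwise join the ends of an
    omitted edge inside T minus that edge, against acyclicity. Its potential thus serves all of
    T. *)
Lemma spanning_tree_gauge (A : graph_of_groups) (T : {set edge A}) :
  spanning_tree T -> forall (K : groupType) (k : edge A -> K),
    exists b : vertex A -> K,
      forall e, e \in T -> k e = b (src e) * (b (tgt e))^-1.
Proof.
move=> [/card_gt0P[v0 _] T_conn T_acyc] K k.
have conn P : P v0 -> (forall e, e \in T -> (P (src e) <-> P (tgt e))) ->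
    [set: vertex A] `<=` P.
  by move=> P0 TP v _; apply/(adjacent_invariant TP (T_conn v0 v)).
have [//|//|par [_ parT _ gauge par_conn]] := @spanning_tree_exists _ _ setT
  [set e | e \in T] (@src A) (@tgt A) v0 _ _ conn.
have [b [_ b_eq _]] := gauge K k; exists b => e eT.
have [[u ue]|no_par] := pselect (exists u, par u e); first exact: b_eq ue.
have := T_acyc e eT; suff -> :
  connect (adjacent (T :\ e)) (src e) (tgt e) by [].
have from0 v : connect (adjacent (T :\ e)) v0 v.
  apply: (par_conn [set v | connect (adjacent (T :\ e)) v0 v]) => //=.
  move=> u f uf; have [_ _ /= fT] := parT _ _ uf.
  have fTe : f \in T :\ e.
    by rewrite !inE fT andbT; apply/eqP => fe; apply: no_par; exists u;
      rewrite -fe.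
  by split=> h; apply: connect_trans h _; apply: connect1; apply/existsP;
    exists f; rewrite fTe !eqxx ?orbT.
apply: connect_trans (from0 (tgt e)).
rewrite (sym_connect_sym _) // => u w.
by apply: eq_existsb => f; rewrite orbC.
Qed.

(** * Subgroups acting freely on the Bass-Serre tree *)

Section Pi1Subgroup.
Variables (A : graph_of_groups) (T : {set edge A}) (G : groupType).
Variables (iv : forall v : vertex A, vgrp v -> G) (st : edge A -> G).
Hypotheses (treeT : spanning_tree T) (piG : is_pi1 T iv st).
Variables (v0 : vertex A) (H : set G).
Hypothesis HH : is_subgroup H.
Hypothesis H_free : forall v (a : vgrp v) x, H (x^-1 * iv a * x) -> iv a = 1.

Definition vstab v : set G := range (@iv v).
Definition estab e : set G := range (fun c => iv (src_mor e c)).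
Definition vrep v := dcrep (vstab v) H.
Definition erep e := dcrep (estab e) H.
(* The quotient by H of the Bass-Serre tree; an edge or a vertex is given by
   the chosen representative of its double coset. *)
Definition qvertex : set (vertex A * G) := [set p | vrep p.1 p.2 = p.2].
Definition qedge : set (edge A * G) := [set p | erep p.1 p.2 = p.2].
Definition qsrc (p : edge A * G) := (src p.1, vrep (src p.1) p.2).
(** The factor [(st e)^-1] appears because [st e] conjugates the edge group at the target of e onto
    the edge group at its source. *)
Definition qtgt (p : edge A * G) :=
  (tgt p.1, vrep (tgt p.1) ((st p.1)^-1 * p.2)).
Definition qroot := (v0, vrep v0 1).

Lemma iv_morph v : morph (@iv v). Proof. by have [[]] := piG. Qed.

Lemma vstab_subgroup v : is_subgroup (vstab v).
Proof. exact: (morph_image_subgroup (@iv_morph v) (subgroupT _)). Qed.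

Lemma estab_subgroup e : is_subgroup (estab e).
Proof.
have m : morph (fun c => iv (src_mor e c)).
  by move=> x y; rewrite gmulfM iv_morph.
exact: (morph_image_subgroup m (subgroupT _)).
Qed.

Lemma vstab_iv v (a : vgrp v) : vstab v (iv a). Proof. by exists a. Qed.

Lemma estab_src e s : estab e s -> vstab (src e) s.
Proof. by move=> [c _ <-]; exists (src_mor e c). Qed.

Lemma estab_tgt e s : estab e s -> vstab (tgt e) ((st e)^-1 * s * st e).
Proof.
move=> [c _ <-]; exists (tgt_mor e c) => //.
by have [[_ <- _] _ _] := piG; rewrite !mulgA mulVg mul1g mulgVK.
Qed.

Lemma vstab_free v x s : vstab v s -> H (x^-1 * s * x) -> s = 1.
Proof. by move=> [a _ <-]; exact: H_free. Qed.

Definition Hpart v := hpart (vstab v) H.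

Lemma vrep_eq v s h x : vstab v s -> H h -> vrep v (s * x * h) = vrep v x.
Proof. by move=> Ss Hh; apply: dcrep_eq => //; exact: vstab_subgroup. Qed.

Lemma vrepl v s x : vstab v s -> vrep v (s * x) = vrep v x.
Proof. by move=> Ss; apply: dcrep_eql => //; exact: vstab_subgroup. Qed.

Lemma vrepr v h x : H h -> vrep v (x * h) = vrep v x.
Proof. by move=> Hh; apply: dcrep_eqr => //; exact: vstab_subgroup. Qed.

Lemma erep_eq e s h x : estab e s -> H h -> erep e (s * x * h) = erep e x.
Proof. by move=> Ss Hh; apply: dcrep_eq => //; exact: estab_subgroup. Qed.

Lemma erepP e x : exists s h, [/\ estab e s, H h & x = s * erep e x * h].
Proof. by apply: dcrepP => //; exact: estab_subgroup. Qed.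

Lemma erepK e x : erep e (erep e x) = erep e x.
Proof. by apply: dcrepK => //; exact: estab_subgroup. Qed.

Lemma vrepK v x : vrep v (vrep v x) = vrep v x.
Proof. by apply: dcrepK => //; exact: vstab_subgroup. Qed.

Lemma edge_shift e s h x :
  (st e)^-1 * (s * x * h) = ((st e)^-1 * s * st e) * ((st e)^-1 * x) * h.
Proof. by rewrite !mulgA mulgK. Qed.

Lemma tree_invariant (P : vertex A -> Prop) :
  (forall e, e \in T -> (P (src e) <-> P (tgt e))) -> forall v, P v0 <-> P v.
Proof.
by move=> TP v; have [_ conn _] := treeT; exact: adjacent_invariant (conn v0 v).
Qed.

(** [P'] is the pullback of P to the Bass-Serre tree. It is invariant across edges, so the g whose
    left translation preserves [P' v0] form a subgroup containing all generators of G. *)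
Lemma quotient_connected (P : set (vertex A * G)) : P qroot ->
  (forall e, qedge e -> (P (qsrc e) <-> P (qtgt e))) -> qvertex `<=` P.
Proof.
move=> P0 PE; pose P' v x := P (v, vrep v x).
have P'l v s x : vstab v s -> P' v (s * x) <-> P' v x.
  by move=> Ss; rewrite /P' vrepl.
have P'E e x : P' (src e) x <-> P' (tgt e) ((st e)^-1 * x).
  have [s [h [Ss Hh eq_x]]] := erepP e x.
  have := PE (e, erep e x) (erepK e x); rewrite /qsrc /qtgt /= /P'.
  rewrite [in vrep _ x]eq_x [in _ * x]eq_x edge_shift !vrep_eq //.
    exact: estab_tgt.
  exact: estab_src.
have P'T x v : P' v0 x <-> P' v x.
  apply: (tree_invariant (P := P'^~ x)) => e eT.
  have [[_ _ st1] _ _] := piG.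
  by have := P'E e x; rewrite (st1 e eT) invg1 mul1g.
have inv g : forall x, P' v0 (g * x) <-> P' v0 x.
  have [_ gen _] := piG;
    apply: (gen [set g | forall x, P' v0 (g * x) <-> P' v0 x]).
  - split=> [x|a b Pa Pb x|a Pa x]; first by rewrite mul1g.
      by rewrite -mulgA; split=> [/Pa/Pb|/Pb/Pa].
    by have := Pa (a^-1 * x); rewrite mulVKg => -[? ?]; split.
  - move=> v a x; have aS := vstab_iv a.
    by split=> /P'T/(P'l _ _ _ aS)/P'T.
  - move=> e x /=; have := P'E e (st e * x); rewrite mulKg => E.
    by split=> /P'T/E/P'T.
move=> [v x] Vx.
have : P' v0 (x * 1) by apply/inv.
by rewrite mulg1 => /(P'T x v);
  rewrite /P' -[X in P (v, X)]/(vrep (v, x).1 (v, x).2) Vx.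
Qed.

Variable par : vertex A * G -> edge A * G -> Prop.
Hypothesis par_in : forall u e, par u e -> qedge e.
Hypothesis par_gauge : forall (K : groupType) (k : edge A * G -> K),
  exists b : vertex A * G -> K,
    [/\ b qroot = 1, forall u e, par u e -> k e = b (qsrc e) * (b (qtgt e))^-1
      & forall S, is_subgroup S -> (forall u e, par u e -> S (k e)) ->
        forall u, qvertex u -> S (b u)].
Hypothesis par_connected : forall P : set (vertex A * G), P qroot ->
  (forall u e, par u e -> (P (qsrc e) <-> P (qtgt e))) -> qvertex `<=` P.

(** The label in H of a quotient edge: the discrepancy at its two ends of [h], which trivializes the
    action of H on the vertices of the tree. *)
Definition cycle_of (h : vertex A -> G -> G) (e : edge A * G) : G :=
  h (src e.1) e.2 * (h (tgt e.1) ((st e.1)^-1 * e.2))^-1.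

(** [Hpart] is equivariant because H acts freely. Dividing it on the left by an H-valued potential
    of its labels makes the labels of tree edges trivial, and a constant factor normalizes it at the
    root. *)
Lemma equivariant_gauge : exists h : vertex A -> G -> G,
  [/\ forall v x, H (h v x), forall v s x, vstab v s -> h v (s * x) = h v x,
      forall v k x, H k -> h v (x * k) = h v x * k, h v0 1 = 1
    & forall u e, par u e -> cycle_of h e = 1].
Proof.
have [_ HM HV] := HH.
have [HpH HpS HpR] : [/\ forall v x, H (Hpart v x),
    forall v s x, vstab v s -> Hpart v (s * x) = Hpart v x &
    forall v k x, H k -> Hpart v (x * k) = Hpart v x * k].
  split=> [v x|v s x|v k x].
  - by have [] := hpartP (vstab_subgroup v) HH x.
  - exact: (hpartl (vstab_subgroup v) HH (@vstab_free v)).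
  - exact: (hpartr (vstab_subgroup v) HH (@vstab_free v)).
have [b [b0 b_eq b_in]] := par_gauge (cycle_of Hpart).
have bH v x : H (b (v, vrep v x)).
  apply: b_in; [exact: HH| |exact: vrepK].
  by move=> u e _; apply: HM => //; exact/HV.
exists (fun v x => (Hpart v0 1)^-1 * (b (v, vrep v x))^-1 * Hpart v x); split.
- by move=> v x; apply: (HM) => //; apply: (HM); exact: HV.
- by move=> v s x Ss; rewrite vrepl // HpS.
- by move=> v k x Hk; rewrite vrepr // HpR // !mulgA.
- by rewrite [b _]b0 invg1 mulg1 mulVg.
- move=> u e ue; have := b_eq u e ue; rewrite /cycle_of => E.
  rewrite !invgM !invgK !mulgA -(mulgA _ (Hpart _ _)) E /qsrc /qtgt.
  by rewrite !mulgA mulgVK mulgVK mulVg.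
Qed.

Section Basis.
Variable h : vertex A -> G -> G.
Hypotheses (hH : forall v x, H (h v x))
  (hS : forall v s x, vstab v s -> h v (s * x) = h v x)
  (hR : forall v k x, H k -> h v (x * k) = h v x * k)
  (h1 : h v0 1 = 1)
  (h_par : forall u e, par u e -> cycle_of h e = 1).

Definition basis : set (edge A * G) := qedge `\` [set e | exists u, par u e].

Lemma cycle_rep e x : cycle_of h (e, erep e x) = cycle_of h (e, x).
Proof.
have [s [k [Ss Hk {2}->]]] := erepP e x; rewrite /cycle_of /= edge_shift.
rewrite !(hR _ _ Hk) (hS _ (estab_src Ss)) (hS _ (estab_tgt Ss)).
by rewrite invgM !mulgA mulgK.
Qed.

(** Left multiplication of x by a generator of G keeps [h v0 x] in the same right coset of S, since
    only labels of edges are crossed. Between 1 and k in H, the value goes from 1 to k. *)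
Lemma basis_generates : H `<=` generated (cycle_of h @` basis).
Proof.
set S := generated _; have HS : is_subgroup S by exact: generated_subgroup.
have [S1 SM SV] := HS.
have SE e x : S (cycle_of h (e, x)).
  rewrite -cycle_rep; have [[u ue]|nue] := pselect (exists u, par u (e,
    erep e x)).
    by rewrite (h_par ue).
  apply: sub_generated; exists (e, erep e x) => //; split=> //.
  exact: erepK.
have ST x v : S (h v0 x * (h v x)^-1).
  have iff : S (h v0 x * (h v0 x)^-1) <-> S (h v0 x * (h v x)^-1).
    apply: (tree_invariant (P := fun v => S (h v0 x * (h v x)^-1))) => e eT.
    have := SE e x; rewrite /cycle_of /=; have [[_ _ st1] _ _] := piG.
    rewrite (st1 e eT) invg1 mul1g => Se; split=> Sv.
      by have := SM _ _ Sv Se; rewrite !mulgA mulgVK.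
    by have := SM _ _ Sv (SV _ Se); rewrite invgM invgK !mulgA mulgVK.
  by apply/iff; rewrite mulgV.
have inv g : forall x, S (h v0 (g * x) * (h v0 x)^-1).
  have [_ gen _] := piG.
  apply: (gen [set g | forall x, S (h v0 (g * x) * (h v0 x)^-1)]).
  - split=> [x|a b Pa Pb x|a Pa x] /=; first by rewrite mul1g mulgV.
      by have := SM _ _ (Pa (b * x)) (Pb x); rewrite !mulgA mulgVK.
    by have := SV _ (Pa (a^-1 * x)); rewrite mulVKg invgM invgK.
  - move=> v a x /=; have := SM _ _ (ST (iv a * x) v) (SV _ (ST x v)).
    by rewrite invgM invgK (hS _ (vstab_iv a)) mulgA mulgVK.
  - move=> e x /=; have := SE e (st e * x); rewrite /cycle_of /= mulKg => Se.
    have := SM _ _ (ST (st e * x) (src e)) (SM _ _ Se (SV _ (ST x (tgt e)))).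
    by rewrite invgM invgK !mulgA mulgVK mulgVK.
by move=> k Hk; have := inv k 1;
  rewrite -(mul1g (k * 1)) mulg1 hR // h1 !mul1g invg1 mulg1.
Qed.

(* The weights f on the basis, extended by 1 on the tree, define a crossed
   homomorphism of G with values in the functions from G to K; the value at 1
   of this function is multiplicative on H. *)
Lemma basis_universal (K : groupType) (f : edge A * G -> K) :
  exists phi : G -> K,
    (forall g k, H g -> H k -> phi (g * k) = phi g * phi k) /\
    (forall b, basis b -> phi (cycle_of h b) = f b).
Proof.
have [[ivM strel st1] gen univ] := piG.
pose F e x := if `[< basis (e, erep e x) >] then f (e, erep e x) else 1.
have FS e s k x : estab e s -> H k -> F e (s * x * k) = F e x.
  by move=> Ss Hk; rewrite /F erep_eq.
have FR e k x : H k -> F e (x * k) = F e x.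
  by move=> Hk; rewrite -[x]mul1g FS ?mul1g //; have [] := estab_subgroup e.
(* The letters of T must go to 1, so the weights on T are absorbed by the potential [sig]. Choosing
   [gam] as a function of the weights makes [sig] inherit the H-invariance of [F]. *)
have /choice[gam gamP] := fun k => spanning_tree_gauge treeT (K := K) k.
pose sig v x := gam (F^~ x) v.
have sigE e x : e \in T -> F e x = sig (src e) x * (sig (tgt e) x)^-1.
  by move=> eT; rewrite /sig -(gamP (F^~ x)).
have sigR v k x : H k -> sig v (x * k) = sig v x.
  move=> Hk; rewrite /sig; congr (gam _ v).
  by apply: funext => e; rewrite FR.
pose jv v (a : vgrp v) : wreath G K :=
  (fun x => (sig v (iv a * x))^-1 * sig v x, iv a).
pose tau e : wreath G K :=
  (fun x => (sig (src e) (st e * x))^-1 * F e (st e * x) * sig (tgt e) x, st e).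
have [|Phi [PhiM Phi_iv Phi_st]] := univ _ jv tau.
  split.
  - move=> v a b; rewrite /jv ivM; congr (_, _); apply: funext => x /=.
    by rewrite !mulgA mulgK.
  - move=> e c; suff -> :
    tau e * jv _ (tgt_mor e c) = jv _ (src_mor e c) * tau e.
      by rewrite mulgK.
    have E : st e * iv (tgt_mor e c) = iv (src_mor e c) * st e.
      by rewrite -strel mulgVK.
    congr (_, _) => //; apply: funext => x /=; rewrite !mulgA mulgK E.
    rewrite mulgK; congr (_ * _ * _).
    by rewrite -[_ * _ * x]mulgA -[_ * (_ * x)]mulg1 FS //; [exists c|case: HH].
  - move=> e eT; rewrite /tau (st1 e eT); congr (_, _); apply: funext => x /=.
    by rewrite mul1g sigE // mulKg mulVg.
have Phi2 g : (Phi g).2 = g.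
  apply: (gen [set g | (Phi g).2 = g]).
  - split=> [|a b /= Pa Pb|a /= Pa];
    rewrite /= ?(morph1 PhiM) // ?PhiM ?(morphV PhiM) /=.
      by rewrite Pa Pb.
    by rewrite Pa.
  - by move=> v a /=; rewrite Phi_iv.
  - by move=> e /=; rewrite Phi_st.
pose phi g x := (Phi g).1 x.
have phiM a b x : phi (a * b) x = phi a (b * x) * phi b x.
  by rewrite /phi PhiM /= Phi2.
have phi1 x : phi 1 x = 1 by rewrite /phi (morph1 PhiM).
have phiR g : forall x k, H k -> phi g (x * k) = phi g x.
  apply: (gen [set g | forall x k, H k -> phi g (x * k) = phi g x]).
  - split=> [x k _|a b Pa Pb x k Hk|a Pa x k Hk] /=; first by rewrite !phi1.
      by rewrite !phiM (mulgA b) (Pa _ _ Hk) (Pb _ _ Hk).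
    apply: (mulgI (phi a (a^-1 * x))); rewrite -phiM mulgV phi1.
    by rewrite -(Pa _ _ Hk) -mulgA -phiM mulgV phi1.
  - by move=> v a x k Hk; rewrite /phi Phi_iv /= mulgA !(sigR _ _ _ Hk).
  - by move=> e x k Hk;
    rewrite /phi Phi_st /= mulgA !(sigR _ _ _ Hk) (FR _ _ _ Hk).
have hV v x : H (h v x)^-1 by have [_ _ HV] := HH; exact: HV.
have phiH g k : H k -> phi g k = phi g 1.
  by move=> Hk; rewrite -[k in LHS]mul1g phiR.
pose sec v x := x * (h v x)^-1.
have secS v s x : vstab v s -> sec v (s * x) = s * sec v x.
  by move=> Ss; rewrite /sec hS // mulgA.
have secR v k x : H k -> sec v (x * k) = sec v x.
  by move=> Hk; rewrite /sec hR // invgM mulgA mulgK.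
(* [sec v x] is the point of the H-orbit of x where [h v] is 1. By [phi_cycle], [bet] relates the
   value of [phi] on a label to the weight [F]. It depends only on the vertex of the quotient and
   agrees across tree edges, where label and weight are 1, so it is constant; conjugating by this
   constant gives the required homomorphism. *)
pose bet v x := sig v x * phi (sec v x) 1.
have sig_sec v w x y : sig v (y * sec w x) = sig v (y * x).
  by rewrite /sec mulgA (sigR _ _ _ (hV w x)).
have betS v s x : vstab v s -> bet v (s * x) = bet v x.
  move=> /[dup] Ss [a _ eq_s]; rewrite /bet secS // -eq_s phiM mulg1.
  rewrite {1}/phi Phi_iv /= sig_sec -(mul1g (sec v x)) sig_sec.
  by rewrite mul1g !mulgA mulgV mul1g mul1g.
have betR v k x : H k -> bet v (x * k) = bet v x.
  by move=> Hk; rewrite /bet secR // sigR.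
have phi_st e z : phi (st e) z =
    (sig (src e) (st e * z))^-1 * F e (st e * z) * sig (tgt e) z.
  by rewrite /phi Phi_st.
have phi_cycle e x : bet (src e) x * phi (cycle_of h (e, x)) 1
                     = F e x * bet (tgt e) ((st e)^-1 * x).
  set x' := (st e)^-1 * x; set y := cycle_of h (e, x).
  have Hy : H y by apply: subgroup_div.
  have E : sec (src e) x * y = st e * sec (tgt e) x'.
    by rewrite /sec /y /cycle_of /= -/x' !mulgA mulgVK mulgV mul1g.
  have := congr1 (phi^~ 1) E;
    rewrite (phiM _ y) (phiM (st e)) !mulg1 (phiH _ y) //.
  have tsec : st e * sec (tgt e) x' = x * (h (tgt e) x')^-1.
    by rewrite /sec mulgA mulVKg.
  rewrite phi_st tsec (sigR _ _ _ (hV _ x')) (FR _ _ _ (hV _ x')).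
  have -> : sig (tgt e) (sec (tgt e) x') = sig (tgt e) x'.
    by rewrite -[sec _ _]mul1g sig_sec mul1g.
  move=> {}E.
  by rewrite /bet -mulgA E !mulgA mulgV mul1g.
have bet_const v x : bet v x = bet v0 1.
  have [s [k [Ss Hk ->]]] := dcrepP (vstab_subgroup v) HH x.
  rewrite betR // betS //.
  have [s0 [k0 [Ss0 Hk0 E0]]] := dcrepP (vstab_subgroup v0) HH 1.
  rewrite {}E0 betR // betS // -/(vrep v x) -/(vrep v0 1).
  suff : [set p | bet p.1 p.2 = bet v0 (vrep v0 1)] (v, vrep v x) by [].
  apply: par_connected => //=; last exact: vrepK.
  move=> u [e y] ue; rewrite /qsrc /qtgt /=.
  have bet_rep w z : bet w (vrep w z) = bet w z.
    have [s1 [k1 [Ss1 Hk1 {2}->]]] := dcrepP (vstab_subgroup w) HH z.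
    by rewrite betR // betS.
  have := phi_cycle e y; rewrite (h_par ue) phi1 mulg1.
  rewrite /F (_ : erep e y = y); last exact: (par_in ue).
  rewrite asboolF; last by move=> [_]; apply; exists u.
  by rewrite mul1g !bet_rep => ->.
exists (fun g => bet v0 1 * phi g 1 * (bet v0 1)^-1); split.
  move=> g k Hg Hk; rewrite phiM mulg1 (phiH g k) //.
  by move: (bet v0 1) (phi g 1) (phi k 1) => c a b; rewrite !mulgA mulgVK.
move=> [e x] bx; have := phi_cycle e x; rewrite !bet_const => ->.
have ex : erep e x = x by case: bx.
by rewrite mulgK /F ex asboolT.
Qed.

End Basis.
End Pi1Subgroup.

(* H acts freely on the Bass-Serre tree, so it is the fundamental group of the
   quotient graph, which is free on the edges outside a spanning tree. *)
Theorem pi1_subgroup_free (A : graph_of_groups) (T : {set edge A})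
    (G : groupType) (iv : forall v : vertex A, vgrp v -> G) (st : edge A -> G)
    (v0 : vertex A) (H : set G) :
  spanning_tree T -> is_pi1 T iv st -> is_subgroup H ->
  (forall v a x, H (x^-1 * iv v a * x) -> iv v a = 1) ->
  exists (par : vertex A * G -> edge A * G -> Prop) (y : edge A * G -> G),
  [/\ forall u, qvertex iv H u -> u <> qroot iv v0 H -> exists e, par u e,
      forall u e, par u e -> [/\ qvertex iv H u, u <> qroot iv v0 H
                                & qedge iv H e],
      forall u e e', par u e -> par u e' -> e = e',
      forall u u' e, par u e -> par u' e -> u = u'
    & free_on H (qedge iv H `\` [set e | exists u, par u e]) y].
Proof.
move=> treeT piG HH H_free.
have [||par [par_ex par_in [par_fun par_inj] gauge par_conn]] :=
  spanning_tree_exists (V := qvertex iv H) (E := qedge iv H)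
    (s := qsrc iv H) (t := qtgt iv st H) _ _
    (@quotient_connected _ _ _ _ _ treeT piG v0 _ HH).
- by move=> [e x] _; exact: (vrepK piG HH).
- by move=> [e x] _; exact: (vrepK piG HH).
have par_edge u e : par u e -> qedge iv H e by case/par_in.
have [h [hH hS hR h1 h_par]] :=
  equivariant_gauge piG HH H_free gauge.
exists par, (cycle_of st h); split=> //; split.
- by move=> [e x] _; apply: subgroup_div.
- exact: (basis_generates treeT piG HH hS hR h1 h_par).
- by move=> K f; exact:
  (basis_universal treeT piG HH par_edge par_conn hH hS hR h_par).
Qed.

(** * Index *)

Section Cardinality.
Variables T U : choiceType.
Implicit Types (A B : set T) (C : set U).

Lemma card_setD_I A B a b : B `<=` A -> A #= `I_a -> B #= `I_b ->
  exists2 c, A `\` B #= `I_c & (c + b)%N = a.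
Proof.
move=> BA cA cB; have fA : finite_set A by apply/finite_setP; exists a.
have fB : finite_set B by apply/finite_setP; exists b.
have /finite_setP[c cD] : finite_set (A `\` B) by apply: sub_finite_set fA =>
  x [].
exists c => //; have := card_fset_set cD; rewrite fset_setD // => <-.
have sBA : finmap.fsubset (fset_set B) (fset_set A) by rewrite -fset_set_sub.
rewrite (finmap.cardfsDS sBA) -(card_fset_set cA) -(card_fset_set cB).
by rewrite subnK // finmap.fsubset_leq_card.
Qed.

Lemma card_setX_I A C a b : A #= `I_a -> C #= `I_b -> A `*` C #= `I_(a * b).
Proof.
move=> /card_set_bijP[f [f_fun f_inj f_surj]].
move=> /card_set_bijP[g [g_fun g_inj g_surj]].
apply/card_set_bijP; exists (fun p => f p.1 * b + g p.2)%N; split.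
- move=> [x y] [/= /f_fun /= fx /g_fun /= gy].
  by move: (f x) (g y) fx gy => i j *; nia.
- move=> [x y] [x' y']; rewrite !inE /= => -[/= Ax Cy] [/= Ax' Cy'] E.
  have [gy gy'] : (g y < b)%N /\ (g y' < b)%N by split; exact: g_fun.
  have fxx' : f x = f x'.
    have := congr1 (divn^~ b) E; rewrite /= !divnMDl ?(leq_ltn_trans _ gy) //.
    by rewrite !divn_small // !addn0.
  move: E; rewrite fxx' => /addnI gyy'.
  have -> : x = x' by apply: f_inj; rewrite ?inE.
  by have -> : y = y' by apply: g_inj; rewrite ?inE.
- move=> i /= i_lt; have b_gt0 : (0 < b)%N by case: (b) i_lt => //;
  rewrite muln0.
  have [x Ax xi] : (f @` A) (i %/ b)%N by apply: f_surj; rewrite /= ltn_divLR.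
  have [y Cy yi] : (g @` C) (i %% b)%N by apply: g_surj; exact: ltn_pmod.
  by exists (x, y) => //=; rewrite xi yi -divn_eq.
Qed.

End Cardinality.

Section Index.
Variable G : groupType.
Implicit Types (K H M : set G).

(** A numbering of the left cosets: indices are computed with such functions rather than with sets
    of cosets. *)
Definition coset_index K H n (phi : G -> nat) : Prop :=
  [/\ forall x, K x -> (phi x < n)%N,
      forall i, (i < n)%N -> exists2 x, K x & phi x = i
    & forall x y, K x -> K y -> (phi x = phi y <-> H (x^-1 * y))].

Lemma coset_eqP H x y : is_subgroup H ->
  ([set x * h | h in H] = [set y * h | h in H] <-> H (x^-1 * y)).
Proof.
move=> HH; have [H1 HM HV] := HH; split=> [E|Hxy].
  have : [set y * h | h in H] y by exists 1 => //; rewrite mulg1.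
  by rewrite -E => -[h Hh <-]; rewrite mulKg.
rewrite eqEsubset; split=> _ [h Hh <-].
  exists ((x^-1 * y)^-1 * h); first exact/HM/Hh/HV.
  by rewrite invgM invgK !mulgA mulgV mul1g.
by exists (x^-1 * y * h); [exact: HM|rewrite !mulgA mulgV mul1g].
Qed.

Lemma has_indexP K H n : is_subgroup H ->
  (has_index K H n <-> exists phi, coset_index K H n phi).
Proof.
move=> HH; split.
  move=> /card_set_bijP[f [f_fun f_inj f_surj]].
  exists (fun x => f [set x * h | h in H]); split.
  - by move=> x Kx; apply: f_fun; exists x.
  - by move=> i /f_surj[_ [x Kx <-] <-]; exists x.
  - move=> x y Kx Ky; rewrite -coset_eqP //; split=> [|-> //].
    by apply: f_inj; rewrite inE; [exists x|exists y].
move=> [phi [phi_lt phi_surj phi_eq]]; rewrite /has_index card_eq_sym.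
have /choice[r rP] : forall i, exists x, (i < n)%N -> K x /\ phi x = i.
  move=> i; have [/phi_surj[x Kx xi]|_] := boolP (i < n)%N; first by exists x.
  by exists 1.
have set_bij_r : set_bij `I_n [set [set x * h | h in H] | x in K]
    (fun i => [set r i * h | h in H]).
  split.
  - by move=> i /rP[Kr _]; exists (r i).
  - move=> i j; rewrite !inE => /rP[Ki ri] /rP[Kj rj] /(coset_eqP _ _ HH).
    by move/(phi_eq _ _ Ki Kj); rewrite ri rj.
  - move=> _ [x Kx <-]; exists (phi x); first exact: phi_lt.
    have [Kr rx] := rP _ (phi_lt x Kx).
    by apply/(coset_eqP _ _ HH)/phi_eq.
exact: pcard_eq (bij_of_set_bijection set_bij_r).
Qed.

Lemma has_index_uniq K H a b : has_index K H a -> has_index K H b -> a = b.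
Proof.
move=> Ka Kb; apply/card_eq_II.
by apply: card_eq_trans Kb; rewrite card_eq_sym.
Qed.

Lemma has_index_gt0 K H n : is_subgroup H -> K 1 -> has_index K H n ->
  (0 < n)%N.
Proof.
move=> HH K1 /(has_indexP _ _ HH)[phi [phi_lt _ _]].
exact: leq_ltn_trans (phi_lt 1 K1).
Qed.

Lemma has_index_refl K : is_subgroup K -> has_index K K 1.
Proof.
move=> HK; have [K1 KM KV] := HK; apply/has_indexP => //.
exists (fun=> 0%N); split=> // [[|//] _|x y Kx Ky]; first by exists 1.
by split=> // _; exact/KM/Ky/KV.
Qed.

Lemma has_index_mul K M H a b :
  is_subgroup K -> is_subgroup M -> is_subgroup H -> H `<=` M -> M `<=` K ->
  has_index K M a -> has_index M H b -> has_index K H (a * b).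
Proof.
move=> HK HM HH HsM MsK; have [[K1 KM KV] [M1 MM MV]] := (HK, HM).
move=> /(has_indexP _ _ HM)[f [f_lt f_surj f_eq]].
move=> /(has_indexP _ _ HH)[g [g_lt g_surj g_eq]].
have /choice[r rP] : forall i, exists x, (i < a)%N -> K x /\ f x = i.
  move=> i; have [/f_surj[x Kx xi]|_] := boolP (i < a)%N; first by exists x.
  by exists 1.
have rM x : K x -> M ((r (f x))^-1 * x).
  by move=> Kx; have [Kr rx] := rP _ (f_lt x Kx); apply/f_eq.
apply/has_indexP => //.
exists (fun x => f x * b + g ((r (f x))^-1 * x)%g)%N; split.
- move=> x Kx /=; have := f_lt x Kx; have := g_lt _ (rM x Kx).
  by move: (g ((r (f x))^-1 * x)) => j; move: (f x) => i *; nia.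
- move=> i i_lt; have b_gt0 : (0 < b)%N by case: (b) i_lt => //; rewrite muln0.
  have [Kr ri] : K (r (i %/ b)) /\ f (r (i %/ b)) = (i %/ b)%N.
    by apply: rP; rewrite ltn_divLR.
  have [y My yi] := g_surj (i %% b)%N (ltn_pmod i b_gt0).
  have fry : f (r (i %/ b) * y) = (i %/ b)%N.
    rewrite -[RHS]ri; apply/f_eq => //; first by apply: KM => //; exact: MsK.
    by rewrite invgM mulgVK; exact: MV.
  exists (r (i %/ b) * y); first by apply: KM => //; exact: MsK.
  by rewrite fry mulKg yi -divn_eq.
- move=> x y Kx Ky; have [gx gy] := (g_lt _ (rM x Kx), g_lt _ (rM y Ky)).
  split=> [E|Hxy].
    have [Ef Eg] : f x = f y /\ g ((r (f x))^-1 * x) = g ((r (f y))^-1 * y).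
      move: gx gy E; move: (g ((r (f x))^-1 * x)) (g ((r (f y))^-1 * y)).
      move=> i j; move: (f x) (f y) => p q i_lt j_lt E.
      suff pq : p = q by split=> //; move: E; rewrite pq => /addnI.
      have := congr1 (divn^~ b) E;
        rewrite /= !divnMDl ?(leq_ltn_trans _ i_lt) //.
      by rewrite !divn_small // !addn0.
    have [My] := (rM y Ky, g_eq _ _ (rM x Kx) (rM y Ky)).
    by rewrite Eg => -[/(_ erefl)]; rewrite Ef invgM invgK !mulgA mulgK.
  have Ef : f x = f y by apply/f_eq => //; exact: HsM.
  congr (_ * _ + _)%N => //; apply/(g_eq _ _ (rM x Kx) (rM y Ky)).
  by rewrite Ef invgM invgK !mulgA mulgK.
Qed.

Lemma bounded_has_index K H n (phi : G -> nat) : is_subgroup H ->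
  (forall x, K x -> (phi x < n)%N) ->
  (forall x y, K x -> K y -> phi x = phi y -> H (x^-1 * y)) ->
  exists m, has_index K H m.
Proof.
move=> HH phi_lt phi_eq; apply/finite_setP.
have /choice[r rP] : forall i, exists x, forall y, K y -> phi y = i ->
  K x /\ phi x = i.
  move=> i; have [[y [Ky yi]]|no] := pselect (exists y, K y /\ phi y = i).
    by exists y.
  by exists 1 => y Ky yi; case: no; exists y.
apply: (@sub_finite_set _ _ ((fun i => [set r i * h | h in H]) @` `I_n)).
  move=> _ [x Kx <-]; exists (phi x); first exact: phi_lt.
  have [Kr rx] := rP _ x Kx erefl.
  by apply/(coset_eqP _ _ HH); exact: phi_eq.
by apply: finite_image; exact: finite_II.
Qed.

Lemma has_index_sub K M H n : is_subgroup M -> is_subgroup H -> M `<=` K ->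
  has_index K H n -> exists m, has_index M (M `&` H) m.
Proof.
move=> HM HH MK /(has_indexP _ _ HH)[f [f_lt f_surj f_eq]].
apply: (@bounded_has_index _ _ n f); first exact: subgroupI.
  by move=> x /MK /f_lt.
move=> x y Mx My /(f_eq _ _ (MK _ Mx) (MK _ My)) Hxy; split=> //.
by have [_ MM MV] := HM; exact/MM/My/MV.
Qed.

Lemma has_index_inter K H1 H2 a b :
  is_subgroup K -> is_subgroup H1 -> is_subgroup H2 -> H1 `<=` K -> H2 `<=` K ->
  has_index K H1 a -> has_index K H2 b ->
  exists l1 l2, [/\ has_index H1 (H1 `&` H2) l1, has_index H2 (H1 `&` H2) l2
                 & (a * l1 = b * l2)%N].
Proof.
move=> HK HH1 HH2 H1K H2K ia ib.
have [l1 i1] := has_index_sub HH1 HH2 H1K ib.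
have [l2 i2] := has_index_sub HH2 HH1 H2K ia.
have HI := subgroupI HH1 HH2.
rewrite setIC in i2; exists l1, l2; split=> //.
have j1 := has_index_mul HK HH1 HI (@subIsetl _ _ _) H1K ia i1.
have j2 := has_index_mul HK HH2 HI (@subIsetr _ _ _) H2K ib i2.
exact: has_index_uniq j1 j2.
Qed.

(** Pigeonhole: two of the powers of x with exponents 0 to n lie in the same coset. *)
Lemma has_index_power K H n x : is_subgroup K -> is_subgroup H ->
  has_index K H n -> K x -> exists2 i, (0 < i)%N & H (x ^+ i).
Proof.
move=> HK HH /(has_indexP _ _ HH)[f [f_lt _ f_eq]] Kx.
have Kn i : K (x ^+ i) by exact: (zexp_in (Posz i) HK Kx).
pose g (i : 'I_n.+1) := Ordinal (f_lt _ (Kn i)).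
have [/leq_card|] := pselect (injective g); first by rewrite !card_ord ltnn.
move=> ninj; have [i [j [ij /(congr1 val) /= gij]]] :
    exists i j : 'I_n.+1, (i < j)%N /\ g i = g j.
  apply: contrapT => no; apply: ninj => i j gij; apply: val_inj => /=.
  by case: (ltngtP i j) => // ij; case: no; [exists i, j|exists j, i].
exists (j - i)%N; first by rewrite subn_gt0.
move/(f_eq _ _ (Kn i) (Kn j)): gij; rewrite -{1}(subnKC (ltnW ij)) expgnDr.
by rewrite mulKg.
Qed.

End Index.

(** Since H is the preimage of H' in K, f matches the cosets. It serves for the projection modulo
    the center as well as for embeddings of free groups. *)
Lemma has_index_image (G L : groupType) (f : G -> L) (K H : set G) (H' : set L)
    n :
  morph f -> is_subgroup K -> is_subgroup H -> is_subgroup H' ->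
  (forall x, K x -> (H x <-> H' (f x))) ->
  (has_index K H n <-> has_index (f @` K) H' n).
Proof.
move=> fM HK HH HH' HE; have [K1 KM KV] := HK.
have E x y : K x -> K y -> (H (x^-1 * y) <-> H' ((f x)^-1 * f y)).
  move=> Kx Ky; rewrite -(morphV fM) -fM; apply: HE.
  by apply: KM => //; exact: KV.
rewrite (has_indexP _ _ HH) (has_indexP _ _ HH'); split.
  move=> [p [p_lt p_surj p_eq]].
  have /choice[r rP] : forall y, exists x, (f @` K) y -> K x /\ f x = y.
    move=> y; have [[x Kx xy]|no] := pselect ((f @` K) y); first by exists x.
    by exists 1 => /no.
  exists (p \o r); split.
  - by move=> y /rP[Kx _]; exact: p_lt.
  - move=> i /p_surj[x Kx xi]; exists (f x); first by exists x.
    have [Kr rx] := rP (f x) (ex_intro2 _ _ x Kx erefl).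
    by rewrite -xi /=; apply/(p_eq _ _ Kr Kx)/E => //; rewrite rx mulVg;
      case: HH'.
  - move=> y z /rP[Ky ry] /rP[Kz rz] /=.
    by rewrite (p_eq _ _ Ky Kz) E // ry rz.
move=> [p [p_lt p_surj p_eq]]; exists (p \o f); split.
- by move=> x Kx; apply: p_lt; exists x.
- by move=> i /p_surj[_ [x Kx <-] xi]; exists x.
- move=> x y Kx Ky; rewrite E //; apply: p_eq; [by exists x|by exists y].
Qed.

(** * Presented groups *)

Section PresentedUniversal.
Local Open Scope quotient_scope.
Variables (X : choiceType) (R : seq (X * bool) -> seq (X * bool) -> Prop).

Definition word (w : seq (X * bool)) : presented R := \pi w.
Definition letter (x : X) : presented R := word [:: (x, false)].

Lemma word_cat u v : word (u ++ v) = word u * word v.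
Proof. by rewrite /word -pmulE. Qed.

Lemma word_repr p : word (repr p) = p.
Proof. exact: reprK. Qed.

Lemma word_letterV x : word [:: (x, true)] = (letter x)^-1.
Proof. by rewrite -[RHS]/(pinv _) /letter /word pinvE. Qed.

Lemma word_rel u v : R u v -> word u = word v.
Proof. by move=> Ruv; apply/eqP/word_eqP; exact: word_eq_rel. Qed.

Lemma letter_generates (H : set (presented R)) :
  is_subgroup H -> (forall x, H (letter x)) -> forall g, H g.
Proof.
move=> [H1 HM HV] Hx g; rewrite -(word_repr g); elim: (repr g) => [|[x b] w IH].
  exact: H1.
rewrite -cat1s word_cat; apply: HM IH.
by case: b; [rewrite word_letterV; exact: HV|exact: Hx].
Qed.

Section Evaluation.
Variables (K : groupType) (f : X -> K).

Definition word_value (w : seq (X * bool)) : K :=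
  foldr (fun a z => (if a.2 then (f a.1)^-1 else f a.1) * z) 1 w.

Lemma word_value_cat u v : word_value (u ++ v) = word_value u * word_value v.
Proof. by elim: u => [|a u IH] /=; rewrite ?mul1g // IH mulgA. Qed.

Hypothesis fR : forall u v, R u v -> word_value u = word_value v.

Lemma word_value_eq u v : word_eq R u v -> word_value u = word_value v.
Proof.
elim=> {u v} [//|u v _ -> //|u v w _ -> _ ->
  //|u u' v v' _ E _ E'|x b|u v /fR //].
  by rewrite !word_value_cat E E'.
by case: b; rewrite /word_value /= mulg1 ?mulVg ?mulgV.
Qed.

Lemma presented_universal : exists Phi : presented R -> K,
  morph Phi /\ forall x, Phi (letter x) = f x.
Proof.
have val_word w : word_value (repr (word w)) = word_value w.
  exact/word_value_eq/word_eq_repr.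
exists (fun p => word_value (repr p)); split.
  move=> p q; rewrite -{1}(word_repr p) -{1}(word_repr q) -word_cat val_word.
  exact: word_value_cat.
by move=> x; rewrite val_word /= mulg1.
Qed.

End Evaluation.
End PresentedUniversal.

Lemma free_group_universal n (K : groupType) (f : 'I_n -> K) :
  exists Phi : free_group n -> K, morph Phi /\ forall i, Phi (letter _ i) = f i.
Proof. exact: presented_universal. Qed.

Lemma morph_ext (X : choiceType) R (K : groupType) (f g : @presented X R -> K) :
  morph f -> morph g -> (forall x, f (letter _ x) = g (letter _ x)) -> f = g.
Proof.
move=> fM gM fg; apply: funext.
apply: (letter_generates (H := [set p | f p = g p])) => //; split.
- by rewrite /= (morph1 fM) (morph1 gM).
- by move=> x y /= fx fy; rewrite fM gM fx fy.
- by move=> x /= fx; rewrite (morphV fM) (morphV gM) fx.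
Qed.

Lemma pi1_is_pi1 (A : graph_of_groups) (T : {set edge A}) :
  is_pi1 T (fun v x => letter (@pi1_rel A T) (vgen x))
    (fun e => letter (@pi1_rel A T) (egen e)).
Proof.
split.
- split.
  + move=> v x y; rewrite /letter -word_cat; apply/esym/word_rel.
    exact: Pi1Vertex.
  + move=> e c; rewrite -word_letterV /letter -(word_cat _ [:: _] [::
    _]) -word_cat.
    by apply: word_rel; exact: Pi1Edge.
  + move=> e eT; rewrite -[RHS]/(word _ [::]); apply: word_rel.
    exact: Pi1Tree.
- move=> H HH Hv He; apply: letter_generates => // -[[v x]|e]; last exact: He.
  exact: (Hv v x).
move=> K jv tau [jvM tau_rel tau1].
pose f (g : pi1_gen A) := match g with inl p => jv (tag p) (tagged p)
                                     | inr e => tau e end.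
have [|Phi [PhiM Phi_l]] := @presented_universal _ (@pi1_rel A T) K f.
  move=> _ _ [v x y|e c|e eT]; rewrite /word_value /= ?mulg1.
  - by rewrite jvM.
  - by rewrite mulgA tau_rel.
  - exact: tau1.
by exists Phi; split=> // [v x|e]; rewrite Phi_l.
Qed.

Lemma is_pi1_isog (A : graph_of_groups) (T : {set edge A}) (G : groupType) :
  isog G (pi1 T) -> exists (iv : forall v : vertex A, vgrp v -> G) st,
    is_pi1 T iv st.
Proof.
move=> [F [F' FK F'K]]; have FM := multiplicative_morph F.
have F'M : morph F' by move=> x y; apply: (can_inj FK); rewrite FM !F'K.
have [[jM j_rel j1] gen univ] := pi1_is_pi1 T.
exists (fun v x => F' (letter _ (vgen x))), (fun e => F' (letter _ (egen e))).
split.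
- split=> [v x y|e c|e eT]; first by rewrite jM F'M.
    by rewrite -(morphV F'M) -!F'M j_rel.
  by rewrite j1 // (morph1 F'M).
- move=> H HH Hv He g; rewrite -(FK g).
  by apply: (gen (F' @^-1` H)) => //; exact: (morph_preimage_subgroup F'M).
- move=> K jv tau /univ[Phi [PhiM Phi_v Phi_e]]; exists (Phi \o F).
  split=> [|v x|e] /=; [exact: morph_comp|by rewrite F'K Phi_v|].
  by rewrite F'K Phi_e.
Qed.

(** The trivial group, for the vertices and edges of bouquets. *)
Definition unit_mul (x y : unit) := tt.
Definition unit_inv (x : unit) := tt.
Lemma unit_mulA : associative unit_mul. Proof. by []. Qed.
Lemma unit_mul1 : left_id tt unit_mul. Proof. by case. Qed.
Lemma unit_mulr1 : right_id tt unit_mul. Proof. by case. Qed.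
Lemma unit_mulV : left_inverse tt unit_inv unit_mul. Proof. by case. Qed.
Lemma unit_mulrV : right_inverse tt unit_inv unit_mul. Proof. by case. Qed.
HB.instance Definition _ := isGroup.Build unit
  unit_mulA unit_mul1 unit_mulr1 unit_mulV unit_mulrV.

(* Makes [pi1_subgroup_free] applicable to subgroups of free groups. *)
Definition bouquet (n : nat) : graph_of_groups :=
  @GraphOfGroups unit 'I_n (fun=> tt) (fun=> tt) (fun=> unit) (fun=> unit)
    (fun=> idfun) (fun=> idfun) (fun _ => @inj_id _) (fun _ => @inj_id _).

Lemma bouquet_tree n : spanning_tree (finset.set0 : {set edge (bouquet n)}).
Proof.
split=> [|[] [] //|e]; first by rewrite card_unit.
by rewrite inE.
Qed.

Lemma bouquet_pi1 n : is_pi1 (finset.set0 : {set edge (bouquet n)})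
  (fun v (x : vgrp v) => 1 : free_group n)
  (fun e : edge (bouquet n) => letter _ (e : 'I_n)).
Proof.
split.
- split=> [v x y|e c|e]; rewrite ?mulg1 ?mulgV //.
  by rewrite inE.
- by move=> H HH _ He g; exact: letter_generates.
move=> K jv tau [jvM _ _]; have [Phi [PhiM Phi_l]] := free_group_universal tau.
exists Phi; split=> // -[] [].
by rewrite (morph1 PhiM) -[tt]/(1 : unit) (morph1 (jvM tt)).
Qed.

(** * Hereditarily free subgroups *)

Section FreeOn.
Variable G : groupType.
Implicit Types H : set G.

(** The exponent sum in one basis element. *)
Lemma free_on_exponent H (I : Type) (B : set I) (y : I -> G) b :
  is_subgroup H -> free_on H B y -> B b -> exists phi : G -> Zgroup,
  [/\ forall g h, H g -> H h -> phi (g * h) = phi g * phi h,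
      phi (y b) = (1%R : int) & forall c, B c -> c <> b -> phi (y c) = 1].
Proof.
move=> HH [yH _ univ] Bb.
have [phi [phiM phi_y]] := univ Zgroup (fun c =>
  if `[< c = b >] then 1%R else 0%R).
exists phi; split=> //; first by rewrite phi_y // asboolT.
by move=> c Bc cb; rewrite phi_y // asboolF.
Qed.

Lemma partial_morph1 H (K : groupType) (phi : G -> K) : is_subgroup H ->
  (forall g h, H g -> H h -> phi (g * h) = phi g * phi h) -> phi 1 = 1.
Proof.
by move=> [H1 _ _] phiM; apply: (mulgI (phi 1)); rewrite -phiM // !mulg1.
Qed.

Lemma partial_morphV H (K : groupType) (phi : G -> K) x : is_subgroup H ->
  (forall g h, H g -> H h -> phi (g * h) = phi g * phi h) -> H x ->
  phi x^-1 = (phi x)^-1.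
Proof.
move=> HH phiM Hx; have [_ _ HV] := HH.
apply: (mulgI (phi x)); rewrite -(phiM x _ Hx (HV x Hx)) !mulgV.
exact: (partial_morph1 HH phiM).
Qed.

Lemma partial_morph_zexp H (K : groupType) (phi : G -> K) x i : is_subgroup H ->
  (forall g h, H g -> H h -> phi (g * h) = phi g * phi h) -> H x ->
  phi (zexp x i) = zexp (phi x) i.
Proof.
move=> HH phiM Hx; have [_ _ HV] := HH.
elim/int_rect: i => [|n IH|n IH]; first exact: (partial_morph1 HH phiM).
  have -> : Posz n.+1 = (Posz n + 1)%R by lia.
  by rewrite !zexpS phiM ?IH //; exact: zexp_in.
have -> : (- Posz n.+1 = - Posz n - 1)%R by lia.
rewrite !zexpP phiM ?IH ?(partial_morphV HH phiM) //; first exact: zexp_in.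
exact: HV.
Qed.

Lemma free_on_commute H (I : Type) (B : set I) (y : I -> G) b c :
  free_on H B y -> B b -> B c -> commute (y b) (y c) -> b = c.
Proof.
move=> [yH _ univ] Bb Bc; apply: contraPP => bc.
have two_neq0 : (2 != 0 :> rat)%R by [].
(* Two affine maps that do not commute: the homothety of ratio 2 and the translation by 1. *)
pose f d : aff := if `[< d = b >] then mkaff two_neq0 0%R
                  else mkaff (oner_neq0 _) 1%R.
have [phi [phiM phi_y]] := univ _ f.
move=> /(congr1 phi); rewrite !phiM ?phi_y //; try exact: yH.
rewrite /f asboolT // asboolF; last by move=> /esym.
by move=> /(congr1 shift); rewrite !shiftM /scale /shift /=.
Qed.

Lemma free_on_no_basis H (I : Type) (B : set I) (y : I -> G) :
  free_on H B y -> (forall b, ~ B b) -> forall x, H x -> x = 1.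
Proof.
move=> [_ gen _] B0 x /gen x_gen; apply: (x_gen [set 1]).
  by split=> // [_ _ -> ->|_ ->] /=; rewrite ?mulg1 ?invg1.
by move=> _ [b Bb <-]; case: (B0 b Bb).
Qed.

Lemma free_on_one_basis H (I : Type) (B : set I) (y : I -> G) b :
  free_on H B y -> B b -> (forall c, B c -> c = b) ->
  forall x, H x -> exists i, x = zexp (y b) i.
Proof.
move=> [_ gen _] Bb B1 x /gen x_gen; apply: generated1_zexp => K HK yK.
by apply: x_gen => // _ [c /B1 -> <-]; apply: yK.
Qed.

(** Allows statements about one or two elements to be proved inside the subgroup that they
    generate. *)
Definition hereditarily_free H : Prop :=
  forall H', is_subgroup H' -> H' `<=` H ->
    exists (I : Type) (B : set I) (y : I -> G), free_on H' B y.

Section HereditarilyFree.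
Variable H : set G.
Hypotheses (HH : is_subgroup H) (HF : hereditarily_free H).

(** A basis element of the subgroup generated by x would be a power of x, hence torsion, against its
    exponent sum. So the basis is empty. *)
Lemma free_torsion x n : H x -> (0 < n)%N -> x ^+ n = 1 -> x = 1.
Proof.
move=> Hx n_gt0 xn; set C := generated [set x].
have CC : is_subgroup C by exact: generated_subgroup.
have Cx : C x by exact: sub_generated.
have CH : C `<=` H by apply: generated_min => // _ ->.
have [I [B [y free_y]]] := HF CC CH.
apply: (free_on_no_basis free_y) => // b Bb.
have [yC _ _] := free_y.
have [phi [phiM phi_b _]] := free_on_exponent CC free_y Bb.
have [i yi] := generated1_zexp (yC b Bb).
have : zexp (y b) (Posz n) = 1 by rewrite yi -zexpM mulrC zexpM /= xn zexp1g.
move/(congr1 phi); rewrite (partial_morph_zexp _ CC phiM) ?(partial_morph1 CC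
  phiM).
  by rewrite phi_b zexp_Zgroup mulr1 => -[n0]; move: n_gt0; rewrite n0.
exact: yC.
Qed.

Lemma free_torsion_zexp x i : H x -> i != 0%R -> zexp x i = 1 -> x = 1.
Proof.
move=> Hx i0 xi; apply: (@free_torsion x `|i|%N) => //; first by lia.
case: (lerP 0%R i) => i_sgn.
  by rewrite -[_ ^+ _]/(zexp x (Posz _)) (_ : Posz `|i|%N = i) //; lia.
rewrite -[_ ^+ _]/(zexp x (Posz _)) (_ : Posz `|i|%N = (- i)%R); last by lia.
by rewrite zexpN xi invg1.
Qed.

(** The subgroup generated by u and v is free and abelian, so its basis has at most one element. *)
Lemma free_commute u v : H u -> H v -> commute u v ->
  exists w, [/\ H w, exists i, u = zexp w i & exists j, v = zexp w j].
Proof.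
move=> Hu Hv uv; set C := generated [set u; v].
have CC : is_subgroup C by exact: generated_subgroup.
have CH : C `<=` H by apply: generated_min => // _ [->|->].
have [Cu Cv] : C u /\ C v by split; apply: sub_generated; [left|right].
have [I [B [y free_y]]] := HF CC CH; have [yC _ _] := free_y.
have [[b Bb]|B0] := pselect (exists b, B b); last first.
  have C1 : forall x, C x -> x = 1.
    by apply: (free_on_no_basis free_y) => b Bb; apply: B0; exists b.
  exists 1; rewrite (C1 u) // (C1 v) //; split; try by exists 0%R.
  by case: HH.
have B1 c : B c -> c = b.
  move=> Bc; apply: (free_on_commute free_y Bc Bb).
  have [i [j ->]] := generated2_zexp uv (yC c Bc).
  have [i' [j' ->]] := generated2_zexp uv (yC b Bb).
  have vu := commute_sym uv.
  apply: commute_sym; apply: commuteM; apply: commute_sym.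
    apply: commuteM; last exact: commute_zexp2.
    by apply: commute_zexp2; exact: commute_refl.
  apply: commuteM; first exact: commute_zexp2.
  by apply: commute_zexp2; exact: commute_refl.
exists (y b); split; first exact: CH (yC b Bb).
  exact: (free_on_one_basis free_y Bb B1).
exact: (free_on_one_basis free_y Bb B1).
Qed.

End HereditarilyFree.

Lemma hereditarily_free_sub H H' :
  hereditarily_free H -> H' `<=` H -> hereditarily_free H'.
Proof. by move=> HF HH' K HK KH'; apply: HF => // x /KH' /HH'. Qed.

(** Such a z is a power of each basis element: z and [y d] are powers of a common w, and [y d] has
    exponent 1 or -1 because its exponent sum is 1. Two distinct basis elements would then force z =
    1. *)
Lemma free_center H z : is_subgroup H -> hereditarily_free H -> H z -> z <> 1 ->
  (forall x, H x -> commute z x) ->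
  exists2 w, H w & forall x, H x -> exists i, x = zexp w i.
Proof.
move=> HH HF Hz z1 z_central; have [//|I [B [y free_y]]] := HF H HH.
have [yH _ _] := free_y.
have [[b Bb]|B0] := pselect (exists b, B b); last first.
  by case: z1; apply: (free_on_no_basis free_y) => // b Bb; apply: B0; exists b.
have [B1|] := pselect (forall c, B c -> c = b).
  exists (y b); first exact: yH.
  exact: (free_on_one_basis free_y Bb B1).
move=> /existsNP[c /not_implyP[Bc cb]].
have z_power d : B d -> exists j, z = zexp (y d) j.
  move=> Bd; have [phi [phiM phi_d _]] := free_on_exponent HH free_y Bd.
  have [w [Hw [i zi] [j yj]]] :=
    free_commute HH HF Hz (yH d Bd) (z_central _ (yH d Bd)).
  exists (j * i)%R; have := phi_d;
    rewrite {1}yj (partial_morph_zexp _ HH phiM) //.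
  rewrite zexp_Zgroup => j_unit.
  have jj : (j * j = 1)%R.
    have /eqP := congr1 absz (j_unit : (j * (phi w : int))%R = 1%R).
    by rewrite abszM muln_eq1 => /andP[/eqP j1 _]; nia.
  by rewrite zexpM yj -(zexpM w j j) jj.
have [i zi] := z_power b Bb; have [j zj] := z_power c Bc.
have [phi [phiM phi_b phi_c]] := free_on_exponent HH free_y Bb.
have := congr1 phi zj; rewrite (partial_morph_zexp _ HH phiM) ?(phi_c c) //;
  last exact: yH.
rewrite zexp1g zi (partial_morph_zexp _ HH phiM) ?phi_b; last exact: yH.
by rewrite zexp_Zgroup mulr1 => i0; case: z1; rewrite zi (i0 : i = 0%R).
Qed.

(** Unless it is 1, the common power is central in the subgroup generated by u and v, which is
    therefore cyclic. *)
Lemma free_root H u v n : is_subgroup H -> hereditarily_free H -> H u -> H v ->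
  (0 < n)%N -> u ^+ n = v ^+ n -> u = v.
Proof.
move=> HH HF Hu Hv n_gt0 uvn; have [un1|un_neq1] := pselect (u ^+ n = 1).
  rewrite (free_torsion HH HF Hu n_gt0 un1) (free_torsion HH HF Hv n_gt0) //.
  by rewrite -uvn.
set C := generated [set u; v].
have CC : is_subgroup C by exact: generated_subgroup.
have CH : C `<=` H by apply: generated_min => // _ [->|->].
have [Cu Cv] : C u /\ C v by split; apply: sub_generated; [left|right].
have [||w Cw w_gen] := free_center CC (hereditarily_free_sub HF CH) _ un_neq1.
- exact: (zexp_in (Posz n) CC Cu).
- move=> x Cx; apply: (Cx [set x | commute (u ^+ n) x]).
    split=> [|a b /= Pa Pb|a /= Pa]; first exact: commute1.
      exact: commuteM.
    exact: commuteV.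
  move=> _ [->|->] /=; first by apply/commute_sym/commuteX/commute_refl.
  by rewrite uvn; apply/commute_sym/commuteX/commute_refl.
have [[i ui] [j vj]] := (w_gen u Cu, w_gen v Cv).
have [ij|ij] := eqVneq i j; first by rewrite ui vj ij.
case: un_neq1; suff w1 : w = 1 by rewrite ui w1 zexp1g expg1n.
apply: (free_torsion_zexp HH HF (i := ((i - j) * Posz n)%R)); first exact: CH.
  by rewrite mulf_neq0 // ?subr_eq0 //; lia.
rewrite mulrBl zexpD zexpN !zexpM -ui -vj /= uvn mulgV //.
Qed.

End FreeOn.

Lemma free_on_image (G L : groupType) (f : G -> L) (H : set G) (I : Type)
    (B : set I) (y : I -> G) :
  morph f -> injective f -> is_subgroup H -> free_on H B y ->
  free_on (f @` H) B (f \o y).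
Proof.
move=> fM f_inj HH [yH gen univ]; split.
- by move=> b Bb; exists (y b) => //; exact: yH.
- move=> _ [x Hx <-] K HK yK.
  apply: (gen x Hx (f @^-1` K)); first exact: morph_preimage_subgroup.
  by move=> _ [b Bb <-]; apply: yK; exists b.
- move=> K g; have [phi [phiM phi_y]] := univ K g.
  have /choice[r rP] : forall z, exists x, (f @` H) z -> H x /\ f x = z.
    move=> z; have [[x Hx xz]|no] := pselect ((f @` H) z); first by exists x.
    by exists 1 => /no.
  have rf x : H x -> r (f x) = x.
    by move=> Hx; apply: f_inj; case: (rP (f x) (ex_intro2 _ _ x Hx erefl)).
  exists (phi \o r); split; last by move=> b Bb; rewrite /= rf ?phi_y //;
    exact: yH.
  move=> _ _ [x Hx <-] [z Hz <-] /=; rewrite -fM !rf ?phiM //.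
  by have [_ HM _] := HH; exact: HM.
Qed.

Lemma hereditarily_free_image (G L : groupType) (f : G -> L) (H : set G) :
  morph f -> injective f -> is_subgroup H -> hereditarily_free H ->
  hereditarily_free (f @` H).
Proof.
move=> fM f_inj HH HF K HK KH.
have [||I [B [y free_y]]] := HF (f @^-1` K).
- exact: morph_preimage_subgroup.
- by move=> x /= /KH [z Hz /f_inj <-].
exists I, B, (f \o y).
have -> : K = f @` (f @^-1` K).
  rewrite eqEsubset; split=> [z Kz|_ [x Kx <-] //].
  by have [x _ xz] := KH z Kz; exists x => //=; rewrite xz.
by apply: free_on_image => //; exact: morph_preimage_subgroup.
Qed.

Lemma pi1_hereditarily_free (A : graph_of_groups) (T : {set edge A})
    (G : groupType) (iv : forall v : vertex A, vgrp v -> G) (st : edge A -> G)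
    (H : set G) :
  spanning_tree T -> is_pi1 T iv st ->
  (forall v a x, H (x^-1 * iv v a * x) -> iv v a = 1) -> hereditarily_free H.
Proof.
move=> treeT piG H_free K HK KH; have [/card_gt0P[v0 _] _ _] := treeT.
have [|par [y [_ _ _ _ free_y]]] := pi1_subgroup_free v0 treeT piG HK.
  by move=> v a x /KH; exact: H_free.
by exists _, (qedge iv K `\` [set e | exists u, par u e]), y.
Qed.

Lemma free_group_hereditarily_free n : hereditarily_free [set: free_group n].
Proof. exact: (pi1_hereditarily_free (bouquet_tree n) (bouquet_pi1 n)). Qed.

Lemma subgroup_isogP (K G : groupType) (H : set G) :
  subgroup_isog K H <-> exists f : K -> G, [/\ morph f,
    injective f & range f = H].
Proof.
split=> [[f [f_inj f_H]]|[f [fM f_inj f_H]]].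
  by exists f; split=> //; exact: multiplicative_morph.
by have [F FE] := morph_bundle fM; exists F; rewrite FE.
Qed.

Lemma free_isog_hereditarily_free n (G : groupType) (H : set G) :
  subgroup_isog (free_group n) H -> hereditarily_free H.
Proof.
move=> /subgroup_isogP[f [fM f_inj <-]]; apply: hereditarily_free_image => //.
exact: free_group_hereditarily_free.
Qed.

Lemma free_on_isog (G : groupType) (H : set G) (I : Type) (B : set I)
    (y : I -> G) r :
  is_subgroup H -> B #= `I_r -> free_on H B y -> subgroup_isog (free_group r) H.
Proof.
move=> HH /card_set_bijP[c [c_lt c_inj c_surj]] [yH gen univ].
have /choice[e eP] : forall i : 'I_r, exists b, B b /\ c b = i.
  by move=> i; have [b Bb bi] := c_surj i (ltn_ord i); exists b.
have [Phi [PhiM Phi_l]] := free_group_universal (y \o e).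
have [phi [phiM phi_y]] := univ (free_group r)
  (fun b => if insub (c b) is Some i then letter _ i else 1).
have PhiH w : H (Phi w).
  apply: (letter_generates (H := Phi @^-1` H)).
    exact: morph_preimage_subgroup.
  by move=> i /=; rewrite Phi_l; apply: yH; case: (eP i).
have phiK : cancel Phi phi.
  have E : phi \o Phi = id.
    apply: morph_ext => //; first by move=> x z /=; rewrite PhiM phiM.
    move=> i; rewrite /= Phi_l /= phi_y; last by case: (eP i).
    by have [_ ->] := eP i; rewrite valK.
  by move=> w; rewrite -[RHS]/(id w) -E.
apply/subgroup_isogP; exists Phi; split=> //; first exact: can_inj phiK.
rewrite eqEsubset; split=> [_ [w _ <-] //|x Hx].
apply: (gen x Hx); first exact: (morph_image_subgroup PhiM (subgroupT _)).
move=> _ [b Bb <-]; exists (letter _ (Ordinal (c_lt b Bb))) => //.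
have [Be ce] := eP (Ordinal (c_lt b Bb)).
by rewrite Phi_l /=; congr y; apply: c_inj; rewrite ?inE.
Qed.

(** * Schreier's formula and the rank of a free group *)

Lemma card_ord_setT n : [set: 'I_n] #= `I_n.
Proof.
apply/card_set_bijP; exists val; split=> [i _ /=|i j _ _ /val_inj //|i /= i_lt].
  exact: ltn_ord.
by exists (Ordinal i_lt).
Qed.

Lemma card_set1_I (T : Type) (x : T) : [set x] #= `I_1.
Proof.
apply/card_set_bijP; exists (fun=> 0%N); split=> // [y z|[|//] _].
  by rewrite !inE => -> ->.
by exists x.
Qed.

Lemma card_image_I (T U : Type) (A : set T) (f : T -> U) n :
  {in A &, injective f} -> (f @` A #= `I_n) = (A #= `I_n).
Proof. by move=> f_inj; apply/card_eql/inj_card_eq. Qed.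

Lemma card_coset_reps (G : groupType) (S H : set G) k :
  is_subgroup S -> is_subgroup H -> S = [set 1] -> has_index setT H k ->
  [set x | dcrep S H x = x] #= `I_k.
Proof.
move=> HS HH S1 /(has_indexP _ _ HH)[f [f_lt f_surj f_eq]].
have [H1 HM HV] := HH.
have rep_eq x : f (dcrep S H x) = f x.
  have [s [h [Ss Hh {2}->]]] := dcrepP HS HH x.
  move: Ss; rewrite S1 => ->; rewrite mul1g; apply/f_eq => //.
  by rewrite mulKg.
apply/card_set_bijP; exists f; split.
- by move=> x _; exact: f_lt.
- move=> x y; rewrite !inE /= => rx ry /(f_eq x y) Hxy.
  by rewrite -rx -ry -(dcrep_eqr HS HH x (Hxy I I)) mulVKg.
- move=> i /f_surj[x _ <-]; exists (dcrep S H x) => //=.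
  exact: dcrepK.
Qed.

(** The quotient by H of the Cayley tree has k vertices and n k edges, and a maximal tree in it has
    k - 1 edges; the others form a basis. *)
Lemma free_group_schreier n k (H : set (free_group n)) :
  is_subgroup H -> has_index setT H k ->
  exists2 r, subgroup_isog (free_group r) H & (r + k = n * k + 1)%N.
Proof.
move=> HH Hk; have piF := bouquet_pi1 n.
pose iv (v : vertex (bouquet n)) (x : vgrp v) : free_group n := 1.
have [|par [y [par_ex par_in par_fun par_inj free_y]]] :=
  pi1_subgroup_free (tt : vertex (bouquet n)) (bouquet_tree n) piF HH.
  by [].
rewrite -/iv in par_ex par_in free_y.
pose R := [set x : free_group n | dcrep [set 1] H x = x].
have S1 : is_subgroup [set 1 : free_group n].
  by split=> // [_ _ -> ->|_ ->] /=; rewrite ?mulg1 ?invg1.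
have cR : R #= `I_k by exact: card_coset_reps.
have vstab1 v : vstab iv v = [set 1].
  by rewrite eqEsubset; split=> [_ [x _ <-] //|_ ->]; exists (1 : unit).
have estab1 e : estab iv e = [set 1].
  by rewrite eqEsubset; split=> [_ [x _ <-] //|_ ->]; exists (1 : unit).
have cE : qedge iv H #= `I_(n * k).
  have -> : qedge iv H = [set: 'I_n] `*` R.
    rewrite eqEsubset; split=> -[e x]; rewrite /qedge /erep /= estab1 //.
    by case.
  by apply: card_setX_I => //; exact: card_ord_setT.
have cV : qvertex iv H #= `I_k.
  have -> : qvertex iv H = (fun x => (tt, x)) @` R.
    rewrite eqEsubset; split=> [[[] x]|_ [x Rx <-]].
      by rewrite /qvertex /vrep /= vstab1 => Rx; exists x.
    by rewrite /qvertex /vrep /= vstab1.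
  by rewrite card_image_I // => x z _ _ [].
have [|c cVr ck] := card_setD_I (B := [set qroot iv tt H]) _ cV (card_set1_I _).
  by move=> _ -> /=; exact: (vrepK piF HH).
have cP : [set e | exists u, par u e] #= `I_c.
  have /choice[p pP] : forall u, exists oe,
      (qvertex iv H `\` [set qroot iv tt H]) u -> exists2 e,
        oe = Some e & par u e.
    move=> u; have [[Vu uu]|] :=
      pselect ((qvertex iv H `\` [set qroot iv tt H]) u).
      by have [e ue] := par_ex u Vu uu; exists (Some e) => _; exists e.
    by exists None.
  have E : Some @` [set e | exists u, par u e]
           = p @` (qvertex iv H `\` [set qroot iv tt H]).
    rewrite eqEsubset; split=> [_ [e [u ue] <-]|_ [u Vu <-]].
      have [Vu uu _] := par_in u e ue; exists u => //.
      by have [e' -> ue'] := pP u (conj Vu uu); rewrite (par_fun u e e').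
    by have [e -> ue] := pP u Vu; exists e => //; exists u.
  rewrite -(@card_image_I _ _ _ Some); last by move=> e e' _ _ [].
  rewrite E card_image_I // => u u'; rewrite !inE.
  move=> /pP[e -> ue] /pP[e' -> u'e'] [ee']; apply: (par_inj u u' e) => //.
  by rewrite ee'.
have [|r cB rc] := card_setD_I _ cE cP.
  by move=> e [u /par_in[]].
exists r; first exact: free_on_isog cB free_y.
lia.
Qed.

(** On abelianizations, f and g become mutually inverse matrices, which must be square. *)
Lemma free_group_rank r s (f : free_group r -> free_group s) g :
  morph f -> cancel f g -> cancel g f -> r = s.
Proof.
move=> fM fK gK.
have gM : morph g by move=> x y; apply: (can_inj fK); rewrite fM !gK.
have ex m (i : 'I_m) : exists phi : free_group m -> Zgroup, morph phi /\
    forall j, phi (letter _ j) = Posz (i == j).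
  exact: free_group_universal.
have /choice[phi phiP] := ex r; have /choice[psi psiP] := ex s.
have expand m (ph : 'I_m -> free_group m -> Zgroup) :
    (forall i, morph (ph i) /\ forall j, ph i (letter _ j) = Posz (i == j)) ->
    forall (h : free_group m -> Zgroup), morph h ->
    forall w, (h w : int) = (\sum_i (ph i w : int) * h (letter _ i))%R.
  move=> phP h hM w; pose h' w : Zgroup := (\sum_i (ph i w :
    int) * h (letter _ i))%R.
  suff hh' : h = h' by rewrite -[RHS]/(h' w) -hh'.
  apply: morph_ext => //.
    move=> x y; rewrite /h' -[RHS]big_split /=; apply: eq_bigr => i _.
    by have [phM _] := phP i; rewrite phM -mulrDl.
  move=> j; rewrite /h' (bigD1 j) //= big1 => [|i ij].
    by have [_ ->] := phP j; rewrite eqxx mul1r addr0.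
  by have [_ ->] := phP i; rewrite (negbTE ij) mul0r.
pose M := (\matrix_(i, j) ((psi j (f (letter _ i)) : int)%:~R : rat))%R : 'M_(r,
  s).
pose N := (\matrix_(i, j) ((phi j (g (letter _ i)) : int)%:~R : rat))%R : 'M_(s,
  r).
have MN : (M *m N = 1%:M)%R.
  apply/matrixP => i j; rewrite !mxE.
  have [phiM phi_l] := phiP j.
  have := expand _ _ psiP (phi j \o g) (morph_comp gM phiM) (f (letter _ i)).
  rewrite /= fK phi_l eq_sym => E.
  transitivity ((Posz (i == j))%:~R : rat)%R; last by case: eqP.
  rewrite E rmorph_sum; apply: eq_bigr => l _.
  by rewrite !mxE rmorphM.
have NM : (N *m M = 1%:M)%R.
  apply/matrixP => i j; rewrite !mxE.
  have [psiM psi_l] := psiP j.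
  have := expand _ _ phiP (psi j \o f) (morph_comp fM psiM) (g (letter _ i)).
  rewrite /= gK psi_l eq_sym => E.
  transitivity ((Posz (i == j))%:~R : rat)%R; last by case: eqP.
  rewrite E rmorph_sum; apply: eq_bigr => l _.
  by rewrite !mxE rmorphM.
by apply/eqP; rewrite eqn_leq (mulmx1_min MN) (mulmx1_min NM).
Qed.

Lemma subgroup_isog_rank (G : groupType) (H : set G) r s :
  subgroup_isog (free_group r) H -> subgroup_isog (free_group s) H -> r = s.
Proof.
move=> /subgroup_isogP[f [fM f_inj fH]] /subgroup_isogP[g [gM g_inj gH]].
have /choice[a aP] : forall w, exists z, g z = f w.
  move=> w; suff [z _ zw] : range g (f w) by exists z.
  by rewrite gH -fH; exists w.
have /choice[b bP] : forall w, exists z, f z = g w.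
  move=> w; suff [z _ zw] : range f (g w) by exists z.
  by rewrite fH -gH; exists w.
apply: (@free_group_rank r s a b).
- by move=> x y; apply: g_inj; rewrite gM !aP fM.
- by move=> x; apply: f_inj; rewrite bP aP.
- by move=> x; apply: g_inj; rewrite aP bP.
Qed.

Lemma schreier (G : groupType) (M H : set G) n k :
  is_subgroup H -> H `<=` M -> subgroup_isog (free_group n) M ->
    has_index M H k ->
  exists2 r, subgroup_isog (free_group r) H & (r + k = n * k + 1)%N.
Proof.
move=> HH HM /subgroup_isogP[f [fM f_inj fE]] Hk.
have HfH : is_subgroup (f @^-1` H) by exact: morph_preimage_subgroup.
have [|r iso rk] := free_group_schreier HfH (k := k).
  by apply/(has_index_image k fM (subgroupT _) HfH HH) => //; rewrite fE.
exists r => //; have [g [gM g_inj gE]] := (subgroup_isogP _ _).1 iso.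
apply/subgroup_isogP; exists (f \o g); split; first exact: morph_comp.
  exact: inj_comp.
have -> : range (f \o g) = f @` range g by rewrite image_comp.
rewrite gE.
rewrite eqEsubset; split=> [_ [x Hx <-] //|z Hz].
have [x _ xz] : range f z by rewrite fE; exact: HM.
by exists x => //=; rewrite xz.
Qed.

(** * Generalized Baumslag-Solitar groups *)

Section GBS.
Variables (A : graph_of_groups) (T : {set edge A}) (G : groupType).
Variables (iv : forall v : vertex A, vgrp v -> G) (st : edge A -> G).
Variables (a : vertex A -> G) (p q : edge A -> int).

Definition gbs_relations (K : groupType) (al : vertex A -> K) (ta : edge A ->
  K) :=
  (forall e, ta e * zexp (al (tgt e)) (q e) * (ta e)^-1 = zexp (al (src e)) (p
    e))
  /\ (forall e, e \in T -> ta e = 1).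

(* The vertex groups are generated by the [a v], and the edge group of e is
   generated by c with source [a (src e) ^ p e] and target [a (tgt e) ^ q e]. *)
Definition gbs_presentation : Prop :=
  [/\ spanning_tree T, is_pi1 T iv st,
      (forall v (x : vgrp v), exists i, iv x = zexp (a v) i) /\
      (forall e i, exists c, iv (src_mor e c) = zexp (a (src e)) (p e * i)%R),
      forall e, p e != 0%R /\ q e != 0%R
    & [/\ gbs_relations a st,
      forall H : set G, is_subgroup H -> (forall v, H (a v)) ->
        (forall e, H (st e)) -> forall g, H g
    & forall (K : groupType) al ta, @gbs_relations K al ta -> exists Phi : G ->
      K,
        [/\ morph Phi, forall v, Phi (a v) = al v
          & forall e, Phi (st e) = ta e]]].

End GBS.

Lemma infinite_cyclicP (G : groupType) : infinite_cyclic G ->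
  exists (a : G) (log : G -> Zgroup),
    [/\ morph log, forall x, x = zexp a (log x) & forall i, log (zexp a i) = i].
Proof.
move=> [f [g fK gK]]; have fM := multiplicative_morph f.
have fE i : f i = zexp (f (1%R : int)) i.
  by rewrite -(morph_zexp _ _ fM) zexp_Zgroup mulr1.
exists (f (1%R : int)), g; split.
- by move=> x y; apply: (can_inj fK); rewrite fM !gK.
- by move=> x; rewrite -fE gK.
- by move=> i; rewrite -fE fK.
Qed.

Lemma is_GBS_presentation (G : groupType) : is_GBS G ->
  exists A T iv st a p q, @gbs_presentation A T G iv st a p q.
Proof.
move=> [A [T [treeT vcyc ecyc /is_pi1_isog[iv [st piG]]]]].
have [b bP] := all_sig (fun v => cid (infinite_cyclicP (vcyc v))).
have [vlog vlogP] := all_sig (fun v => cid (bP v)).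
have [c cP] := all_sig (fun e => cid (infinite_cyclicP (ecyc e))).
have [elog elogP] := all_sig (fun e => cid (cP e)).
pose p e : int := vlog _ (src_mor e (c e)).
pose q e : int := vlog _ (tgt_mor e (c e)).
have [[ivM st_rel st1] gen univ] := piG.
have src_c e : src_mor e (c e) = zexp (b (src e)) (p e).
  by have [_ E _] := vlogP (src e); exact: E.
have tgt_c e : tgt_mor e (c e) = zexp (b (tgt e)) (q e).
  by have [_ E _] := vlogP (tgt e); exact: E.
have c_neq1 e : c e <> 1.
  have [_ _ E] := elogP e => c1; have := E 1%R.
  by rewrite /= c1; have := E 0%R; rewrite /= => ->.
exists A, T, iv, st, (fun v => iv v (b v)), p, q; split=> //.
- split=> [v x|e i].
    by exists (vlog v x); have [_ E _] := vlogP v; rewrite {1}(E x) morph_zexp.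
  exists (zexp (c e) i).
  by rewrite (morph_zexp _ _ (@multiplicative_morph _ _ _)) src_c -zexpM
    (morph_zexp _ _ (ivM _)).
- move=> e; split; apply/eqP => e0; apply: (c_neq1 e).
    by apply: (@src_mor_inj A e);
      rewrite src_c e0 (morph1 (@multiplicative_morph _ _ (src_mor e))).
  by apply: (@tgt_mor_inj A e);
    rewrite tgt_c e0 (morph1 (@multiplicative_morph _ _ (tgt_mor e))).
split.
- split=> // e; have := st_rel e (c e).
  by rewrite src_c tgt_c !(morph_zexp _ _ (ivM _)).
- move=> H HH Ha Hst; apply: gen => // v x.
  by have [_ E _] := vlogP v; rewrite (E x) morph_zexp //; exact: zexp_in.
move=> K al ta [ta_rel ta1].
have [|Phi [PhiM Phi_iv Phi_st]] := univ K (fun v x =>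
  zexp (al v) (vlog v x)) ta.
  split=> // [v x y|e d]; first by have [-> _ _] := vlogP v; exact: zexpD.
  have [_ E _] := elogP e;
    rewrite (E d) !(morph_zexp _ _ (@multiplicative_morph _ _ _)).
  rewrite src_c tgt_c -!zexpM; have [_ _ ->] := vlogP (src e).
  by have [_ _ ->] := vlogP (tgt e); rewrite !zexpM -zexp_conj ta_rel.
exists Phi; split=> // v; rewrite Phi_iv.
by have [_ _ /(_ 1%R) /= ->] := vlogP v.
Qed.

(** * Recognition of the elementary groups *)

Lemma isog_of_bij (K G : groupType) (f : K -> G) :
  morph f -> injective f -> (forall g, exists x, f x = g) -> isog G K.
Proof.
move=> fM f_inj /choice[h hK].
have hM : morph h by move=> x y; apply: f_inj; rewrite fM !hK.
have [F FE] := morph_bundle hM; exists F; rewrite FE.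
by exists f => x; [rewrite hK|apply: f_inj; rewrite hK].
Qed.

(** The sign e is (-1)^j. *)
Lemma zexp_conj_inv (G : groupType) (b t : G) : t * b * t^-1 = b^-1 ->
  forall j, exists e, forall i,
    zexp t j * zexp b i = zexp b (e * i)%R * zexp t j.
Proof.
move=> tb; have tbi i : t * zexp b i = zexp b (- i)%R * t.
  have := zexp_conj b t i; rewrite tb -{1}[b]zexp1 -zexpN -zexpM mulN1r => ->.
  by rewrite mulgVK.
have tVbi i : t^-1 * zexp b i = zexp b (- i)%R * t^-1.
  by apply: (mulgI t); rewrite mulVKg mulgA tbi opprK mulgK.
elim/int_rect => [|n [e IH]|n [e IH]].
- by exists 1%R => i; rewrite mul1r mul1g mulg1.
- have -> : Posz n.+1 = (Posz n + 1)%R by lia.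
  by exists (- e)%R => i; rewrite zexpS -!mulgA tbi mulgA IH mulrN mulNr mulgA.
- have -> : (- Posz n.+1 = - Posz n - 1)%R by lia.
  by exists (- e)%R => i; rewrite zexpP -!mulgA tVbi mulgA IH mulrN mulNr mulgA.
Qed.

Lemma zexp_prod_subgroup (G : groupType) (b t : G) :
  (forall j, exists e, forall i,
    zexp t j * zexp b i = zexp b (e * i)%R * zexp t j) ->
  is_subgroup [set g | exists i j, g = zexp b i * zexp t j].
Proof.
move=> comm; split; first by exists 0%R, 0%R; rewrite mulg1.
  move=> _ _ [i [j ->]] [i' [j' ->]]; have [e E] := comm j.
  exists (i + e * i')%R, (j + j')%R.
  by rewrite !zexpD -!mulgA; congr (_ * _); rewrite !mulgA E.
move=> _ [i [j ->]]; have [e E] := comm (- j)%R.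
by exists (e * - i)%R, (- j)%R; rewrite -E !zexpN invgM.
Qed.

(** The relation puts every element of the presented group in the form b^i t^j, so uniqueness of
    this form in G gives injectivity of the map to G, and its existence gives surjectivity. *)
Lemma klein_bottle_recognition (G : groupType) (b t : G) :
  t * b * t^-1 = b^-1 -> (forall g, exists i j, g = zexp b i * zexp t j) ->
  (forall i j, zexp b i * zexp t j = 1 -> i = 0%R /\ j = 0%R) ->
  isog G klein_bottle_group.
Proof.
move=> tb norm free.
have [|Phi [PhiM Phi_l]] := @presented_universal _
  (fun u v : seq (bool * bool) =>
    u = [:: (false, false); (true, false); (false, true)] /\
    v = [:: (true, true)]) G (fun x => if x then b else t).
  by move=> _ _ [-> ->]; rewrite /word_value /= !mulg1 mulgA.
set B : klein_bottle_group := letter _ true.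
set S : klein_bottle_group := letter _ false.
have SB : S * B * S^-1 = B^-1.
  rewrite /S /B -!word_letterV /letter -(word_cat _ [:: _] [:: _]) -word_cat.
  exact: word_rel.
have PhiBS i j : Phi (zexp B i * zexp S j) = zexp b i * zexp t j.
  have [PhiB PhiS] : Phi B = b /\ Phi S = t by split;
    [exact: (Phi_l true)|exact: (Phi_l false)].
  by rewrite PhiM !(morph_zexp _ _ PhiM) PhiB PhiS.
have klein_norm x : exists i j, x = zexp B i * zexp S j.
  apply: (letter_generates (H := [set x | exists i j,
    x = zexp B i * zexp S j])).
    exact: zexp_prod_subgroup (zexp_conj_inv SB).
  by move=> [] /=; [exists 1%R, 0%R; rewrite mulg1|exists 0%R, 1%R;
    rewrite mul1g].
apply: (isog_of_bij PhiM).
  apply: (morph_inj PhiM) => x; have [i [j ->]] := klein_norm x.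
  by rewrite PhiBS => /free[-> ->]; rewrite mulg1.
by move=> g; have [i [j ->]] := norm g; exists (zexp B i * zexp S j).
Qed.

Lemma Z2_recognition (G : groupType) (b t : G) :
  commute b t -> (forall g, exists i j, g = zexp b i * zexp t j) ->
  (forall i j, zexp b i * zexp t j = 1 -> i = 0%R /\ j = 0%R) ->
  isog G (Zgroup * Zgroup)%type.
Proof.
move=> bt norm free.
pose f (x : (Zgroup * Zgroup)%type) := zexp b x.1 * zexp t x.2.
have fM : morph f.
  move=> [i j] [i' j']; rewrite /f /= !zexpD -!mulgA; congr (_ * _).
  rewrite !mulgA; congr (_ * _); apply: commute_zexp2; exact: commute_sym.
apply: (isog_of_bij fM); last by move=> g; have [i [j ->]] := norm g;
  exists (i, j).
by apply: (morph_inj fM) => -[i j] /free[/= -> ->].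
Qed.

Lemma mul_sq_commute (G : groupType) (x c : G) :
  commute x c -> x * c * (x * c) = x * x * (c * c).
Proof. by move=> xc; have := expgMn 2 xc; rewrite !expg2. Qed.

(** From the presentation of the Klein bottle group by x^2 = y^2, with x = b t and y = t, to the one
    by conjugation. *)
Lemma square_eq_klein (G : groupType) (b t : G) :
  b * t * (b * t) = t * t -> t * b * t^-1 = b^-1.
Proof.
move=> bt; apply: (mulgI b); rewrite mulgV; apply: (mulIg t).
by rewrite mul1g !mulgA mulgVK; apply: (mulIg t); rewrite -bt !mulgA.
Qed.

Lemma rat_exprz_eq1 (x : rat) (i : int) :
  i != 0%R -> (x ^ i = 1)%R -> x = 1%R \/ x = (-1)%R.
Proof.
move=> i0 xi; have [n n_gt0 xn] : exists2 n, (0 < n)%N & (x ^+ n = 1)%R.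
  case: i i0 xi => n i0 xi; first by exists n => //; lia.
  exists n.+1 => //; apply: invr_inj; rewrite invr1 -[RHS]xi.
  by rewrite NegzE -exprnN.
have : (`|x| ^+ n = 1)%R by rewrite -normrX xn normr1.
move/eqP; rewrite pexpr_eq1 // => /eqP x1.
case: (lerP 0%R x) => x_sgn; [left|right]; first by rewrite -x1 ger0_norm.
by rewrite -x1 ltr0_norm // opprK.
Qed.

(** * The affine action of a GBS group *)

Section Structure.
Variables (A : graph_of_groups) (T : {set edge A}) (G : groupType).
Variables (iv : forall v : vertex A, vgrp v -> G) (st : edge A -> G).
Variables (a : vertex A -> G) (p q : edge A -> int).
Hypothesis gbsG : gbs_presentation T iv st a p q.

(* The linear part of this action is the modular homomorphism. *)
Lemma gbs_affine_action : exists (n : vertex A -> int) (rho : G -> aff),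
  [/\ morph rho, forall v, n v != 0%R,
      forall v, scale (rho (a v)) = 1%R /\ shift (rho (a v)) = (n v)%:~R%R
    & forall e, shift (rho (st e)) = 0%R].
Proof.
have [treeT piG _ pq0 [rel gen univ]] := gbsG.
have pq e : ((p e)%:~R / (q e)%:~R != 0 :> rat)%R.
  by have [p0 q0] := pq0 e; rewrite mulf_neq0 ?invr_eq0 ?intr_eq0.
(* Letters of T can act trivially only if p n(src) = q n(tgt) on T. A potential of p / q along T
   solves this with n v proportional to the inverse of [scale (b v)]; only the linear parts of [b]
   matter. *)
have [b bE] := spanning_tree_gauge treeT (fun e => mkaff (pq e) 0%R).
(* [D] clears the denominators. Integral lengths make the group of translations discrete in
   [translation_generator]. *)
pose D : int := (\prod_v denq (scale (b v))^-1)%R.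
have D0 : D != 0%R by apply/prodf_neq0 => v _; exact: denq_neq0.
have /choice[n nP] : forall v, exists m : int,
  (m%:~R = D%:~R / scale (b v) :> rat)%R.
  move=> v; exists ((\prod_(w | w != v) denq (scale (b w))^-1) *
                    numq (scale (b v))^-1)%R.
  rewrite /D [in RHS](bigD1 v) //= !rmorphM /= numqE; ring.
have n0 v : n v != 0%R.
  rewrite -(intr_eq0 rat) nP mulf_neq0 ?intr_eq0 // invr_eq0.
  exact: scale_neq0.
(* The ratio by which [st e] must act: it carries the translation by q n(tgt) to the translation by
   p n(src). *)
have lam0 e : ((p e)%:~R * (n (src e))%:~R / ((q e)%:~R * (n (tgt e))%:~R) != 0
  :> rat)%R.
  have [p0 q0] := pq0 e.
  by rewrite !mulf_neq0 ?invr_eq0 ?mulf_neq0 ?intr_eq0.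
pose al v := mkaff (oner_neq0 rat) (n v)%:~R%R.
pose ta e := mkaff (lam0 e) 0%R.
have [|rho [rhoM rho_a rho_st]] := univ aff al ta.
  split=> e => [|eT].
    have [p0 q0] := pq0 e; have sc i v : scale (zexp (al v) i) = 1%R.
      by rewrite scale_zexp /scale /= exp1rz.
    rewrite mul_shift //; apply: aff_ext; first by rewrite sc.
    rewrite !shift_zexp // /shift /scale /=.
    by field; rewrite !intr_eq0 q0 n0.
  apply: aff_ext => //; rewrite /scale /=.
  have [p0 q0] := pq0 e.
  have E : ((p e)%:~R / (q e)%:~R = scale (b (src e)) / scale (b (tgt e)) :>
    rat)%R.
    have := congr1 scale (bE e eT); rewrite scaleM scaleV; exact.
  have b0 v := scale_neq0 (b v).
  have {}E : ((p e)%:~R * scale (b (tgt e)) = (q e)%:~R * scale (b (src e)) :>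
    rat)%R.
    have qr : ((q e)%:~R != 0 :> rat)%R by rewrite intr_eq0.
    by move/eqP: E; rewrite eqr_div // => /eqP ->; rewrite mulrC.
  rewrite !nP; have D0' : (D%:~R != 0 :> rat)%R by rewrite intr_eq0.
  have qr : ((q e)%:~R != 0 :> rat)%R by rewrite intr_eq0.
  rewrite -[RHS](mulfV (mulf_neq0 qr (mulf_neq0 D0' (invr_neq0 (b0 (tgt e)))))).
  congr (_ / _)%R; rewrite mulrCA [RHS]mulrCA; congr (_ * _)%R.
  apply: (mulIf (b0 (src e))); rewrite mulfVK //.
  apply: (mulIf (b0 (tgt e))); rewrite E.
  by field; rewrite b0.
exists n, rho; split=> // [v|e]; first by rewrite rho_a.
by rewrite rho_st.
Qed.

Lemma gbs_generators_induction (H : set G) : is_subgroup H -> (forall v,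
  H (a v)) ->
  (forall e, H (st e)) -> forall g, H g.
Proof. by have [_ _ _ _ [_ gen _]] := gbsG; exact: gen. Qed.

Variables (n : vertex A -> int) (rho : G -> aff).
Hypotheses (rhoM : morph rho) (n0 : forall v, n v != 0%R)
  (rho_a : forall v, scale (rho (a v)) = 1%R /\ shift (rho (a v)) = (n v)%:~R%R)
  (rho_st : forall e, shift (rho (st e)) = 0%R).

Lemma rho_av v i : scale (rho (zexp (a v) i)) = 1%R /\
  shift (rho (zexp (a v) i)) = (i%:~R * (n v)%:~R)%R.
Proof.
have [sc sh] := rho_a v; rewrite !(morph_zexp _ _ rhoM) scale_zexp sc exp1rz.
by rewrite shift_zexp // sh.
Qed.

Lemma rho_hereditarily_free (H : set G) :
  (forall h, H h -> scale (rho h) = 1%R -> shift (rho h) = 0%R) ->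
  hereditarily_free H.
Proof.
move=> H_good; have [treeT piG [ivE _] _ _] := gbsG.
apply: (pi1_hereditarily_free treeT piG) => v x g.
have [i ->] := ivE v x; have [sc sh] := rho_av v i.
have eq_rho : rho (g^-1 * zexp (a v) i * g)
              = rho g^-1 * rho (zexp (a v) i) * (rho g^-1)^-1.
  by rewrite !rhoM (morphV rhoM g) invgK.
move=> /H_good; rewrite eq_rho mul_shift // => /(_ erefl) /eqP.
rewrite [shift _]/(_ * _)%R sh !mulf_eq0 !intr_eq0 (negbTE (scale_neq0 _)).
by rewrite (negbTE (n0 v)) orbF /= => /eqP ->.
Qed.

(** A translation of finite order is trivial, so the cyclic group generated by x contains no element
    acting as a non-trivial translation and is free. *)
Lemma gbs_torsion_free (x : G) m : (0 < m)%N -> x ^+ m = 1 -> x = 1.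
Proof.
move=> m_gt0 xm.
apply: (free_torsion (generated_subgroup [set x]) _ _ m_gt0 xm).
  apply: rho_hereditarily_free => _ /generated1_zexp[i ->] sc.
  have : rho (zexp (zexp x i) (Posz m)) = 1.
    by rewrite -zexpM mulrC zexpM /= xm zexp1g (morph1 rhoM).
  rewrite morph_zexp // => /(congr1 shift); rewrite shift_zexp // shift1.
  by move=> /eqP; rewrite mulf_eq0 intr_eq0 => /orP[|/eqP //]; lia.
exact: sub_generated.
Qed.

Lemma gbs_torsion_free_zexp (x : G) i : i != 0%R -> zexp x i = 1 -> x = 1.
Proof.
move=> i0 xi; apply: (@gbs_torsion_free _ `|i|%N); first by lia.
case: i i0 xi => m i0 // xi.
by apply: invg_inj; rewrite [LHS]xi invg1.
Qed.

(** * The case of a non-trivial linear part *)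

Section NontrivialModulus.
Variables (z s : G).
Hypotheses (z_central : center G z) (z_neq1 : z <> 1)
  (s_scale : scale (rho s) <> 1%R) (v0 : vertex A).

(** Commuting with the translation of a vertex generator forces linear part 1; commuting with s,
    whose linear part is not 1, then forces shift 0. *)
Lemma rho_center : rho z = 1.
Proof.
have zx x : rho z * rho x = rho x * rho z by rewrite -!rhoM z_central.
have [sc sh] := rho_a v0.
have sz : scale (rho z) = 1%R.
  have := congr1 shift (zx (a v0));
    rewrite !shiftM sc sh mul1r addrC => /addIr E.
  have n_neq0 : ((n v0)%:~R != 0 :> rat)%R by rewrite intr_eq0.
  by apply: (mulIf n_neq0); rewrite mul1r.
apply: aff_ext => //; have := congr1 shift (zx s); rewrite !shiftM sz mul1r.
rewrite addrC => /addrI E; apply/eqP.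
have : ((1 - scale (rho s)) * shift (rho z) == 0)%R.
  by rewrite mulrBl mul1r -E subrr.
by rewrite mulf_eq0 subr_eq0 => /orP[/eqP/esym/s_scale|].
Qed.

Lemma modulus_sign : scale (rho s) = (-1)%R.
Proof.
have zs : commute s z by rewrite /commute z_central.
set M := generated [set s; z];
  have MM : is_subgroup M by exact: generated_subgroup.
apply: contrapT => s_neqN1.
have scale_s i : scale (rho (zexp s i)) = 1%R -> i = 0%R.
  rewrite morph_zexp // scale_zexp => si; apply/eqP; apply: contraPT si => i0.
  by move=> /(rat_exprz_eq1 i0)[].
have MF : hereditarily_free M.
  apply: rho_hereditarily_free => _ /(generated2_zexp zs)[i [j ->]].
  rewrite rhoM (morph_zexp _ j rhoM) rho_center zexp1g mulg1 => /scale_s ->.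
  by rewrite (morph1 rhoM).
have [Ms Mz] : M s /\ M z by split; apply: sub_generated; [left|right].
(* The contradiction: z = w^j acts trivially with j nonzero, so w has linear part 1 or -1, and so
   does its power s. *)
have [w [_ [i si] [j zj]]] := free_commute MM MF Ms Mz zs.
have j0 : j != 0%R by apply/eqP => j0; apply: z_neq1; rewrite zj j0.
have := rho_center; rewrite zj morph_zexp // => /(congr1 scale).
rewrite scale_zexp => /(rat_exprz_eq1 j0) w_pm1.
have sq : (scale (rho s) ^ (2 : int) = 1)%R.
  rewrite si morph_zexp // scale_zexp exprz_exp mulrC -exprz_exp.
  by case: w_pm1 => ->; rewrite ?sqrrN ?expr1n exp1rz.
by have [|/s_neqN1] := rat_exprz_eq1 (isT : (2 : int) != 0%R) sq.
Qed.

End NontrivialModulus.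

Lemma rho_shift_integral :
  (forall g, scale (rho g) = 1%R \/ scale (rho g) = (-1)%R) ->
  forall g, exists i : int, shift (rho g) = i%:~R%R.
Proof.
move=> sc; apply: (gbs_generators_induction
    (H := [set g | exists i : int, shift (rho g) = i%:~R%R])).
- split.
  + by exists 0%R; rewrite (morph1 rhoM).
  + move=> x y [i xi] [j yj]; rewrite /= rhoM shiftM xi yj.
    case: (sc x) => ->; first by exists (i + j)%R; rewrite mul1r intrD.
    by exists (i - j)%R; rewrite mulN1r intrB.
  + move=> x [i xi]; rewrite /= (morphV rhoM) shiftV xi.
    case: (sc x) => ->; first by exists (- i)%R; rewrite invr1 mulN1r intrN.
    by exists i; rewrite invrN1 opprK mul1r.
- by move=> v /=; exists (n v); have [] := rho_a v.
- by move=> e /=; exists 0%R; rewrite rho_st.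
Qed.

(** By integrality the shifts of translations form a subgroup of the integers, and it is nonzero
    because it contains [n v0]. *)
Lemma translation_generator (v0 : vertex A) :
  (forall g, scale (rho g) = 1%R \/ scale (rho g) = (-1)%R) ->
  exists (d : int) (t : G), [/\ d != 0%R, scale (rho t) = 1%R,
    shift (rho t) = d%:~R%R
    & forall g, scale (rho g) = 1%R -> exists i : int,
        shift (rho g) = (i%:~R * d%:~R)%R].
Proof.
move=> sc; pose D : set Zgroup :=
  [set i : int | exists g, scale (rho g) = 1%R /\ shift (rho g) = i%:~R%R].
have DD : is_subgroup D.
  split.
  - by exists 1; rewrite (morph1 rhoM).
  - move=> i j [x [x1 xi]] [y [y1 yj]]; exists (x * y).
    by rewrite rhoM scaleM shiftM x1 y1 xi yj !mul1r intrD.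
  - move=> i [x [x1 xi]]; exists x^-1.
    by rewrite (morphV rhoM) scaleV shiftV x1 xi invr1 mulN1r intrN.
have [d DE] := Zgroup_subgroup DD.
have Dn : D (n v0) by exists (a v0); exact: rho_a.
have [t [t1 td]] : D (Posz d) by rewrite DE /=.
exists (Posz d), t; split=> //.
  apply/eqP => d0; move: Dn; rewrite DE /= d0 dvd0z; exact/negP/n0.
move=> g g1; have [i gi] := rho_shift_integral sc g.
have : D i by exists g.
by rewrite DE => /dvdzP[j ij]; exists j; rewrite gi ij intrM.
Qed.

Section KleinBottle.
Variables (z s : G) (v0 : vertex A).
Hypotheses (z_central : center G z) (z_neq1 : z <> 1)
  (s_scale : scale (rho s) = (-1)%R)
  (scale_pm1 : forall g, scale (rho g) = 1%R \/ scale (rho g) = (-1)%R).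

(** The kernel of the action is free and contains z, hence is cyclic, and its generator w is
    central: conjugation sends w to w^e and fixes z = w^m. An element of linear part -1 squares to
    an odd power of w, as an even power would yield an involution in the torsion-free G. Multiplying
    s and t0 t by powers of w gives t and b t with the same square w. *)
Lemma gbs_klein_bottle : isog G klein_bottle_group.
Proof.
have s1 : scale (rho s) <> 1%R by rewrite s_scale.
pose N := [set g | rho g = 1];
  have NN : is_subgroup N := morph_kernel_subgroup rhoM.
have Nz : N z by exact: rho_center z_central s1 v0.
have NF : hereditarily_free N.
  by apply: rho_hereditarily_free => h -> _; rewrite shift1.
have [|w Nw w_gen] := free_center NN NF Nz z_neq1.
  by move=> x _; exact: z_central.
have [m zm] := w_gen z Nz.
have m0 : m != 0%R by apply/eqP => m0; apply: z_neq1; rewrite zm m0.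
have w_neq1 : w <> 1 by move=> w1; apply: z_neq1; rewrite zm w1 zexp1g.
have w_inj i : zexp w i = 1 -> i = 0%R.
  move=> wi; apply/eqP; apply: contrapT => /negP i0.
  exact: w_neq1 (gbs_torsion_free_zexp i0 wi).
have w_central g : commute g w.
  have [e we] : exists e, g * w * g^-1 = zexp w e.
    apply: w_gen; rewrite /N /= !rhoM (morphV rhoM) [rho w]Nw mulg1.
    exact: mulgV.
  have : zexp w ((e - 1) * m)%R = 1.
    rewrite mulrBl mul1r zexpD zexpN zexpM -we zexp_conj -zm.
    by rewrite -(z_central g) mulgK mulgV.
  move=> /w_inj/eqP; rewrite mulf_eq0 (negbTE m0) orbF subr_eq0 => /eqP e1.
  by move: we; rewrite e1 zexp1 => E; rewrite /commute -{2}E mulgVK.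
have sq g : scale (rho g) = (-1)%R -> exists l, g * g = zexp w (l + l + 1)%R.
  move=> g1; have Ngg : N (g * g).
    by apply: aff_ext; rewrite rhoM ?scaleM ?shiftM g1 ?mulN1r ?opprK ?subrr.
  have [i ggi] := w_gen _ Ngg.
  have [l [il|il]] : exists l : int, i = (l + l)%R \/ i = (l + l + 1)%R.
    by exists (i %/ 2)%Z; have := divz_eq i 2;
      have := modz_ge0 i (isT : 2%Z != 0%R);
      have := ltz_pmod i (isT : (0 < 2 :> int)%R); lia.
    have g_wl : commute g (zexp w (- l)%R) by exact: commute_zexp.
    have : (g * zexp w (- l)%R) ^+ 2 = 1.
      rewrite expg2 mul_sq_commute // ggi -!zexpD il.
      by rewrite (_ : (l + l + (- l - l))%R = 0%R) //; lia.
    move/(gbs_torsion_free (isT : (0 < 2)%N)) => /(congr1 (scale \o rho)) /=.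
    rewrite rhoM scaleM (morph1 rhoM) g1 morph_zexp // [rho w]Nw zexp1g scale1.
    by [].
  by exists l; rewrite ggi il.
have [d [t0 [d0 t0_scale t0_shift t0_gen]]] :=
  translation_generator v0 scale_pm1.
have [l ssl] := sq s s_scale.
pose t := s * zexp w (- l)%R.
have t_scale : scale (rho t) = (-1)%R.
  by rewrite /t rhoM scaleM morph_zexp // [rho w]Nw zexp1g scale1 mulr1.
have tt : t * t = w.
  have s_wl : commute s (zexp w (- l)%R) by exact: commute_zexp.
  rewrite /t mul_sq_commute // ssl -!zexpD.
  by rewrite (_ : (l + l + 1 + (- l - l))%R = 1%R) //; lia.
have [|k t0tk] := sq (t0 * t).
  by rewrite rhoM scaleM t0_scale t_scale mul1r.
pose b := t0 * zexp w (- k)%R.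
have btbt : b * t * (b * t) = t * t.
  have bt : b * t = t0 * t * zexp w (- k)%R.
    have t_wk : commute t (zexp w (- k)%R) by exact: commute_zexp.
    by rewrite /b -(mulgA t0 _ t) -(mulgA t0 t) t_wk.
  have c_wk : commute (t0 * t) (zexp w (- k)%R) by exact: commute_zexp.
  rewrite tt bt mul_sq_commute // t0tk -!zexpD.
  by rewrite (_ : (k + k + 1 + (- k - k))%R = 1%R) //; lia.
have tb : t * b * t^-1 = b^-1 by exact: square_eq_klein.
have b_shift i : scale (rho (zexp b i)) = 1%R /\
    shift (rho (zexp b i)) = (i%:~R * d%:~R)%R.
  have rb : rho b = rho t0.
    by rewrite /b rhoM (morph_zexp _ _ rhoM) [rho w]Nw zexp1g mulg1.
  by rewrite !(morph_zexp _ _ rhoM) rb scale_zexp shift_zexp //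
    t0_scale exp1rz t0_shift.
have t_even i : zexp t (i + i)%R = zexp w i.
  by rewrite zexpD -zexpMn ?tt //; exact: commute_refl.
have tr g : scale (rho g) = 1%R -> exists i j, g = zexp b i * zexp t j.
  move=> g1; have [i gi] := t0_gen g g1; have [bi1 bi] := b_shift i.
  have [j gj] : exists j, (zexp b i)^-1 * g = zexp w j.
    apply: w_gen; apply: aff_ext; rewrite rhoM (morphV rhoM) ?scaleM ?shiftM.
      by rewrite scaleV bi1 g1 invr1 mulr1.
    by rewrite scaleV shiftV bi1 bi gi invr1 mul1r mulN1r addrC subrr.
  by exists i, (j + j)%R; rewrite t_even -gj mulVKg.
apply: (klein_bottle_recognition tb).
  move=> g; have [/tr //|g1] := scale_pm1 g.
  have [|i [j gt]] := tr (g * t^-1).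
    by rewrite rhoM (morphV rhoM) scaleM scaleV g1 t_scale invrN1 mulrNN mulr1.
  by exists i, (j + 1)%R; rewrite zexpS mulgA -gt mulgVK.
(* The linear part determines the parity of j, the shift then gives i = 0, and what remains is a
   power of w. *)
move=> i j bt1; have [bi1 bi] := b_shift i.
have [l' [jl|jl]] : exists l : int, j = (l + l)%R \/ j = (l + l + 1)%R.
  by exists (j %/ 2)%Z; have := divz_eq j 2;
    have := modz_ge0 j (isT : 2%Z != 0%R);
    have := ltz_pmod j (isT : (0 < 2 :> int)%R); lia.
  move: bt1; rewrite jl t_even => bw1.
  have i0 : i = 0%R.
    have := congr1 (shift \o rho) bw1; rewrite /= rhoM (morph_zexp _ l' rhoM).
    rewrite [rho w]Nw zexp1g mulg1 bi (morph1 rhoM) shift1 => /eqP.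
    by rewrite mulf_eq0 !intr_eq0 (negbTE d0) orbF => /eqP.
  by move: bw1; rewrite i0 mul1g => /w_inj ->.
have := congr1 (scale \o rho) bt1; rewrite /= rhoM scaleM bi1 jl zexpS t_even.
by rewrite rhoM (morph_zexp _ l' rhoM) [rho w]Nw zexp1g mul1g t_scale (morph1
  rhoM).
Qed.

End KleinBottle.

(** * The case of translations: height and center *)

Section TrivialModulus.
Hypothesis scale1 : forall g, scale (rho g) = 1%R.
Variable v0 : vertex A.

(** The height is the shift divided by the generator d of the group of shifts. *)
Lemma gbs_height : exists (theta : G -> Zgroup) (t : G),
  [/\ morph theta, theta t = (1%R : int),
      forall v, theta (a v) <> 1 & forall e, theta (st e) = 1].
Proof.
have [|d [t [d0 t1 td gen]]] := translation_generator v0; first by left.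
have dQ : (d%:~R != 0 :> rat)%R by rewrite intr_eq0.
have /choice[th thP] := fun g => gen g (scale1 g).
have thE g i : shift (rho g) = (i%:~R * d%:~R)%R -> th g = i.
  by rewrite thP => /(mulIf dQ)/eqP; rewrite eqr_int => /eqP.
have th1 g : th g = 0%R <-> rho g = 1.
  split=> [g0|g1]; first by apply: aff_ext => //; rewrite thP g0 mul0r.
  by apply: thE; rewrite g1 mul0r.
exists th, t; split=> //.
- by move=> x y; apply: thE; rewrite rhoM shiftM scale1 mul1r !thP intrD mulrDl.
- by apply: thE; rewrite mul1r.
- move=> v /th1 a1; have [_] := rho_a v; rewrite a1 shift1 => /eqP.
  by rewrite eq_sym intr_eq0 (negbTE (n0 v)).
- by move=> e; apply/th1/aff_ext => //; rewrite rho_st.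
Qed.

Variables (theta : G -> Zgroup) (t : G).
Hypotheses (thetaM : morph theta) (theta_t : theta t = (1%R : int))
  (theta_a : forall v, theta (a v) <> 1) (theta_st : forall e,
    theta (st e) = 1).

Lemma height_zexp g i : theta (zexp g i) = (i * theta g)%R.
Proof. by rewrite (morph_zexp _ _ thetaM) zexp_Zgroup. Qed.

(* The graph of the height kernel is finite: the edges above e are classified
   by heights modulo that of the generator of the edge group. *)
Lemma height_finite_rank : exists r,
  subgroup_isog (free_group r) [set g | theta g = 1].
Proof.
set N := [set g | theta g = 1];
  have NN : is_subgroup N := morph_kernel_subgroup thetaM.
have [treeT piG [ivE edgeE] pq0 _] := gbsG.
have [|par [y [_ par_in _ _ free_y]]] := pi1_subgroup_free v0 treeT piG NN.
  move=> v x g; have [i ->] := ivE v x; rewrite /N /= !thetaM (morphV thetaM g).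
  rewrite height_zexp => E; have : (i * theta (a v) = 0 :> int)%R.
    by move: E; rewrite -[RHS]/(0%R : int) -[_ * theta g]/(_ + _)%R
      -[_ * _]/(_ + _)%R -[X in (X + _ + _)%R]/(- _)%R addrAC addNr add0r.
  move=> /eqP; rewrite mulf_eq0 => /orP[/eqP ->//|/eqP a0].
  by case: (@theta_a v).
pose m e : int := (p e * theta (a (src e)))%R.
have m0 e : m e != 0%R.
  by rewrite mulf_neq0 //; [case: (pq0 e)|apply/eqP; exact: theta_a].
pose M := \max_e `|m e|%N.
have finE : finite_set (qedge iv N).
  pose f (x : edge A * G) := (x.1, `|(theta x.2 %% m x.1)%Z|%N).
  have f_inj : {in qedge iv N &, injective f}.
    move=> [e x] [e' x']; rewrite !inE /qedge /f /= => ex ex' [ee'].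
    subst e' => /(congr1 Posz); rewrite !gez0_abs ?modz_ge0 ?m0 // => xx'.
    congr (_, _); rewrite -ex -ex'.
    have [i thi] : exists i : int, (theta x' = theta x + m e * i :> int)%R.
      exists ((theta x' %/ m e)%Z - (theta x %/ m e)%Z)%R.
      by rewrite {1}(divz_eq (theta x') (m e)) {1}(divz_eq (theta x) (m e)) xx';
        ring.
    have [c cE] := edgeE e i.
    (* An element of the edge group lifts x to the height of x'; the remaining factor has height
       0. *)
    pose h := (zexp (a (src e)) (p e * i)%R * x)^-1 * x'.
    have Nh : N h.
      rewrite /N /h /= thetaM (morphV thetaM) thetaM height_zexp thi.
      rewrite -[RHS]/(0%R : int) -[LHS]/(_ + _)%R -[X in (X + _)%R]/(- _)%R.
      by rewrite -[X in (- X + _)%R]/(_ + _)%R /m; ring.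
    have -> : x' = zexp (a (src e)) (p e * i)%R * x * h by rewrite /h mulVKg.
    by rewrite (erep_eq piG NN) //; exists c.
  rewrite -(eq_finite_set (inj_card_eq f_inj)).
  apply: (@sub_finite_set _ _ ([set: edge A] `*` `I_M.+1)).
    move=> _ [[e x] _ <-]; split=> //=; rewrite ltnS.
    apply: leq_trans (leq_bigmax e); rewrite -lez_nat gez0_abs ?modz_ge0 ?m0 //.
    exact/ltW/ltz_mod/m0.
  apply: finite_setX; last exact: finite_II.
  exact: finite_finset.
have /finite_setP[r cB] :
    finite_set (qedge iv N `\` [set e | exists u, par u e]).
  by apply: sub_finite_set finE => x [].
by exists r; exact: free_on_isog cB free_y.
Qed.

(** G is an extension of the integers by the cyclic group of w. If w is not 1, conjugation by t is
    an automorphism of an infinite cyclic group, thus the identity or the inversion. *)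
Lemma height_kernel_cyclic w : theta w = 1 ->
  (forall x, theta x = 1 -> exists i, x = zexp w i) ->
  [\/ isog G Zgroup, isog G (Zgroup * Zgroup)%type | isog G klein_bottle_group].
Proof.
move=> w1 w_gen.
have norm g : exists i j, g = zexp w i * zexp t j.
  have [|i gi] := w_gen (g * (zexp t (theta g))^-1).
    rewrite thetaM (morphV thetaM) height_zexp theta_t mulr1; exact: mulgV.
  by exists i, (theta g); rewrite -gi mulgVK.
have t_th i j : theta (zexp w i * zexp t j) = j.
  rewrite thetaM !height_zexp w1 theta_t mulr1 mulr0; exact: mul1g.
have [weq1|w_neq1] := pselect (w = 1).
  constructor 1; apply: (@isog_of_bij Zgroup G (zexp t)).
  - exact: zexp_morph.
  - apply: (morph_inj (@zexp_morph _ t)) => i ti.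
    by have := t_th 0%R i; rewrite mul1g ti (morph1 thetaM).
  - by move=> g; have [i [j ->]] := norm g; exists j; rewrite weq1 zexp1g mul1g.
have w_inj i : zexp w i = 1 -> i = 0%R.
  move=> wi; apply/eqP; apply: contrapT => /negP i0.
  exact: w_neq1 (gbs_torsion_free_zexp i0 wi).
have free i j : zexp w i * zexp t j = 1 -> i = 0%R /\ j = 0%R.
  move=> ij; have j0 : j = 0%R by rewrite -(t_th i j) ij (morph1 thetaM).
  by move: ij; rewrite j0 mulg1 => /w_inj.
have conj_ker g : theta (g * w * g^-1) = 1.
  by rewrite !thetaM (morphV thetaM) w1 mulg1 mulgV.
have [e we] := w_gen _ (conj_ker t); have [e' we'] := w_gen _ (conj_ker t^-1).
have ee' : (e * e' = 1)%R.
  have : zexp w (e * e' - 1)%R = 1.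
    rewrite zexpD zexpN zexpM -we zexp_conj -we' invgK zexp1.
    by rewrite !mulgA mulgV mul1g mulgK mulgV.
  by move=> /w_inj /eqP; rewrite subr_eq0 => /eqP.
have : e = 1%R \/ e = (-1)%R.
  have /eqP := congr1 absz ee'; rewrite abszM muln_eq1 => /andP[/eqP e1 _]; lia.
move=> [e1|eN1]; [constructor 2|constructor 3].
  apply: (Z2_recognition _ norm free).
  by move: we; rewrite e1 zexp1 => E; apply: commute_sym;
    rewrite /commute -{2}E mulgVK.
by apply: (klein_bottle_recognition _ norm free); rewrite we eN1.
Qed.

(** Across an edge of T the stable letter is trivial, and the relation equates nonzero powers of the
    two vertex generators. *)
Lemma commensurable v : exists i j : int,
  [/\ i != 0%R, j != 0%R & zexp (a v0) i = zexp (a v) j].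
Proof.
have [treeT _ _ pq0 [[rel st1] _ _]] := gbsG; have [_ conn _] := treeT.
pose P v := exists i j : int, [/\ i != 0%R,
  j != 0%R & zexp (a v0) i = zexp (a v) j].
suff : P v0 <-> P v by move=> [P0v _]; apply: P0v; exists 1%R, 1%R.
apply: (adjacent_invariant _ (conn v0 v)) => e eT.
have [p0 q0] := pq0 e; have := rel e; rewrite st1 // mul1g invg1 mulg1 => E.
split=> -[i [j [i0 j0 ij]]].
  exists (i * p e)%R, (q e * j)%R; split; try exact: mulf_neq0.
  by rewrite !zexpM ij E -!zexpM mulrC.
exists (i * q e)%R, (p e * j)%R; split; try exact: mulf_neq0.
by rewrite !zexpM ij -E -!zexpM mulrC.
Qed.

(** By commensurability a stable letter conjugates some power of [a v0] to another. Height is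
    invariant under conjugation and nonzero on [a v0], so the two exponents agree. *)
Lemma commensurator g : exists2 m : int, m != 0%R & commute g (zexp (a v0) m).
Proof.
have [_ _ _ pq0 [[rel _] _ _]] := gbsG.
pose S := [set g | exists2 m : int, m != 0%R & commute g (zexp (a v0) m)].
suff : S g by []; apply: gbs_generators_induction.
- split.
  + by exists 1%R => //; apply/commute_sym/commute1.
  + move=> x y [i i0 xi] [j j0 yj]; exists (i * j)%R; first exact: mulf_neq0.
    apply/commute_sym/commuteM; apply/commute_sym.
      by rewrite zexpM; exact: commute_zexp.
    by rewrite mulrC zexpM; exact: commute_zexp.
  + by move=> x [i i0 xi]; exists i => //;
    apply/commute_sym/commuteV/commute_sym.
- move=> v; have [i [j [i0 j0 ij]]] := commensurable v; exists i => //.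
  by rewrite ij; apply: commute_zexp; exact: commute_refl.
- move=> e; have [p0 q0] := pq0 e.
  have [i [j [i0 j0 ij]]] := commensurable (tgt e).
  have [i' [j' [i'0 j'0 ij']]] := commensurable (src e).
  exists (i * (q e * j'))%R; first by rewrite !mulf_neq0.
  have E : st e * zexp (a v0) (i * (q e * j'))%R * (st e)^-1
           = zexp (a v0) (i' * (p e * j))%R.
    have -> : zexp (a v0) (i * (q e * j'))%R = zexp (a (tgt e)) (q e * (j *
      j'))%R.
      by rewrite zexpM ij -zexpM; congr zexp; ring.
    have -> : zexp (a v0) (i' * (p e * j))%R = zexp (a (src e)) (p e * (j *
      j'))%R.
      by rewrite zexpM ij' -zexpM; congr zexp; ring.
    by rewrite !(zexpM _ _ (j * j')%R) -zexp_conj rel.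
  have a0 : (theta (a v0) : int) != 0%R by apply/eqP; exact: theta_a.
  have := congr1 theta E; rewrite !thetaM (morphV thetaM) theta_st invg1.
  rewrite mul1g mulg1 !height_zexp => /(mulIf a0) ii'.
  by rewrite -{}ii' in E; rewrite /commute -{2}E mulgVK.
Qed.

(** The exponents given by [commensurator] are multiplied over the finitely many generators. *)
Lemma central_power : exists2 m : int, m != 0%R & center G (zexp (a v0) m).
Proof.
have /choice[m mP] : forall g, exists m : int,
    m != 0%R /\ commute g (zexp (a v0) m).
  by move=> g; have [m m0 gm] := commensurator g; exists m.
pose M := ((\prod_v m (a v)) * (\prod_e m (st e)))%R.
exists M.
  by apply: mulf_neq0; apply/prodf_neq0 => x _;
    [case: (mP (a x))|case: (mP (st x))].
suff cM x : commute x (zexp (a v0) M) by move=> x; apply: commute_sym.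
apply: (gbs_generators_induction (H := [set x | commute x (zexp (a v0) M)])).
- split=> [|y y' /= yM yM'|y /= yM].
  + exact/commute_sym/commute1.
  + by apply/commute_sym/commuteM; apply/commute_sym.
  + exact/commute_sym/commuteV/commute_sym.
- move=> v /=; rewrite /M (bigD1 v) //= -mulrA zexpM.
  by apply: commute_zexp; case: (mP (a v)).
- move=> e /=; rewrite /M (bigD1 e) //= mulrCA zexpM.
  by apply: commute_zexp; case: (mP (st e)).
Qed.

Lemma vertex_central_power v : exists2 m, (0 < m)%N & center G (a v ^+ m).
Proof.
have [M M0 cM] := central_power; have [i [j [i0 j0 ij]]] := commensurable v.
have c : center G (zexp (a v) (j * M)%R).
  rewrite zexpM -ij -zexpM mulrC zexpM => x; apply: commute_sym.
  by apply: commute_zexp; rewrite /commute -cM.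
exists `|(j * M)%R|%N; first by rewrite absz_gt0 mulf_neq0.
rewrite -[_ ^+ _]/(zexp (a v) (Posz _)).
case: (lerP 0%R (j * M)%R) => jM; first by rewrite gez0_abs.
by rewrite ltz0_abs // zexpN; exact: centerV.
Qed.

End TrivialModulus.
End Structure.

(** * The structure theorem *)

Lemma free_group_cyclic r : (r < 2)%N ->
  exists w : free_group r, forall x, exists i, x = zexp w i.
Proof.
case: r => [|[|//]] _.
  exists 1 => x; exists 0%R; apply: (letter_generates (H := [set 1])) x.
    by split=> // [_ _ -> ->|_ ->] /=; rewrite ?mulg1 ?invg1.
  by case.
exists (letter _ ord0) => x.
apply: (letter_generates (H := [set x | exists i, x = zexp (letter _ ord0) i])).
  split; first by exists 0%R.
    by move=> _ _ [i ->] [j ->]; exists (i + j)%R; rewrite zexpD.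
  by move=> _ [i ->]; exists (- i)%R; rewrite zexpN.
by move=> i; exists 1%R; rewrite zexp1 (ord1 i).
Qed.

(** All that the sequel uses about graphs of groups. The last clause holds since stable letters have
    height 0 and each vertex generator has a central power; it is what identifies kappa. *)
Theorem gbs_structure (G : groupType) :
  is_GBS G -> non_elementary G -> (exists z : G, center G z /\ z <> 1) ->
  exists (theta : G -> Zgroup) (t : G) (r : nat),
  [/\ morph theta, theta t = (1%R : int), (1 < r)%N,
      subgroup_isog (free_group r) [set g | theta g = 1]
    & forall S : set G, is_subgroup S -> (forall g, theta g = 1 -> S g) ->
        (forall a m, (0 < m)%N -> center G (a ^+ m) -> S a) -> forall g, S g].
Proof.
move=> /is_GBS_presentation[A [T [iv [st [a [p [q gbsG]]]]]]] [nZ nZ2 nK] [z [zZ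
  z1]].
have [[/card_gt0P[v0 _] _ _] _ _ _ _] := gbsG.
have [n [rho [rhoM n0 rho_a rho_st]]] := gbs_affine_action gbsG.
have scale1 g : scale (rho g) = 1%R.
  apply: contrapT => g1; apply: nK.
  have pm1 h : scale (rho h) = 1%R \/ scale (rho h) = (-1)%R.
    have [h1|h1] := pselect (scale (rho h) = 1%R); first by left.
    by right; exact: (modulus_sign gbsG rhoM n0 rho_a zZ z1 h1 v0).
  have [//|gN1] := pm1 g.
  exact: (gbs_klein_bottle gbsG rhoM n0 rho_a rho_st v0 zZ z1 gN1 pm1).
have [theta [t [thM tht th_a th_st]]] :=
  gbs_height gbsG rhoM n0 rho_a rho_st scale1 v0.
have [r iso] := height_finite_rank gbsG v0 thM th_a.
exists theta, t, r; split=> //.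
  rewrite ltnNge; apply/negP => r_le1.
  have [w w_gen] := free_group_cyclic r_le1.
  have [f [fM f_inj fN]] := (subgroup_isogP _ _).1 iso.
  have fw : theta (f w) = 1.
    by have : range f (f w) by [exists w]; rewrite fN.
  have [|//|//|//] := height_kernel_cyclic gbsG rhoM n0 rho_a thM tht fw.
  move=> x x1; have [y _ <-] : range f x by rewrite fN.
  by have [i ->] := w_gen y; exists i; rewrite morph_zexp.
move=> S SS SN Scent; apply: (gbs_generators_induction gbsG SS).
  move=> v; have [m m_gt0 cm] :=
    vertex_central_power gbsG v0 thM th_a th_st v.
  exact: Scent m_gt0 cm.
by move=> e; apply: SN.
Qed.

Lemma isog_free_on r (G : groupType) (H : set G) :
  subgroup_isog (free_group r) H -> exists y : 'I_r -> G, free_on H setT y.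
Proof.
move=> /subgroup_isogP[f [fM f_inj <-]]; exists (f \o letter _).
apply: free_on_image => //; split=> // [x _|K g].
  by move=> K KK lK; apply: (letter_generates KK) => i; apply: lK; exists i.
by have [Phi [PhiM Phi_l]] := free_group_universal g; exists Phi; split.
Qed.

(** A non-trivial center would make H cyclic, and two basis elements would commute. *)
Lemma free_centerless r (G : groupType) (H : set G) x :
  is_subgroup H -> subgroup_isog (free_group r) H -> (1 < r)%N -> H x ->
  (forall y, H y -> commute x y) -> x = 1.
Proof.
move=> HH iso r_gt1 Hx x_central; apply: contrapT => x1.
have HF := free_isog_hereditarily_free iso.
have [w Hw w_gen] := free_center HH HF Hx x1 x_central.
have [y free_y] := isog_free_on iso; have [yH _ _] := free_y.
pose i0 : 'I_r := Ordinal (ltnW r_gt1); pose i1 : 'I_r := Ordinal r_gt1.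
have : i0 = i1.
  apply: (free_on_commute free_y) => //.
  have [i ->] := w_gen _ (yH i0 I); have [j ->] := w_gen _ (yH i1 I).
  by apply: commute_zexp2; exact: commute_refl.
by move/(congr1 val).
Qed.

(** * Indices and orders of torsion elements *)

Lemma has_index_height (G : groupType) (h : G -> Zgroup) (t : G) (m : nat) :
  morph h -> h t = (1%R : int) -> (0 < m)%N ->
  is_subgroup [set g | (m %| (h g : int))%Z] /\
  has_index setT [set g | (m %| (h g : int))%Z] m.
Proof.
move=> hM ht m_gt0; have m0 : Posz m != 0%R by lia.
have hD x y : (h (x * y) : int) = (h x + h y)%R by rewrite hM.
have hV x : (h x^-1 : int) = (- h x)%R by rewrite (morphV hM).
have HH : is_subgroup [set g | (m %| (h g : int))%Z].
  split=> [|x y /= mx my|x /= mx]; first by rewrite /= (morph1 hM) dvdz0.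
    by rewrite hD rpredD.
  by rewrite hV rpredN.
split=> //; apply/has_indexP => //.
exists (fun g => `|(h g %% m)%Z|%N); split.
- by move=> x _; rewrite -ltz_nat gez0_abs ?modz_ge0 //; exact: ltz_pmod.
- move=> i i_lt; exists (zexp t i) => //.
  by rewrite (morph_zexp _ _ hM) zexp_Zgroup ht mulr1 modz_small //=; lia.
- move=> x y _ _ /=; rewrite hD hV addrC -eqz_mod_dvd; split=> [E|/eqP -> //].
  have := congr1 Posz E; rewrite !gez0_abs ?modz_ge0 // => E'.
  by rewrite eq_sym; apply/eqP.
Qed.

Lemma has_order_dvd (G : groupType) (x : G) d m :
  has_order x d -> x ^+ m = 1 -> (d %| m)%N.
Proof.
move=> [d_gt0 xd dmin] xm; apply: contraT; rewrite /dvdn -lt0n => r_gt0.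
have xr : x ^+ (m %% d)%N = 1.
  by move: xm; rewrite {1}(divn_eq m d) expgnDr mulnC expgnA xd expg1n mul1g.
by have := dmin _ r_gt0 xr; rewrite leqNgt ltn_mod d_gt0.
Qed.

Lemma has_order_exists (G : groupType) (x : G) m :
  (0 < m)%N -> x ^+ m = 1 -> exists d, has_order x d.
Proof.
move=> m_gt0 xm; have ex : exists d, (0 < d)%N && (x ^+ d == 1).
  by exists m; rewrite m_gt0 xm eqxx.
case: (ex_minnP ex) => d /andP[d_gt0 /eqP xd] dmin; exists d;
  split=> // k k_gt0 xk.
by apply: dmin; rewrite k_gt0 xk eqxx.
Qed.

(* The powers of x act freely on the cosets of the torsion-free H. *)
Lemma order_dvd_index (G : groupType) (H : set G) k (x : G) d :
  is_subgroup H -> (forall y m, H y -> (0 < m)%N -> y ^+ m = 1 -> y = 1) ->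
  has_index setT H k -> has_order x d -> (d %| k)%N.
Proof.
move=> HH H_tf /(has_indexP _ _ HH)[phi [phi_lt phi_surj phi_eq]] xd.
have [d_gt0 xd1 dmin] := xd.
have /choice[r rP] : forall i : 'I_k, exists g, phi g = i.
  by move=> i; have [g _ gi] := phi_surj i (ltn_ord i); exists g.
pose f (i : 'I_k) : 'I_k := Ordinal (phi_lt (x * r i) I).
have phi_mul y g h : phi g = phi h -> phi (y * g) = phi (y * h).
  by move=> /(phi_eq _ _ I I) gh; apply/(phi_eq _ _ I I);
    rewrite invgM -mulgA mulKg.
have iter_f j i : iter j f i = phi (x ^+ j * r i) :> nat.
  elim: j => [|j IH]; first by rewrite mul1g rP.
  by rewrite iterS /= expgS -mulgA; apply: phi_mul; rewrite rP IH.
have f_per i : iter d f i = i.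
  by apply: val_inj => /=; rewrite iter_f xd1 mul1g rP.
have f_free i j : (0 < j < d)%N -> iter j f i <> i.
  move=> /andP[j_gt0 j_lt] /(congr1 val) /=; rewrite iter_f -[RHS]rP => /esym.
  move/(phi_eq _ _ I I); rewrite mulgA => Hj.
  have conj_pow m : ((r i)^-1 * x ^+ j * r i) ^+ m
                    = (r i)^-1 * (x ^+ j) ^+ m * r i.
    elim: m => [|m IH]; first by rewrite mulg1 mulVg.
    by rewrite expgS IH !mulgA mulgK expgS !mulgA.
  have E : (r i)^-1 * x ^+ j * r i = 1.
    by apply: (H_tf _ d Hj d_gt0);
      rewrite conj_pow -expgnAC xd1 expg1n mulg1 mulVg.
  have xj : x ^+ j = 1.
    by apply: (mulgI (r i)^-1); apply: (mulIg (r i)); rewrite E mulg1 mulVg.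
  by have := dmin j j_gt0 xj; rewrite leqNgt j_lt.
have f_inj : injective f.
  have fK : cancel f (iter d.-1 f).
    by move=> i; rewrite -iterSr prednK.
  exact: can_inj fK.
have f_order i : order f i = d.
  apply/eqP; rewrite eqn_leq; apply/andP; split.
    rewrite -size_orbit -(size_traject f i d).
    apply: uniq_leq_size (orbit_uniq f i) _ => y; rewrite -fconnect_orbit.
    move=> /iter_findex <-; apply/trajectP.
    exists (findex f i y %% d)%N; first by rewrite ltn_mod.
    rewrite {1}(divn_eq (findex f i y) d) addnC iterD; congr iter.
    by elim: (_ %/ d)%N => // m IH; rewrite mulSn iterD IH f_per.
  rewrite leqNgt; apply/negP => lt_d.
  by apply: (f_free i (order f i)); rewrite ?order_gt0 ?lt_d // iter_order.
rewrite -(card_ord k) -(@fcard_order_set _ f f_inj d) ?dvdn_mull //.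
by apply/fintype.subsetP => i _; rewrite inE f_order.
Qed.

(** * The quotient by the center *)

Section CenterProjection.
Local Open Scope quotient_scope.
Variable G : groupType.

Definition proj (x : G) : center_quot G := \pi x.

Lemma proj_morph : morph proj.
Proof. by move=> x y; rewrite /proj -qmulE. Qed.

Lemma proj_eq x y : proj x = proj y <-> center G (x^-1 * y).
Proof. by split=> [/eqP/center_quotP|/center_quotP/eqP]. Qed.

Lemma proj_eq1 x : proj x = 1 <-> center G x.
Proof.
rewrite -(morph1 proj_morph); split=> [/esym/proj_eq|xZ];
  first by rewrite invg1 mul1g.
by apply/esym/proj_eq; rewrite invg1 mul1g.
Qed.

Lemma proj_surj b : exists x, proj x = b.
Proof. by exists (repr b); exact: reprK. Qed.

Lemma center_subgroup : is_subgroup (center G).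
Proof. by split; [exact: center1|exact: centerM|exact: centerV]. Qed.

End CenterProjection.

(* (n1 - 1) / k1 is minus the rational Euler characteristic of G. *)
Lemma euler_characteristic (G : groupType) (H1 H2 : set G) k1 k2 n1 n2 :
  is_subgroup H1 -> is_subgroup H2 -> has_index setT H1 k1 ->
  has_index setT H2 k2 -> subgroup_isog (free_group n1) H1 ->
  subgroup_isog (free_group n2) H2 ->
  ((Posz n1 - 1) * Posz k2 = (Posz n2 - 1) * Posz k1)%R.
Proof.
move=> HH1 HH2 i1 i2 f1 f2.
have [l1 [l2 [j1 j2 kl]]] := has_index_inter (@subgroupT G) HH1 HH2
  (@subsetT _ _) (@subsetT _ _) i1 i2.
have HI := subgroupI HH1 HH2.
have [r1 g1 e1] := schreier HI (@subIsetl _ _ _) f1 j1.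
have [r2 g2 e2] := schreier HI (@subIsetr _ _ _) f2 j2.
have r12 := subgroup_isog_rank g1 g2; rewrite {}r12 in e1.
have l1_gt0 : (0 < l1)%N by apply: (has_index_gt0 HI _ j1); case: HH1.
have l2_gt0 : (0 < l2)%N by apply: (has_index_gt0 HI _ j2); case: HH2.
have k1_gt0 := has_index_gt0 HH1 I i1; have k2_gt0 := has_index_gt0 HH2 I i2.
have E1 : ((Posz n1 - 1) * l1 = (Posz n2 - 1) * l2)%R by nia.
have l1Z : Posz l1 != 0%R by lia.
have kl' : (Posz k1 * l1 = k2 * l2)%R by lia.
have k2Z : Posz k2 != 0%R by lia.
apply: (mulIf l1Z); rewrite mulrAC E1 -[RHS]mulrA kl'; ring.
Qed.

(** * The invariants kappa and epsilon, and the equivalences *)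

Section Final.
Variables (G : groupType) (theta : G -> Zgroup) (t : G) (r : nat).
Hypotheses (thetaM : morph theta) (theta_t : theta t = (1%R : int))
  (r_gt1 : (1 < r)%N)
  (kerF : subgroup_isog (free_group r) [set g | theta g = 1])
  (G_gen : forall S : set G, is_subgroup S -> (forall g, theta g = 1 -> S g) ->
        (forall a m, (0 < m)%N -> center G (a ^+ m) -> S a) -> forall g, S g)
  (Z_nontriv : exists z : G, center G z /\ z <> 1).

Let N := [set g | theta g = 1].
Let NN : is_subgroup N := morph_kernel_subgroup thetaM.
Let NF : hereditarily_free N := free_isog_hereditarily_free kerF.

Lemma heightM x y : (theta (x * y) : int) = (theta x + theta y)%R.
Proof. by rewrite thetaM. Qed.

Lemma heightV x : (theta x^-1 : int) = (- theta x)%R.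
Proof. by rewrite (morphV thetaM). Qed.

Lemma heightX x i : (theta (zexp x i) : int) = (i * theta x)%R.
Proof. by rewrite (morph_zexp _ _ thetaM) zexp_Zgroup. Qed.

Lemma center_height1 x : center G x -> theta x = 1 -> x = 1.
Proof.
by move=> xZ x1; apply: (free_centerless NN kerF r_gt1 x1) => y _; exact: xZ.
Qed.

Lemma torsion_free (x : G) m : (0 < m)%N -> x ^+ m = 1 -> x = 1.
Proof.
move=> m_gt0 xm; apply: (free_torsion NN NF _ m_gt0 xm).
have : (theta (zexp x m) : int) = 0%R by rewrite /= xm (morph1 thetaM).
rewrite heightX => /eqP; rewrite mulf_eq0 => /orP[|/eqP //].
by rewrite -[_ == _]/(m == 0%N) eqn0Ngt m_gt0.
Qed.

(** The height is injective on the center, which is thus infinite cyclic like its non-trivial image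
    in the integers. *)
Lemma center_generator : exists (c : G) (L : nat), [/\ (0 < L)%N, center G c,
  (theta c : int) = L & forall x, center G x -> exists i, x = zexp c i].
Proof.
have DD := morph_image_subgroup thetaM (center_subgroup G).
have [L LE] := Zgroup_subgroup DD.
have [c cZ cL] : (theta @` center G) (Posz L) by rewrite LE /=.
have [z [zZ z1]] := Z_nontriv.
exists c, L; split=> //.
  rewrite lt0n; apply/eqP => L0; apply: z1; apply: center_height1 => //.
  have : (theta @` center G) (theta z) by exists z.
  by rewrite LE /= L0 dvd0z => /eqP.
move=> x xZ; have : (theta @` center G) (theta x) by exists x.
rewrite LE /= => /dvdzP[i xi]; exists i.
apply: divg1_eq; apply: center_height1.
  exact: centerM xZ (centerV (zexp_in i (center_subgroup G) cZ)).
by rewrite -[LHS]/(theta _ : int) heightM heightV heightX cL xi subrr.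
Qed.

Variables (c : G) (L : nat).
Hypotheses (L_gt0 : (0 < L)%N) (cZ : center G c) (c_height : (theta c :
  int) = L)
  (c_gen : forall x, center G x -> exists i, x = zexp c i).

Lemma center_height x : center G x -> (L %| (theta x : int))%Z.
Proof. by move=> /c_gen[i ->]; rewrite heightX c_height dvdz_mull. Qed.

Let NQ := @proj G @` N.

Lemma kernel_image_subgroup : is_subgroup NQ.
Proof. exact (morph_image_subgroup (@proj_morph G) NN). Qed.

Lemma kernel_image_isog : subgroup_isog (free_group r) NQ.
Proof.
have [f [fM f_inj fN]] := (subgroup_isogP _ _).1 kerF.
apply/subgroup_isogP; exists (@proj G \o f).
have pfM := morph_comp fM (@proj_morph G); split=> //.
  apply: (morph_inj pfM) => w /proj_eq1 fw; apply: f_inj.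
  rewrite (morph1 fM); apply: center_height1 => //.
  by have : range f (f w) by [exists w]; rewrite fN.
have -> : range (@proj G \o f) = @proj G @` range f by rewrite image_comp.
by rewrite fN.
Qed.

(** Powers of c adjust the height by multiples of L without changing the class modulo the center. *)
Lemma kernel_imageP x : NQ (proj x) <-> (L %| (theta x : int))%Z.
Proof.
split=> [[g Ng /proj_eq gx]|/dvdzP[i xi]].
  have := center_height gx; rewrite heightM heightV.
  by rewrite [theta g]Ng oppr0 add0r.
exists (x * zexp c (- i)%R).
  rewrite /N /= -[LHS]/(theta _ : int) heightM heightX c_height xi.
  by rewrite mulNr subrr.
apply/proj_eq; rewrite invgM -mulgA mulVg mulg1 -zexpN opprK.
exact: (zexp_in _ (center_subgroup G) cZ).
Qed.

Lemma kernel_image_index : has_index setT NQ L.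
Proof.
have [DD DL] := has_index_height thetaM theta_t L_gt0.
have -> : [set: center_quot G] = @proj G @` setT.
  by rewrite eqEsubset; split=> // b _; have [x xb] := proj_surj b; exists x.
apply/(has_index_image L (@proj_morph G) (@subgroupT G) DD
  kernel_image_subgroup).
  by move=> x _; exact: iff_sym (kernel_imageP x).
exact: DL.
Qed.

Lemma kernel_image_torsion_free b m : NQ b -> (0 < m)%N -> b ^+ m = 1 -> b = 1.
Proof.
apply: free_torsion; first exact: kernel_image_subgroup.
exact: free_isog_hereditarily_free kernel_image_isog.
Qed.

Lemma proj_exp (x : G) m : proj x ^+ m = proj (x ^+ m).
Proof. by have := morph_zexp x (Posz m) (@proj_morph G). Qed.

(** Orders divide L because L-th powers lie in the torsion-free [NQ]. Conversely, let m be a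
    multiple of all orders. The g for which L divides m * theta g form a subgroup; it contains the
    kernel, and each a with a central power, since a^m is then central. Hence it contains t, of
    height 1. *)
Lemma center_quot_lcm : is_lcm [set d | exists b : center_quot G,
  has_order b d] L.
Proof.
split=> [d [b bd]|m m_mult].
  apply: (has_order_dvd bd); have [x xb] := proj_surj b; rewrite -xb proj_exp.
  have [d_gt0 b1 _] := bd; apply: (kernel_image_torsion_free _ d_gt0).
    by apply/kernel_imageP;
      rewrite -[_ ^+ _]/(zexp x (Posz L)) heightX dvdz_mulr.
  by rewrite -proj_exp expgnAC xb b1 expg1n.
have Lm (g : G) : (L %| (Posz m * (theta g : int))%R)%Z.
  apply: (G_gen (S := [set g | (L %| (Posz m * (theta g : int))%R)%Z])).
  - split=> [|x y /= xL yL|x /= xL].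
    + by rewrite /= (morph1 thetaM) mulr0 dvdz0.
    + by rewrite heightM mulrDr rpredD.
    + by rewrite heightV mulrN rpredN.
  - by move=> x /= ->; rewrite mulr0 dvdz0.
  - move=> a k k_gt0 ak; have pak : proj a ^+ k = 1 by rewrite proj_exp;
    exact/proj_eq1.
    have [d ad] := has_order_exists k_gt0 pak.
    have /dvdnP[l ml] : (d %| m)%N by apply: m_mult; exists (proj a).
    have : center G (a ^+ m).
      apply/proj_eq1; rewrite -proj_exp ml mulnC expgnA.
      by have [_ -> _] := ad; rewrite expg1n.
    by move=> /center_height; rewrite -[_ ^+ _]/(zexp a (Posz m)) heightX.
by have := Lm t; rewrite theta_t mulr1.
Qed.

Lemma kappaE : kappa G = L.
Proof.
apply: xget_unique; first exact: center_quot_lcm.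
move=> l [l_mult l_min]; have [L_mult L_min] := center_quot_lcm.
by apply/eqP; rewrite eqn_dvd l_min // L_min.
Qed.

Lemma free_subgroup_rank (H : set (center_quot G)) k n : is_subgroup H ->
  has_index setT H k ->
  subgroup_isog (free_group n) H ->
  (L %| k)%N /\ ((Posz n - 1) * L = (Posz r - 1) * k)%R.
Proof.
move=> HH Hk iso; split; last first.
  exact: euler_characteristic HH kernel_image_subgroup Hk kernel_image_index
    iso kernel_image_isog.
have [_] := center_quot_lcm; apply=> d [b bd].
apply: (order_dvd_index HH _ Hk bd) => y m Hy.
exact (free_torsion HH (free_isog_hereditarily_free iso) Hy).
Qed.

(** A free subgroup of rank s has index m L for some m > 0, and then s - 1 = (r - 1) m. *)
Lemma epsilonE : epsilon G = (Posz r - 1)%R.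
Proof.
have rP : finite_index_free_rank (center_quot G) r.
  exists NQ; split; [exact: kernel_image_subgroup| |exact: kernel_image_isog].
  by exists L; exact: kernel_image_index.
have r_min s : finite_index_free_rank (center_quot G) s -> (r <= s)%N.
  move=> [H [HH [k Hk] iso]];
    have [/dvdnP[m km] E] := free_subgroup_rank HH Hk iso.
  have k_gt0 := has_index_gt0 HH I Hk.
  have m_gt0 : (0 < m)%N by move: k_gt0; rewrite km; case: (m).
  have LZ : Posz L != 0%R by lia.
  have {}E : (Posz s - 1 = (Posz r - 1) * m)%R.
    by apply: (mulIf LZ); rewrite E km PoszM mulrA.
  by nia.
rewrite /epsilon; congr (Posz _ - 1)%R; apply: xget_unique; first by split.
by move=> s [sP s_min]; apply/eqP; rewrite eqn_leq s_min // r_min.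
Qed.

(** Inside [NQ], of index L, take the words whose total exponent is a multiple of m; Schreier's
    formula gives the rank. *)
Lemma index_free_subgroup m : (0 < m)%N -> exists H : set (center_quot G),
  [/\ is_subgroup H, has_index setT H (L * m)
    & subgroup_isog (free_group (m * (r - 1) + 1)) H].
Proof.
move=> m_gt0; have [f [fM f_inj fN]] :=
  (subgroup_isogP _ _).1 kernel_image_isog.
pose i0 : 'I_r := Ordinal (ltnW r_gt1).
have [h [hM h_l]] := free_group_universal (fun=> (1%R : int) : Zgroup) (n := r).
have [DD Dm] := has_index_height hM (h_l i0) m_gt0.
have HH := morph_image_subgroup fM DD; set H := f @` _ in HH.
have HN : H `<=` NQ by move=> _ [w _ <-]; rewrite -fN; exists w.
have Hm : has_index NQ H m.
  rewrite -fN; apply/(has_index_image m fM (@subgroupT _) DD HH);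
    last exact: Dm.
  by move=> w _; split=> [Dw|[w' Dw' /f_inj <-] //]; exists w.
exists H; split=> //.
  apply: (has_index_mul (@subgroupT _) kernel_image_subgroup HH HN) => //.
  exact: kernel_image_index.
have [s iso sm] := schreier HH HN kernel_image_isog Hm.
by have -> : (m * (r - 1) + 1)%N = s by nia.
Qed.

(** H is free, so the central extension over it splits: [s] is a section, and the preimage is the
    direct product of its image with the powers of c. *)
Lemma lift_free_subgroup (H : set (center_quot G)) k n : is_subgroup H ->
  has_index setT H k ->
  subgroup_isog (free_group n) H ->
  [/\ is_subgroup (@proj G @^-1` H), has_index setT (@proj G @^-1` H) k,
      subgroup_isog (free_group n * Zgroup)%type (@proj G @^-1` H)
    & center G `<=` @proj G @^-1` H].
Proof.
move=> HH Hk /subgroup_isogP[f [fM f_inj fH]].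
have PH := morph_preimage_subgroup (@proj_morph G) HH.
have ZH : center G `<=` @proj G @^-1` H.
  by move=> x /proj_eq1 px; rewrite /= px; case: HH.
split=> //.
  apply/(has_index_image k (@proj_morph G) (@subgroupT G) PH HH) => //.
  rewrite (_ : _ @` _ = setT) // eqEsubset; split=> // b _.
  by have [x xb] := proj_surj b; exists x.
have /choice[y yP] : forall i, exists x, proj x = f (letter _ i).
  by move=> i; exact: proj_surj.
have [s [sM s_l]] := free_group_universal y.
have ps w : proj (s w) = f w.
  have -> // : f = @proj G \o s.
  apply: (morph_ext fM); first exact: morph_comp sM (@proj_morph G).
  by move=> i; rewrite /= s_l yP.
have ciZ i : center G (zexp c i) := zexp_in i (center_subgroup G) cZ.
pose F (x : (free_group n * Zgroup)%type) := s x.1 * zexp c x.2.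
have FM : morph F.
  move=> [w i] [w' i']; rewrite /F /= sM zexpD -!mulgA; congr (_ * _).
  by rewrite !mulgA ciZ.
apply/subgroup_isogP; exists F; split=> //.
  apply: (morph_inj FM) => -[w i]; rewrite /F /= => E.
  have w1 : w = 1.
    apply: f_inj; rewrite (morph1 fM) -ps; apply/proj_eq1.
    have -> : s w = (zexp c i)^-1 by apply: (mulIg (zexp c i)); rewrite E mulVg.
    exact/centerV/ciZ.
  have : (theta (zexp c i) : int) = 0%R.
    by move: E; rewrite w1 (morph1 sM) mul1g => ->; rewrite (morph1 thetaM).
  rewrite heightX c_height w1 => /eqP; rewrite mulf_eq0 => /orP[/eqP -> //|].
  by rewrite -[_ == _]/(L == 0%N) eqn0Ngt L_gt0.
rewrite eqEsubset; split=> [_ [[w i] _ <-]|x /= Hx].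
  rewrite /F /= proj_morph ps.
  have -> : proj (zexp c i) = 1 by exact/proj_eq1.
  by rewrite mulg1 -fH; exists w.
have [w _ fw] : range f (proj x) by rewrite fH.
have [i xi] : exists i, (s w)^-1 * x = zexp c i.
  by apply/c_gen/proj_eq; rewrite ps.
by exists (w, i) => //; rewrite /F /= -xi mulVKg.
Qed.

Lemma centralizer_finite_index (G0 : set G) k u : is_subgroup G0 ->
  has_index setT G0 k ->
  (forall x, G0 x -> commute u x) -> center G u.
Proof.
move=> GG0 G0k uG0.
have conjN g y : N y -> N (g * y * g^-1).
  by rewrite /N /= => y1; rewrite !thetaM (morphV thetaM) y1 mulg1 mulgV.
have conjE (g y : G) m : (g * y * g^-1) ^+ m = g * y ^+ m * g^-1.
  exact: (zexp_conj y g (Posz m)).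
have uN y : N y -> u * y * u^-1 = y.
  move=> Ny; have [m m_gt0 G0m] := has_index_power (@subgroupT G) GG0 G0k (I :
    setT y).
  apply: (free_root NN NF (conjN u y Ny) Ny m_gt0).
  by rewrite conjE uG0 // mulgK.
move=> g; pose u' := g * u * g^-1.
have u'N y : N y -> u' * y * u'^-1 = y.
  move=> Ny; rewrite /u' !invgM invgK !mulgA -[X in X * _^-1]mulgA.
  have := uN _ (conjN g^-1 y Ny); rewrite invgK => E.
  have := congr1 (fun x => g * x * g^-1) E.
  by rewrite /= !mulgA mulgV mul1g mulgK.
have : u^-1 * u' = 1.
  have Nuu : N (u^-1 * u').
    rewrite /N /= /u' !thetaM !(morphV thetaM).
    rewrite -[LHS]/(- (theta u : int) + (theta g + theta u + - (theta g :
      int)))%R.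
    by rewrite addrAC subrr add0r addNr.
  apply: (free_centerless NN kerF r_gt1 Nuu) => y Ny.
  have conj_commute (v x : G) : v * x * v^-1 = x -> commute x v.
    by move=> E; rewrite /commute -{1}E mulgVK.
  apply/commute_sym/commuteM; first exact/commuteV/conj_commute/uN.
  exact/conj_commute/u'N.
move=> /(congr1 ( *%g u)) /=; rewrite mulVKg mulg1 /u' => E.
by rewrite -{1}E mulgVK.
Qed.

(** H is the image of G0 and M = G0 Z its preimage. Then [M : G0] = [Z : G0 /\ Z] = j, which leaves
    k for the index of M. By [centralizer_finite_index], the center of G0 is central in G; as F_n is
    centerless, the projection kills exactly the factor Z of the product. *)
Lemma free_subgroup_of_product (G0 : set G) k j n : (0 < k)%N -> (0 < n)%N ->
  is_subgroup G0 -> subgroup_isog (free_group n * Zgroup)%type G0 ->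
  has_index (center G) (G0 `&` center G) j -> has_index setT G0 (k * j) ->
  exists H : set (center_quot G),
    [/\ is_subgroup H, has_index setT H k & subgroup_isog (free_group n) H].
Proof.
move=> k_gt0 n_gt0 GG0 /subgroup_isogP[f [fM f_inj fG0]] Zj G0k.
have ZG := center_subgroup G.
have G0f x : G0 (f x) by rewrite -fG0; exists x.
have fD w i : f (w, i) = f (w, 1) * f (1, i).
  by rewrite -fM; congr f; rewrite -[RHS]/(w * 1, 1 * i) mulg1 mul1g.
have central x : (forall y, commute x y) -> center G (f x).
  move=> xC; apply: (centralizer_finite_index GG0 G0k) => g.
  by rewrite -fG0 => -[y _ <-]; rewrite /commute -!fM xC.
have fiZ (i : Zgroup) : center G (f (1, i)).
  apply: central => -[w i']; rewrite /commute.
  rewrite -[LHS]/(1 * w, i * i') -[RHS]/(w * 1, i' * i) mul1g mulg1.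
  by congr (_, _); exact: (addrC (i : int) i').
(* Otherwise G0 is abelian, hence central in G. Elements of the height kernel have powers in G0,
   which are central of height 0, hence trivial; so the kernel would be trivial, against r > 1. *)
have n_gt1 : (1 < n)%N.
  rewrite ltnNge; apply/negP => n_le1;
    have [w w_gen] := free_group_cyclic n_le1.
  have G0Z : G0 `<=` center G.
    rewrite -fG0 => _ [[v i] _ <-]; apply: central => -[v' i'].
    rewrite /commute -[LHS]/(v * v', i * i') -[RHS]/(v' * v, i' * i).
    have [[a ->] [b ->]] := (w_gen v, w_gen v').
    congr (_, _); last exact: (addrC (i : int) i').
    by apply: commute_zexp2; exact: commute_refl.
  have [y free_y] := isog_free_on kerF; have [yN _ _] := free_y.
  have y1 i : y i = 1.
    have [m m_gt0 G0m] := has_index_power (@subgroupT G) GG0 G0k (I :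
      setT (y i)).
    apply: (torsion_free m_gt0); apply: center_height1; first exact: G0Z.
    exact: (zexp_in (Posz m) NN (yN i I)).
  have : (Ordinal (ltnW r_gt1)) = (Ordinal r_gt1) :> 'I_r.
    by apply: (free_on_commute free_y) => //; rewrite !y1; exact: commute_refl.
  by move/(congr1 val).
have fw1 w : center G (f (w, 1)) -> w = 1.
  move=> fwZ; apply: (@free_centerless n _ setT) => // [|y _].
    apply/subgroup_isogP; exists id; split=> //.
    by rewrite eqEsubset; split=> // x _; exists x.
  have : f (w * y, 1) = f (y * w, 1).
    have E (v v' : free_group n) : f (v * v', 1) = f (v, 1) * f (v', 1).
      by rewrite -fM; congr f; rewrite -[RHS]/(v * v', 1 * 1) mulg1.
    by rewrite !E fwZ.
  by move=> /f_inj[].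
pose H := @proj G @` G0.
have HH : is_subgroup H by exact (morph_image_subgroup (@proj_morph G) GG0).
pose M := @proj G @^-1` H.
have MM : is_subgroup M by exact (morph_preimage_subgroup (@proj_morph G) HH).
have G0M : G0 `<=` M by move=> x G0x; exists x.
have MP x : M x -> exists2 z, center G z & G0 (x * z).
  move=> [g G0g /proj_eq gx]; exists (g^-1 * x)^-1; first exact: centerV.
  by rewrite invgM invgK mulgA mulgV mul1g.
have [b G0b] : exists b, has_index M G0 b.
  have [b] := has_index_sub MM GG0 (@subsetT _ _) G0k.
  by rewrite setIidr //; exists b.
have [a Ma] : exists a, has_index setT M a.
  have [phi [phi_lt _ phi_eq]] := (has_indexP _ _ GG0).1 G0k.
  apply: (@bounded_has_index _ _ _ (k * j)%N phi MM) => [x _|x y _ _ xy].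
    exact: phi_lt.
  by apply: G0M; apply/(phi_eq x y I I).
(* Each coset of G0 in M = G0 Z meets the center, so a numbering of these cosets restricts to one
   for the center. *)
have bj : b = j.
  apply: (@has_index_uniq _ (center G) (G0 `&` center G)) => //.
  have [phi [phi_lt phi_surj phi_eq]] := (has_indexP _ _ GG0).1 G0b.
  have ZM : center G `<=` M.
    by move=> z zZ; rewrite /M /= (proj_eq1 z).2 //; case: HH.
  apply/has_indexP; first exact: subgroupI.
  exists phi; split=> [x /ZM /phi_lt //|i /phi_surj[x Mx <-]|x y xZ yZ].
    have [z zZ G0xz] := MP x Mx; exists z^-1; first exact: centerV.
    have zVZ := centerV zZ; apply/(phi_eq _ _ (ZM _ zVZ) Mx).
    by rewrite invgK zZ.
  rewrite (phi_eq _ _ (ZM _ xZ) (ZM _ yZ)); split=> [G0xy|[//]].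
  by split=> //; exact: centerM (centerV xZ) yZ.
have ak : a = k.
  have j_gt0 : (0 < j)%N by apply: (has_index_gt0 _ _ Zj);
    [exact: subgroupI|case: ZG].
  have := has_index_uniq G0k
    (has_index_mul (@subgroupT G) MM GG0 G0M (@subsetT _ _) Ma G0b).
  by rewrite bj => /eqP; rewrite eqn_pmul2r // => /eqP.
exists H; split=> //.
  have -> : [set: center_quot G] = @proj G @` setT.
    by rewrite eqEsubset; split=> // q _; have [x xq] := proj_surj q; exists x.
  by rewrite -ak; apply/(has_index_image a (@proj_morph G) (@subgroupT G) MM
    HH).
apply/subgroup_isogP; exists (fun w => proj (f (w, 1))).
have gM : morph (fun w => proj (f (w, 1))).
  by move=> v v'; rewrite -proj_morph -fM; congr (proj (f _));
    rewrite -[RHS]/(v * v', 1 * 1) mulg1.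
split=> //; first by apply: (morph_inj gM) => w /proj_eq1 /fw1.
rewrite eqEsubset; split=> [_ [w _ <-]|_ [x G0x <-]];
  first by exists (f (w, 1)).
move: G0x; rewrite -fG0 => -[[w i] _ <-]; exists w => //.
by rewrite fD proj_morph (proj_eq1 (f (1, i))).2 // mulg1.
Qed.

Lemma index_multiple_free k n : (0 < k)%N -> (0 < n)%N ->
  ((exists m : int, Posz k = (m * Posz (kappa G))%R /\
      (Posz n - 1)%R = (m * epsilon G)%R) <->
   exists H : set (center_quot G),
    [/\ is_subgroup H, has_index setT H k & subgroup_isog (free_group n) H]).
Proof.
move=> k_gt0 n_gt0; rewrite kappaE epsilonE; split.
  move=> [m [km nm]]; have m_gt0 : (0 < m)%R by nia.
  have mE : m = Posz `|m|%N by lia.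
  have [|H [HH Hk iso]] := @index_free_subgroup `|m|%N; first by lia.
  exists H; split=> //; first by have -> : k = (L * `|m|)%N by nia.
  by have -> : n = (`|m| * (r - 1) + 1)%N by nia.
move=> [H [HH Hk iso]]; have [/dvdnP[m km] E] := free_subgroup_rank HH Hk iso.
exists (Posz m); split; first by rewrite km.
have LZ : Posz L != 0%R by lia.
by apply: (mulIf LZ); rewrite E km PoszM; ring.
Qed.

End Final.

Theorem theorem7p3 (G : groupType) (k n : nat)
  (G_GBS : is_GBS G) (G_nonelem : non_elementary G)
  (Z_nontriv : exists z : G, center G z /\ z <> 1)
  (k_gt0 : (0 < k)%N) (n_gt0 : (0 < n)%N) :
  [<-> exists m : int,
         Posz k = (m * Posz (kappa G))%R /\
         (Posz n - 1)%R = (m * epsilon G)%R;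
       exists H : set (center_quot G),
         [/\ is_subgroup H, has_index setT H k
           & subgroup_isog (free_group n) H];
       exists G0 : set G,
         [/\ is_subgroup G0, has_index setT G0 k,
             subgroup_isog (free_group n * Zgroup)%type G0
           & center G `<=` G0];
       exists G0 : set G,
         [/\ is_subgroup G0, subgroup_isog (free_group n * Zgroup)%type G0
           & exists j : nat, has_index (center G) (G0 `&` center G) j /\
                             has_index setT G0 (k * j)%N]].
Proof.
have [theta [t [r [thM tht r_gt1 kerF gen]]]] :=
  gbs_structure G_GBS G_nonelem Z_nontriv.
have [c [L [L_gt0 cZ cL c_gen]]] := center_generator thM r_gt1 kerF Z_nontriv.
have P12 := index_multiple_free thM tht r_gt1 kerF gen L_gt0 cZ cL c_gen k_gt0
  n_gt0.
tfae.
- exact: P12.1.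
- move=> [H [HH Hk iso]]; exists (@proj G @^-1` H).
  by have [] := lift_free_subgroup thM L_gt0 cZ cL c_gen HH Hk iso.
(* The center lies in G0, so the correcting index is 1. *)
- move=> [G0 [GG0 G0k iso ZG0]]; exists G0; split=> //; exists 1%N.
  rewrite setIidr // muln1; split=> //.
  by apply: has_index_refl; exact: center_subgroup.
- move=> [G0 [GG0 iso [j [Zj G0k]]]]; apply: P12.2.
  exact (free_subgroup_of_product thM r_gt1 kerF k_gt0 n_gt0 GG0 iso Zj G0k).
Qed.
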